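(* Assume that there is $C>0$ such that $$d_n+a_n\ge C r_n\quad\text{for all } n\in\mathbb N,$$ and that $$\limsup_{n\to\infty}\frac{a_n}{d_n}<\infty.$$ Then the semigroup $\{S_G(t)\}_{t\ge0}$ generated by $(A+B,D(A))$ is analytic on $X$. If, in addition, $$\liminf_{n\to\infty}\theta_n=\infty,$$ then $\{S_G(t)\}_{t\ge0}$ is immediately compact.
   Context: Indices $n,i,j$ range over the positive integers. Let $(r_i)_{i\ge1},(d_i)_{i\ge1},(a_i)_{i\ge1}$ be real sequences with $r_i>0$ and $d_i\ge0$ for all $i\ge 1$, $a_1=0$, and $a_i>0$ for $i\ge2$. Let $b_{i,j}\ge0$ satisfy $b_{i,j}=0$ for $i\ge j$ and $\sum_{i=1}^{j-1} i\,b_{i,j}=j$ for all $j\ge2$. Put $\theta_i=r_i+a_i+d_i$ and $p_i=a_i+d_i$. Let $X=\{f=(f_n)_{n\ge1}:\ \|f\|=\sum_{n=1}^\infty n|f_n|<\infty\}$ (for analyticity, $X$ is taken over $\mathbb C$). For sequences $x,y$ write $xy=(x_ny_n)_n$. For a sequence $f$ let $\triangle f=(f_1,(f_{n-1}-f_n)_{n\ge2})$. The decay operator $A$ is $[Af]_i=r_{i+1}f_{i+1}-\theta_i f_i$, $i\ge1$, with domain $$D(A)=\{f\in X:\ pf\in X,\ \triangle(rf)\in X,\ \lim_{n\to\infty}r_nf_n=0\}.$$ The operator $B$ is $[Bf]_i=\sum_{j=i+1}^\infty a_jb_{i,j}f_j$, $i\ge1$, considered on $D(A)$, where it takes values in $X$.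 The closure $G$ of $(A+B,D(A))$ generates a $C_0$-semigroup $\{S_G(t)\}_{t\ge0}$ of positive contractions on $X$, and under the condition $\limsup_{n\to\infty}a_n/d_n<\infty$ one has $D(G)=D(A)$, i.e. $G=A+B$. This condition is understood to include that $d_n>0$ for all sufficiently large $n$. Immediately compact means that $S_G(t)$ is a compact operator for every $t>0$. *)

(* Defs.v *)
From Stdlib Require Import Reals Lra FunctionalExtensionality ProofIrrelevance.
From Coquelicot Require Import Coquelicot.
Open Scope R_scope.

(** A sequence [(f_n)_(n >= 1)] is a function on [nat] whose irrelevant entry of
    index 0 is required to be 0, so that indices agree with the usual ones. *)

Definition inX (f : nat -> C) : Prop :=
  f 0%nat = 0%C /\ ex_series (fun n => INR n * Cmod (f n)).

Record X := mkX { Xseq :> nat -> C; XseqP : inX Xseq }.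

Lemma X_ext (f g : X) : (forall n, f n = g n) -> f = g.
Proof.
destruct f as [f Hf], g as [g Hg]; simpl; intros H.
assert (E : f = g) by now apply functional_extensionality.
subst g; f_equal; apply proof_irrelevance.
Qed.

Lemma inX_le (f : nat -> C) (u : nat -> R) :
  f 0%nat = 0%C -> ex_series u ->
  (forall n, INR n * Cmod (f n) <= u n) -> inX f.
Proof.
intros H0 Hu H; split; [exact H0|].
apply (ex_series_le (K := R_AbsRing) (V := R_CompleteNormedModule)) with (b := u);
  [|exact Hu].
intros n; change (Rabs (INR n * Cmod (f n)) <= u n).
rewrite Rabs_pos_eq; [apply H|].
apply Rmult_le_pos; [apply pos_INR | apply Cmod_ge_0].
Qed.

Lemma inX_zero : inX (fun _ => 0%C).
Proof.
apply inX_le with (u := fun _ => 0).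
- reflexivity.
- exists 0.
  apply filterlim_ext with (f := fun _ : nat => 0); [|apply filterlim_const].
  intros n; symmetry; rewrite sum_n_const; ring.
- intros n; rewrite Cmod_0; lra.
Qed.

Lemma X_term_add (f g : nat -> C) n :
  INR n * Cmod (f n + g n)%C <= INR n * Cmod (f n) + INR n * Cmod (g n).
Proof.
rewrite <- Rmult_plus_distr_l.
apply Rmult_le_compat_l; [apply pos_INR | apply Cmod_triangle].
Qed.

Lemma inX_add (f g : nat -> C) : inX f -> inX g -> inX (fun n => (f n + g n)%C).
Proof.
intros [F0 F] [G0 G].
apply inX_le with (u := fun n => INR n * Cmod (f n) + INR n * Cmod (g n)).
- rewrite F0, G0; ring.
- exact (ex_series_plus _ _ F G).
- apply X_term_add.
Qed.

Lemma inX_scale (k : C) (f : nat -> C) : inX f -> inX (fun n => (k * f n)%C).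
Proof.
intros [F0 F].
apply inX_le with (u := fun n => Cmod k * (INR n * Cmod (f n))).
- rewrite F0; ring.
- exact (ex_series_scal_l (Cmod k) _ F).
- intros n; rewrite Cmod_mult; right; ring.
Qed.

Lemma inX_opp (f : nat -> C) : inX f -> inX (fun n => (- f n)%C).
Proof.
intros [F0 F].
apply inX_le with (u := fun n => INR n * Cmod (f n)).
- rewrite F0; ring.
- exact F.
- intros n; rewrite Cmod_opp; right; ring.
Qed.

Definition X_zero : X := mkX _ inX_zero.
Definition X_plus (f g : X) : X := mkX _ (inX_add f g (XseqP f) (XseqP g)).
Definition X_opp (f : X) : X := mkX _ (inX_opp f (XseqP f)).
Definition X_scal (k : C) (f : X) : X := mkX _ (inX_scale k f (XseqP f)).
Definition X_norm (f : X) : R := Series (fun n => INR n * Cmod (f n)).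

Lemma X_plus_comm (f g : X) : X_plus f g = X_plus g f.
Proof. apply X_ext; intros n; simpl; ring. Qed.

Lemma X_plus_assoc (f g h : X) : X_plus f (X_plus g h) = X_plus (X_plus f g) h.
Proof. apply X_ext; intros n; simpl; ring. Qed.

Lemma X_plus_zero (f : X) : X_plus f X_zero = f.
Proof. apply X_ext; intros n; simpl; ring. Qed.

Lemma X_plus_opp (f : X) : X_plus f (X_opp f) = X_zero.
Proof. apply X_ext; intros n; simpl; ring. Qed.

Definition X_AbelianMonoid_mixin :=
  AbelianMonoid.Mixin X X_plus X_zero X_plus_comm X_plus_assoc X_plus_zero.
Canonical X_AbelianMonoid := AbelianMonoid.Pack X X_AbelianMonoid_mixin X.
Definition X_AbelianGroup_mixin := AbelianGroup.Mixin X_AbelianMonoid X_opp X_plus_opp.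
Canonical X_AbelianGroup :=
  AbelianGroup.Pack X (AbelianGroup.Class X X_AbelianMonoid_mixin X_AbelianGroup_mixin) X.

Lemma X_scal_assoc (k l : C) (f : X) : X_scal k (X_scal l f) = X_scal (k * l)%C f.
Proof. apply X_ext; intros n; simpl; ring. Qed.

Lemma X_scal_one (f : X) : X_scal 1%C f = f.
Proof. apply X_ext; intros n; simpl; ring. Qed.

Lemma X_scal_plus_r (k : C) (f g : X) :
  X_scal k (X_plus f g) = X_plus (X_scal k f) (X_scal k g).
Proof. apply X_ext; intros n; simpl; ring. Qed.

Lemma X_scal_plus_l (k l : C) (f : X) :
  X_scal (k + l)%C f = X_plus (X_scal k f) (X_scal l f).
Proof. apply X_ext; intros n; simpl; ring. Qed.

Definition X_ModuleSpace_mixin :=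
  ModuleSpace.Mixin C_Ring X_AbelianGroup X_scal
    X_scal_assoc X_scal_one X_scal_plus_r X_scal_plus_l.
Canonical X_ModuleSpace :=
  ModuleSpace.Pack C_Ring X
    (ModuleSpace.Class C_Ring X (AbelianGroup.class X_AbelianGroup) X_ModuleSpace_mixin) X.

Lemma X_norm_triangle (f g : X) : X_norm (X_plus f g) <= X_norm f + X_norm g.
Proof.
unfold X_norm.
rewrite <- Series_plus; [|apply XseqP|apply XseqP].
apply Series_le.
- intros n; split; [|apply X_term_add].
  apply Rmult_le_pos; [apply pos_INR | apply Cmod_ge_0].
- exact (ex_series_plus _ _ (proj2 (XseqP f)) (proj2 (XseqP g))).
Qed.

Lemma X_norm_scal (k : C) (f : X) : X_norm (X_scal k f) = Cmod k * X_norm f.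
Proof.
unfold X_norm; rewrite <- Series_scal_l; apply Series_ext; intros n.
simpl; rewrite Cmod_mult; ring.
Qed.

Lemma X_norm_zero : X_norm X_zero = 0.
Proof.
rewrite <- (Rmult_0_l (X_norm X_zero)), <- Cmod_0, <- X_norm_scal.
f_equal; apply X_ext; intros n; simpl; ring.
Qed.

Lemma X_norm_opp (f : X) : X_norm (X_opp f) = X_norm f.
Proof. unfold X_norm; apply Series_ext; intros n; simpl; now rewrite Cmod_opp. Qed.

Lemma X_norm_term (f : X) n : INR n * Cmod (f n) <= X_norm f.
Proof.
assert (P : forall k, 0 <= INR k * Cmod (f k))
  by (intros k; apply Rmult_le_pos; [apply pos_INR | apply Cmod_ge_0]).
pose proof (proj2 (XseqP f)) as E.
apply Rle_trans with (sum_n (fun k => INR k * Cmod (f k)) n).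
- destruct n as [|n].
  + rewrite sum_O; lra.
  + rewrite sum_Sn; change (INR (S n) * Cmod (f (S n)) <=
      sum_n (fun k => INR k * Cmod (f k)) n + INR (S n) * Cmod (f (S n))).
    assert (0 <= sum_n (fun k => INR k * Cmod (f k)) n); [|lra].
    rewrite sum_n_Reals; now apply cond_pos_sum.
- apply is_lim_seq_incr_compare; [exact (Series_correct _ E)|].
  intros m; rewrite sum_Sn.
  change (sum_n (fun k => INR k * Cmod (f k)) m <=
    sum_n (fun k => INR k * Cmod (f k)) m + INR (S m) * Cmod (f (S m))).
  specialize (P (S m)); lra.
Qed.

Lemma X_norm_eq0 (f : X) : X_norm f = 0 -> f = X_zero.
Proof.
intros H; apply X_ext; intros [|n].
- apply XseqP.
- simpl Xseq at 2; apply Cmod_eq_0.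
  pose proof (X_norm_term f (S n)) as T; rewrite H in T.
  pose proof (Cmod_ge_0 (f (S n))) as P.
  pose proof (lt_0_INR (S n) (Nat.lt_0_succ n)) as Q; nra.
Qed.

Definition X_ball (f : X) (eps : R) (g : X) : Prop := X_norm (X_plus g (X_opp f)) < eps.

Lemma X_ball_center (f : X) (eps : posreal) : X_ball f eps f.
Proof. unfold X_ball; rewrite X_plus_opp, X_norm_zero; apply cond_pos. Qed.

Lemma X_ball_sym (f g : X) (eps : R) : X_ball f eps g -> X_ball g eps f.
Proof.
unfold X_ball; intros H; rewrite <- X_norm_opp.
replace (X_opp (X_plus f (X_opp g))) with (X_plus g (X_opp f)); [exact H|].
apply X_ext; intros n; simpl; ring.
Qed.

Lemma X_ball_triangle (f g h : X) (e1 e2 : R) :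
  X_ball f e1 g -> X_ball g e2 h -> X_ball f (e1 + e2) h.
Proof.
unfold X_ball; intros H1 H2.
replace (X_plus h (X_opp f))
  with (X_plus (X_plus h (X_opp g)) (X_plus g (X_opp f))).
- eapply Rle_lt_trans; [apply X_norm_triangle|lra].
- apply X_ext; intros n; simpl; ring.
Qed.

Definition X_UniformSpace_mixin :=
  UniformSpace.Mixin X X_zero X_ball X_ball_center X_ball_sym X_ball_triangle.
Canonical X_UniformSpace := UniformSpace.Pack X X_UniformSpace_mixin X.
Canonical X_NormedModuleAux :=
  NormedModuleAux.Pack C_AbsRing X
    (NormedModuleAux.Class C_AbsRing X
       (ModuleSpace.class C_Ring X_ModuleSpace) X_UniformSpace_mixin) X.

Lemma X_norm_scal_le (k : C) (f : X) : X_norm (X_scal k f) <= Cmod k * X_norm f.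
Proof. right; apply X_norm_scal. Qed.

Lemma X_norm_ball1 (f g : X) (eps : R) :
  X_norm (X_plus g (X_opp f)) < eps -> X_ball f eps g.
Proof. exact (fun H => H). Qed.

Lemma X_norm_ball2 (f g : X) (eps : posreal) :
  X_ball f eps g -> X_norm (X_plus g (X_opp f)) < 1 * eps.
Proof. rewrite Rmult_1_l; exact (fun H => H). Qed.

Definition X_NormedModule_mixin :=
  NormedModule.Mixin C_AbsRing X_NormedModuleAux X_norm 1
    X_norm_triangle X_norm_scal_le X_norm_ball1 X_norm_ball2 X_norm_eq0.
Canonical X_NormedModule :=
  NormedModule.Pack C_AbsRing X
    (NormedModule.Class C_AbsRing X
       (NormedModuleAux.class C_AbsRing X_NormedModuleAux) X_NormedModule_mixin) X.

(** [is_linear] of Coquelicot means linear and bounded.  One-parameter families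
    are functions on [R]; only their values at [t >= 0] matter. *)

Definition C0_semigroup {V : NormedModule C_AbsRing} (S : R -> V -> V) : Prop :=
  (forall t, 0 <= t -> is_linear (S t)) /\
  (forall x, S 0 x = x) /\
  (forall t s x, 0 <= t -> 0 <= s -> S (t + s) x = S t (S s x)) /\
  (forall x, filterlim (fun t => S t x) (at_right 0) (locally x)).

(** Unbounded operators are represented by their graphs. *)
Definition generator {V : NormedModule C_AbsRing} (S : R -> V -> V) (x y : V) : Prop :=
  filterlim (fun t => scal (RtoC (/ t)) (minus (S t x) x)) (at_right 0) (locally y).

Definition graph_closure {V : NormedModule C_AbsRing} (Gamma : V -> V -> Prop)
    (x y : V) : Prop :=
  forall eps, 0 < eps ->
    exists x' y', Gamma x' y' /\ norm (minus x' x) < eps /\ norm (minus y' y) < eps.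

Definition closure_generates {V : NormedModule C_AbsRing} (Gamma : V -> V -> Prop)
    (S : R -> V -> V) : Prop :=
  C0_semigroup S /\ forall x y, generator S x y <-> graph_closure Gamma x y.

(** The open sector of the nonzero [z] with [|arg z| < delta]. *)
Definition sector (delta : R) (z : C) : Prop :=
  exists rho phi, 0 < rho /\ Rabs phi < delta /\ z = (rho * cos phi, rho * sin phi).

(** Complex differentiability at [z] for the operator norm. *)
Definition op_differentiable {V : NormedModule C_AbsRing} (T : C -> V -> V) (z : C) : Prop :=
  exists L : V -> V, is_linear L /\
    forall eps, 0 < eps -> exists eta, 0 < eta /\
      forall h : C, Cmod h < eta -> forall x,
        norm (minus (minus (T (z + h)%C x) (T z x)) (scal h (L x)))
          <= eps * Cmod h * norm x.

Definition analytic_semigroup {V : NormedModule C_AbsRing} (S : R -> V -> V) : Prop :=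
  exists delta, 0 < delta <= PI / 2 /\ exists T : C -> V -> V,
    (forall t x, 0 <= t -> T (RtoC t) x = S t x) /\
    (forall z, sector delta z -> is_linear (T z)) /\
    (forall z w x, sector delta z -> sector delta w -> T (z + w)%C x = T z (T w x)) /\
    (forall z, sector delta z -> op_differentiable T z) /\
    (forall delta' x, 0 < delta' < delta ->
       filterlim (fun z => T z x) (within (sector delta') (locally (RtoC 0))) (locally x)).

Definition compact_operator {V : NormedModule C_AbsRing} (T : V -> V) : Prop :=
  is_linear T /\
  forall u : nat -> V, (exists M, forall k, norm (u k) <= M) ->
    exists (sigma : nat -> nat) (y : V),
      (forall k, (sigma k < sigma (S k))%nat) /\
      filterlim (fun k => T (u (sigma k))) eventually (locally y).

Definition immediately_compact {V : NormedModule C_AbsRing} (S : R -> V -> V) : Prop :=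
  forall t, 0 < t -> compact_operator (S t).

Definition theta (r a d : nat -> R) (i : nat) : R := r i + a i + d i.
Definition death (a d : nat -> R) (i : nat) : R := a i + d i.

Definition seqmul (x : nat -> R) (f : nat -> C) (n : nat) : C := (RtoC (x n) * f n)%C.

Definition triangle (f : nat -> C) (n : nat) : C :=
  match n with
  | O => 0%C
  | S O => f 1%nat
  | S m => (f m - f n)%C
  end.

(** Coquelicot's total [Series] is real-valued only; for a convergent complex
    series this componentwise value is the sum. *)
Definition CSeries (u : nat -> C) : C :=
  (Series (fun k => Re (u k)), Series (fun k => Im (u k))).

Definition decay_op (r a d : nat -> R) (f : nat -> C) (i : nat) : C :=
  match i with
  | O => 0%C
  | S _ => (RtoC (r (S i)) * f (S i) - RtoC (theta r a d i) * f i)%C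
  end.

(** The summation variable is [j = i + 1 + k]. *)
Definition frag_op (a : nat -> R) (b : nat -> nat -> R) (f : nat -> C) (i : nat) : C :=
  match i with
  | O => 0%C
  | S _ => CSeries (fun k => let j := (i + 1 + k)%nat in
                             (RtoC (a j * b i j) * f j)%C)
  end.

Definition decay_domain (r a d : nat -> R) (f : X) : Prop :=
  inX (seqmul (death a d) f) /\
  inX (triangle (seqmul r f)) /\
  filterlim (seqmul r f) eventually (locally (RtoC 0)).

(** Graph of [(A + B, D(A))]; both sides of the equation vanish at index 0. *)
Definition decay_frag_graph (r a d : nat -> R) (b : nat -> nat -> R) (f g : X) : Prop :=
  decay_domain r a d f /\
  forall i, g i = (decay_op r a d f i + frag_op a b f i)%C.

(* Main.v *)
(** Write [G = A + B] in the unit vectors [e_j]: it is upper triangular, with diagonal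
    [- theta] and with off-diagonal column [j] of norm at most [(j - 1) r_j + j a_j].
    The two hypotheses bound this by [kappa * theta_j * j] with a single [kappa < 1], so
    [norm (f + h G f) <= norm f - c |h| norm (theta f)] for small [h] in a complex cone
    [q |h| <= Re h] with [kappa < q < 1].  As [G] preserves the span of [e_1, ..., e_J],
    the exponential [exp (z G) e_j] is that of a bounded operator, for every complex [z].
    Subdividing [z], the inequality gives that [exp (z G)] is a contraction on the cone
    and, since [norm (G exp (z G) f)] decreases along rays, that
    [c |z| norm (G exp (z G) f) <= norm f], with constants not depending on [J].
    Hence [f |-> sum_j f_j exp (z G) e_j] is a holomorphic semigroup on the cone, whose
    values have uniformly small tails when [theta] tends to infinity.  It agrees with the
    given semigroup on each [e_j] by a telescoping sum, the given semigroup being bounded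
    on bounded intervals by the uniform boundedness principle. *)

Require Import Defs.
From Stdlib Require Import Reals Lra Lia Psatz Factorial ClassicalEpsilon.
From Coquelicot Require Import Coquelicot.
Open Scope R_scope.

(** * Convergence in X *)

(** The norm of X is a weighted l^1 norm with norm e_j = j, so an operator is bounded by the
    supremum of norm (T e_j) / j and estimates can be made on single columns. The obstacle is that G
    is unbounded: each uniform inequality is proved for a bounded truncation, whose own norm and
    admissible step length depend on J. The norm enters only errors of second order in the step, and
    the step length only requires short steps, so both disappear when a fixed z is divided into ever
    more steps. What survives is the opening of the cone and c, which depend on kappa alone. A kappa
    exists because theta_j exceeds the off-diagonal weight per unit of size by d_j + r_j / j: for
    large j the term d_j is a fixed fraction of theta_j, and for the finitely many other j the term
    r_j / j suffices, even where d_j = 0. The given semigroup is only assumed strongly continuous,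
    so a local bound for it has to be derived before it can be compared with the constructed one. *)

Lemma X_norm_scal_eq (k : C) (f : X) : norm (scal k f) = Cmod k * norm f.
Proof. exact (X_norm_scal k f). Qed.

Lemma X_triangle (f g : X) : norm (plus f g) <= norm f + norm g.
Proof. exact (X_norm_triangle f g). Qed.

Lemma X_triangle_minus (f g : X) : norm (minus f g) <= norm f + norm g.
Proof.
eapply Rle_trans; [apply (X_norm_triangle f (X_opp g))|].
rewrite X_norm_opp; apply Rle_refl.
Qed.

Ltac Rring := match goal with |- @eq _ ?a ?b => change (@eq R a b) end; ring.
Ltac Cring := match goal with |- @eq _ ?a ?b => change (@eq C a b) end; ring.

(* Matching rather than rewriting, since the same operation occurs through
   several syntactically different canonical structures. *)
Ltac X_coords := repeat match goal with
  | |- context [Xseq (@plus ?G ?f ?g) ?i] =>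
      change (Xseq (@plus G f g) i) with (Cplus (Xseq f i) (Xseq g i))
  | |- context [Xseq (@minus ?G ?f ?g) ?i] =>
      change (Xseq (@minus G f g) i) with (Cminus (Xseq f i) (Xseq g i))
  | |- context [Xseq (@opp ?G ?f) ?i] =>
      change (Xseq (@opp G f) i) with (Copp (Xseq f i))
  | |- context [Xseq (@scal ?R ?V ?k ?f) ?i] =>
      change (Xseq (@scal R V k f) i) with (Cmult k (Xseq f i))
  | |- context [Xseq (@zero ?G) ?i] =>
      change (Xseq (@zero G) i) with (RtoC 0)
  end.

Ltac X_ring := apply X_ext; intros ?i; X_coords; Cring.

Lemma X_coord_O (f : X) : f 0%nat = 0%C.
Proof. apply XseqP. Qed.

Lemma X_coord_le (f : X) i : Cmod (f i) <= norm f.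
Proof.
pose proof (norm_ge_0 f) as P.
destruct i as [|i].
- rewrite X_coord_O, Cmod_0; exact P.
- pose proof (X_norm_term f (S i)) as H; change (X_norm f) with (norm f) in H.
  rewrite S_INR in H; pose proof (pos_INR i); pose proof (Cmod_ge_0 (f (S i))); nra.
Qed.

(** Every weight [INR i] with i >= 1 is at least 1, so coordinates are continuous and a limit in X
    can be identified coordinate by coordinate. *)
Lemma X_coord_linear i :
  is_linear (K := C_AbsRing) (U := X_NormedModule) (V := C_NormedModule)
    (fun f : X => f i : C).
Proof.
split.
- reflexivity.
- reflexivity.
- exists 1; split; [lra|]; intros f; rewrite Rmult_1_l; exact (X_coord_le f i).
Qed.

Lemma is_lim_seq_sum_n (u : nat -> nat -> R) (l : nat -> R) N :
  (forall i, is_lim_seq (fun m => u m i) (l i)) ->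
  is_lim_seq (fun m => sum_n (u m) N) (sum_n l N).
Proof.
intros H; induction N as [|N IH].
- apply is_lim_seq_ext with (fun m => u m 0%nat); [|rewrite sum_O; apply H].
  intros m; now rewrite sum_O.
- apply is_lim_seq_ext with (fun m => sum_n (u m) N + u m (S N)).
  + intros m; now rewrite sum_Sn.
  + rewrite sum_Sn; apply is_lim_seq_plus'; [exact IH|apply H].
Qed.

Lemma sum_n_le_Series (u : nat -> R) n :
  (forall k, 0 <= u k) -> ex_series u -> sum_n u n <= Series u.
Proof.
intros P E.
apply is_lim_seq_incr_compare; [exact (Series_correct _ E)|].
intros m; rewrite sum_Sn; change (sum_n u m <= sum_n u m + u (S m)).
specialize (P (S m)); lra.
Qed.

Lemma ex_series_bounded (u : nat -> R) M :
  (forall k, 0 <= u k) -> (forall n, sum_n u n <= M) ->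
  ex_series u /\ Series u <= M.
Proof.
intros P B.
assert (E : ex_finite_lim_seq (sum_n u)).
{ apply ex_finite_lim_seq_incr with M; [|exact B].
  intros m; rewrite sum_Sn; change (sum_n u m <= sum_n u m + u (S m)).
  specialize (P (S m)); lra. }
destruct E as [l Hl].
assert (Hs : is_series u l) by exact Hl.
split; [now exists l|].
rewrite (is_series_unique _ _ Hs).
exact (is_lim_seq_le _ _ l M B Hl (is_lim_seq_const M)).
Qed.

Lemma X_term_ge_0 (f : nat -> C) n : 0 <= INR n * Cmod (f n).
Proof. apply Rmult_le_pos; [apply pos_INR | apply Cmod_ge_0]. Qed.

(** Each partial sum of the norm passes to the coordinatewise limit, so the bound does too. This is
    how an element of X is obtained from mere coordinates, for sums of series and for limits of
    subsequences. *)
Lemma X_fatou (v : nat -> X) (s : nat -> C) M :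
  (forall i, filterlim (fun m => v m i) eventually (locally (s i))) ->
  eventually (fun m => norm (v m) <= M) ->
  exists f : X, (forall i, f i = s i) /\ norm f <= M.
Proof.
intros L [N B].
assert (S0 : s 0%nat = 0%C).
{ apply (filterlim_locally_unique (K := C_AbsRing) (V := C_NormedModule)
     (F := eventually) (fun m => v m 0%nat)); [apply L|].
  apply (filterlim_ext (fun _ => zero : C)); [|apply filterlim_const].
  intros m; symmetry; apply X_coord_O. }
assert (Q : forall n, sum_n (fun i => INR i * Cmod (s i)) n <= M).
{ intros n.
  apply (is_lim_seq_le_loc (fun m => sum_n (fun i => INR i * Cmod (v m i)) n)
           (fun _ => M) (Finite _) (Finite M)).
  - exists N; intros m Hm; eapply Rle_trans; [|apply B, Hm].
    apply sum_n_le_Series; [apply X_term_ge_0 | apply XseqP].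
  - apply is_lim_seq_sum_n; intros i.
    apply is_lim_seq_scal_l with (lu := Finite (Cmod (s i))).
    apply filterlim_comp with (1 := L i).
    exact (filterlim_norm (V := C_NormedModule) (s i)).
  - apply is_lim_seq_const. }
destruct (ex_series_bounded _ M (X_term_ge_0 s) Q) as [E Hle].
now exists (mkX s (conj S0 E)).
Qed.

Lemma X_norm_sum_n (V : NormedModule C_AbsRing) (u : nat -> V) n :
  norm (sum_n u n) <= sum_n (fun k => norm (u k)) n.
Proof. apply (norm_sum_n_m u 0 n). Qed.

Lemma is_series_norm_le (V : NormedModule C_AbsRing) (u : nat -> V) s (w : nat -> R) :
  is_series u s -> (forall k, norm (u k) <= w k) -> ex_series w -> norm s <= Series w.
Proof.
intros H B E.
apply (is_lim_seq_le (fun n => norm (sum_n u n)) (sum_n w) (Finite (norm s))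
         (Finite (Series w))).
- intros n; eapply Rle_trans; [apply X_norm_sum_n|].
  apply sum_n_m_le, B.
- apply filterlim_comp with (1 := H); apply filterlim_norm.
- exact (Series_correct _ E).
Qed.

Lemma sum_n_minus_tail (G : AbelianGroup) (u : nat -> G) n m :
  (n <= m)%nat -> minus (sum_n u m) (sum_n u n) = sum_n_m u (S n) m.
Proof.
intros H; unfold sum_n; rewrite (sum_n_m_Chasles u 0 n m); [|lia|exact H].
unfold minus; rewrite (plus_comm (sum_n_m u 0 n)), <- plus_assoc.
etransitivity; [apply f_equal, plus_opp_r|apply plus_zero_r].
Qed.

Lemma X_coord_sum_n (u : nat -> X) n i :
  (sum_n u n : X) i = sum_n (fun k => u k i : C) n.
Proof.
induction n as [|n IH]; [now rewrite !sum_O|].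
rewrite !sum_Sn; X_coords; now rewrite IH.
Qed.

(** Completeness of X, from Fatou used twice: on the partial sums, to produce the limit, and on
    their differences, to bound the remainder by the tail of the series of norms. *)
Lemma X_ex_series (u : nat -> X) :
  ex_series (fun k => norm (u k)) -> exists s, is_series u s.
Proof.
intros E.
assert (Hc : forall i, exists l : C,
  filterlim (fun m => (sum_n u m : X) i) eventually (locally l)).
{ intros i.
  destruct (ex_series_le (K := C_AbsRing) (V := C_CompleteNormedModule)
              (fun k => u k i : C) (fun k => norm (u k))) as [l Hl]; [|exact E|].
  - intros k; exact (X_coord_le (u k) i).
  - exists l; apply filterlim_ext with (2 := Hl).
    intros m; symmetry; apply X_coord_sum_n. }
apply choice in Hc; destruct Hc as [s Hs].
assert (P : forall k, 0 <= norm (u k)) by (intros; apply norm_ge_0).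
destruct (X_fatou (sum_n u) s (Series (fun k => norm (u k)))) as (f & Hf & _); [exact Hs| |].
{ exists 0%nat; intros m _; eapply Rle_trans; [apply X_norm_sum_n|].
  now apply sum_n_le_Series. }
exists f.
assert (T : forall n, norm (minus f (sum_n u n)) <=
   Series (fun k => norm (u k)) - sum_n (fun k => norm (u k)) n).
{ intros n.
  destruct (X_fatou (fun m => minus (sum_n u m) (sum_n u n))
     (fun i => s i - (sum_n u n : X) i)%C
     (Series (fun k => norm (u k)) - sum_n (fun k => norm (u k)) n)) as (g & Hg & Bg).
  - intros i.
    apply (filterlim_comp_2 (G := locally (s i))
      (H := locally (opp ((sum_n u n : X) i : C)))
      (fun m => (sum_n u m : X) i) (fun _ => opp ((sum_n u n : X) i : C))
      (@plus C_AbelianGroup) (Hs i)).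
    + apply filterlim_const.
    + exact (filterlim_plus (V := C_NormedModule) (s i) (opp ((sum_n u n : X) i))).
  - exists n; intros m Hm.
    rewrite sum_n_minus_tail; [|exact Hm].
    eapply Rle_trans;
      [apply (norm_sum_n_m (K := C_AbsRing) (V := X_NormedModule) u (S n) m)|].
    pose proof (sum_n_minus_tail R_AbelianGroup (fun k => norm (u k)) n m Hm) as Q.
    change (sum_n (fun k => norm (u k)) m - sum_n (fun k => norm (u k)) n
      = sum_n_m (fun k => norm (u k)) (S n) m) in Q; rewrite <- Q.
    pose proof (sum_n_le_Series (fun k => norm (u k)) m P E); lra.
  - replace (minus f (sum_n u n)) with g; [exact Bg|].
    apply X_ext; intros i; rewrite Hg; X_coords; now rewrite Hf. }
pose proof (Series_correct _ E) as L.
apply (filterlim_locally_ball_norm (K := C_AbsRing) (U := X_NormedModule)); intros eps.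
destruct (proj1 (filterlim_locally_ball_norm (K := R_AbsRing) (U := R_NormedModule) _ _)
  L eps) as [N HN].
exists N; intros n Hn; specialize (HN n Hn).
unfold ball_norm in *.
rewrite <- norm_opp, opp_minus; eapply Rle_lt_trans; [apply T|].
change (Rabs (sum_n (fun k => norm (u k)) n - Series (fun k => norm (u k))) < eps) in HN.
apply Rabs_def2 in HN; lra.
Qed.

(** * Operators given by their columns *)

Lemma sum_n_stable (G : AbelianMonoid) (u : nat -> G) J n :
  (forall k, (J < k)%nat -> u k = zero) -> (J <= n)%nat -> sum_n u n = sum_n u J.
Proof.
intros Z H; induction H as [|n H IH]; [reflexivity|].
rewrite sum_Sn, IH, Z; [apply plus_zero_r|lia].
Qed.

Lemma is_series_finite (K : AbsRing) (V : NormedModule K) (u : nat -> V) J :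
  (forall k, (J < k)%nat -> u k = zero) -> is_series u (sum_n u J).
Proof.
intros Z; apply filterlim_ext_loc with (fun _ => sum_n u J); [|apply filterlim_const].
exists J; intros n H; symmetry; now apply sum_n_stable.
Qed.

Lemma X_norm_finite (f : nat -> C) (Hf : inX f) J :
  (forall i, (J < i)%nat -> f i = 0%C) ->
  norm (mkX f Hf) = sum_n (fun i => INR i * Cmod (f i)) J.
Proof.
intros Z; apply is_series_unique, (is_series_finite R_AbsRing R_NormedModule).
intros k Hk; rewrite Z, Cmod_0; [apply Rmult_0_r|exact Hk].
Qed.

Lemma inX_finite (f : nat -> C) J :
  f 0%nat = 0%C -> (forall i, (J < i)%nat -> f i = 0%C) -> inX f.
Proof.
intros H0 Z; split; [exact H0|].
exists (sum_n (fun i => INR i * Cmod (f i)) J).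
apply (is_series_finite R_AbsRing R_NormedModule).
intros k Hk; rewrite Z, Cmod_0; [apply Rmult_0_r|exact Hk].
Qed.

Definition unit_seq (j i : nat) : C :=
  match i with O => 0%C | S _ => if Nat.eqb i j then 1%C else 0%C end.

Lemma unit_seq_neq j i : i <> j -> unit_seq j i = 0%C.
Proof.
intros H; destruct i as [|i]; [reflexivity|].
unfold unit_seq; apply Nat.eqb_neq in H; now rewrite H.
Qed.

Lemma unit_seq_diag j : (1 <= j)%nat -> unit_seq j j = 1%C.
Proof.
intros H; destruct j as [|j]; [lia|].
unfold unit_seq; now rewrite Nat.eqb_refl.
Qed.

Lemma inX_unit j : inX (unit_seq j).
Proof.
apply inX_finite with j; [reflexivity|].
intros i Hi; apply unit_seq_neq; lia.
Qed.

Definition Xe (j : nat) : X := mkX _ (inX_unit j).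

Lemma sum_n_single (G : AbelianMonoid) (u : nat -> G) j n :
  (forall k, k <> j -> u k = zero) -> (j <= n)%nat -> sum_n u n = u j.
Proof.
intros Z H; rewrite (sum_n_stable _ u j n); [|intros; apply Z; lia|exact H].
destruct j as [|j]; [apply sum_O|].
assert (Q : sum_n u j = zero).
{ unfold sum_n; rewrite (sum_n_m_ext_loc _ (fun _ => zero)); [apply sum_n_m_const_zero|].
  intros k Hk; apply Z; lia. }
rewrite sum_Sn, Q; apply plus_zero_l.
Qed.

Lemma Xe_norm j : norm (Xe j) = INR j.
Proof.
unfold Xe; rewrite (X_norm_finite _ _ j).
2: { intros i Hi; apply unit_seq_neq; lia. }
rewrite (sum_n_single R_AbelianMonoid _ j j).
- destruct j as [|j]; [simpl; ring|].
  rewrite unit_seq_diag, Cmod_1; [ring|lia].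
- intros k Hk; rewrite unit_seq_neq, Cmod_0; [apply Rmult_0_r|exact Hk].
- lia.
Qed.

Lemma Xe_O : Xe 0 = zero.
Proof. apply X_ext; intros [|i]; reflexivity. Qed.

(** The unit vectors form a basis: the series converges absolutely because [norm (Xe j) = INR j],
    and its sum has the right coordinates. *)
Lemma X_expansion (f : X) : is_series (fun j => scal (f j) (Xe j)) f.
Proof.
destruct (X_ex_series (fun j => scal (f j) (Xe j))) as [s Hs].
{ eapply ex_series_ext; [|exact (proj2 (XseqP f))].
  intros j; cbv beta; rewrite X_norm_scal_eq, Xe_norm; apply Rmult_comm. }
assert (E : s = f); [|rewrite E in Hs; exact Hs].
apply X_ext; intros i.
apply (filterlim_locally_unique (K := C_AbsRing) (V := C_NormedModule) (F := eventually)
  (fun n => (sum_n (fun j => scal (f j) (Xe j)) n : X) i)).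
- apply (filterlim_comp _ _ _ (sum_n (fun j => scal (f j) (Xe j)))
    (fun g : X => g i : C) _ (locally s) _ Hs).
  exact (linear_cont (K := C_AbsRing) (U := X_NormedModule) (V := C_NormedModule)
    (fun g : X => g i : C) s (X_coord_linear i)).
- apply filterlim_ext_loc with (fun _ => f i : C); [|apply filterlim_const].
  exists i; intros n Hn; rewrite X_coord_sum_n.
  rewrite (sum_n_single C_AbelianGroup _ i n); [| |exact Hn].
  + X_coords; simpl Xseq at 3; destruct i as [|i].
    * rewrite X_coord_O; symmetry; apply Cmult_0_l.
    * rewrite unit_seq_diag; [symmetry; apply Cmult_1_r|lia].
  + intros k Hk; X_coords; simpl Xseq at 2.
    rewrite unit_seq_neq; [apply Cmult_0_r|congruence].
Qed.

Lemma linear_series (V : NormedModule C_AbsRing) (l : X -> V) (f : X) :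
  is_linear l -> is_series (fun j => scal (f j) (l (Xe j))) (l f).
Proof.
intros L.
apply filterlim_ext with (fun n => l (sum_n (fun j => scal (f j) (Xe j)) n)).
- intros n; induction n as [|n IH].
  + rewrite !sum_O; apply (linear_scal l L).
  + rewrite !sum_Sn, (linear_plus l L), IH; f_equal; apply (linear_scal l L).
- apply filterlim_comp with (1 := X_expansion f).
  now apply linear_cont.
Qed.

Lemma linear_Xe_O (V : NormedModule C_AbsRing) (l : X -> V) :
  is_linear l -> l (Xe 0) = zero.
Proof. intros L; rewrite Xe_O; exact (linear_zero l L). Qed.

Lemma linear_ext (V : NormedModule C_AbsRing) (l l' : X -> V) :
  is_linear l -> is_linear l' -> (forall j, (1 <= j)%nat -> l (Xe j) = l' (Xe j)) ->
  forall f, l f = l' f.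
Proof.
intros L L' E f.
apply (filterlim_locally_unique (K := C_AbsRing) (V := V) (F := eventually)
  (sum_n (fun j => scal (f j) (l (Xe j))))); [now apply linear_series|].
apply filterlim_ext with (sum_n (fun j => scal (f j) (l' (Xe j)))).
- intros n; apply sum_n_ext; intros [|k].
  + now rewrite (linear_Xe_O V l L), (linear_Xe_O V l' L').
  + rewrite E; [reflexivity|lia].
- now apply linear_series.
Qed.

Lemma norm_scal_Cmod (V : NormedModule C_AbsRing) (k : C) (x : V) :
  norm (scal k x) <= Cmod k * norm x.
Proof. exact (norm_scal (K := C_AbsRing) k x). Qed.

(** The l^1 principle: bounds on columns bound the operator. The weights [w] need not be
    proportional to [INR j]; dissipativity will be read as such a bound with smaller weights. *)
Lemma linear_norm_col (V : NormedModule C_AbsRing) (l : X -> V) (w : nat -> R) (f : X) :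
  is_linear l -> (forall j, (1 <= j)%nat -> norm (l (Xe j)) <= w j) ->
  ex_series (fun j => Cmod (f j) * w j) ->
  norm (l f) <= Series (fun j => Cmod (f j) * w j).
Proof.
intros L B E; apply is_series_norm_le with (1 := linear_series V l f L); [|exact E].
intros [|k].
- rewrite (linear_Xe_O V l L), X_coord_O, Cmod_0.
  eapply Rle_trans; [apply norm_scal_Cmod|]; rewrite norm_zero; lra.
- eapply Rle_trans; [apply norm_scal_Cmod|].
  apply Rmult_le_compat_l; [apply Cmod_ge_0|apply B; lia].
Qed.

Lemma ex_series_Rscal (c : R) (u : nat -> R) : ex_series u -> ex_series (fun n => c * u n).
Proof. exact (ex_series_scal_l c u). Qed.

Lemma linear_norm_le (V : NormedModule C_AbsRing) (l : X -> V) q (f : X) :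
  is_linear l -> (forall j, (1 <= j)%nat -> norm (l (Xe j)) <= q * INR j) ->
  norm (l f) <= q * norm f.
Proof.
intros L B.
assert (E : forall j, q * (INR j * Cmod (f j)) = Cmod (f j) * (q * INR j))
  by (intros; ring).
eapply Rle_trans; [apply linear_norm_col with (1 := L) (2 := B)|].
- apply ex_series_ext with (1 := E), ex_series_Rscal, XseqP.
- rewrite <- (Series_ext _ _ E), Series_scal_l; apply Rle_refl.
Qed.

Lemma minus_plus_plus (G : AbelianGroup) (a b c d : G) :
  minus (plus a b) (plus c d) = plus (minus a c) (minus b d).
Proof.
unfold minus; rewrite opp_plus, <- !plus_assoc; f_equal.
rewrite !plus_assoc; f_equal; apply plus_comm.
Qed.

Lemma is_linear_minus_fun (U V : NormedModule C_AbsRing) (l l' : U -> V) :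
  is_linear l -> is_linear l' -> is_linear (fun x => minus (l x) (l' x)).
Proof.
intros L L'; split.
- intros x y; rewrite (linear_plus l L), (linear_plus l' L').
  apply (minus_plus_plus (NormedModule.AbelianGroup C_AbsRing V)).
- intros k x; rewrite (linear_scal l L), (linear_scal l' L').
  symmetry; apply (scal_minus_distr_l (K := C_Ring) (V := NormedModule.ModuleSpace C_AbsRing V)).
- destruct (linear_norm l L) as (M & Mp & HM), (linear_norm l' L') as (M' & Mp' & HM').
  exists (M + M'); split; [lra|]; intros x; unfold minus.
  eapply Rle_trans; [apply norm_triangle|]; rewrite norm_opp.
  specialize (HM x); specialize (HM' x); lra.
Qed.

Lemma is_linear_scal_fun (U V : NormedModule C_AbsRing) (k : C) (l : U -> V) :
  is_linear l -> is_linear (fun x => scal k (l x)).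
Proof.
intros L; split.
- intros x y; rewrite (linear_plus l L); apply (@scal_distr_l C_Ring).
- intros c x; rewrite (linear_scal l L), !scal_assoc; f_equal; apply Cmult_comm.
- destruct (linear_norm l L) as (M & Mp & HM).
  pose proof (Cmod_ge_0 k).
  exists (Cmod k * M + 1); split; [nra|]; intros x.
  eapply Rle_trans; [apply norm_scal_Cmod|].
  change (Cmod k * norm (l x) <= (Cmod k * M + 1) * norm x).
  specialize (HM x); pose proof (norm_ge_0 x); nra.
Qed.

Definition col_op (c : nat -> X) (f : X) : X :=
  epsilon (inhabits (zero : X)) (fun s => is_series (fun j => scal (f j) (c j)) s).

(** At j = 0 this forces [c 0] to vanish, as befits the dummy index. *)
Definition col_bound (c : nat -> X) (q : R) : Prop := forall j, norm (c j) <= q * INR j.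

Lemma col_op_unique c (f s : X) : is_series (fun j => scal (f j) (c j)) s -> col_op c f = s.
Proof.
intros H.
apply (filterlim_locally_unique (K := C_AbsRing) (V := X_NormedModule) (F := eventually)
  (sum_n (fun j => scal (f j) (c j)))); [|exact H].
exact (epsilon_spec (inhabits (zero : X))
  (fun s => is_series (fun j => scal (f j) (c j)) s) (ex_intro _ s H)).
Qed.

Lemma col_op_series c q (f : X) :
  col_bound c q -> is_series (fun j => scal (f j) (c j)) (col_op c f).
Proof.
intros B; destruct (X_ex_series (fun j => scal (f j) (c j))) as [s Hs].
- apply (ex_series_le (K := R_AbsRing) (V := R_CompleteNormedModule))
    with (b := fun j => q * (INR j * Cmod (f j))).
  + intros j; change (Rabs (norm (scal (f j) (c j))) <= q * (INR j * Cmod (f j))).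
    rewrite Rabs_pos_eq; [|apply norm_ge_0].
    rewrite X_norm_scal_eq; specialize (B j); pose proof (Cmod_ge_0 (f j)); nra.
  + apply ex_series_Rscal, XseqP.
- now rewrite (col_op_unique _ _ _ Hs).
Qed.

Lemma col_op_norm_le c q f : col_bound c q -> norm (col_op c f) <= q * norm f.
Proof.
intros B.
change (q * norm f) with (q * Series (fun j => INR j * Cmod (f j))).
rewrite <- Series_scal_l.
apply (is_series_norm_le X_NormedModule _ _ _ (col_op_series c q f B)).
- intros j; rewrite X_norm_scal_eq; specialize (B j); pose proof (Cmod_ge_0 (f j)); nra.
- apply ex_series_Rscal, XseqP.
Qed.

Lemma col_op_linear c q : col_bound c q -> is_linear (col_op c).
Proof.
intros B; split.
- intros f g; apply col_op_unique.
  eapply is_series_ext;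
    [|exact (is_series_plus _ _ _ _ (col_op_series c q f B) (col_op_series c q g B))].
  intros j; cbv beta; X_coords; symmetry; apply (@scal_distr_r C_Ring).
- intros k f; apply col_op_unique.
  eapply is_series_ext;
    [|exact (is_series_scal_l k _ _ (col_op_series c q f B))].
  intros j; cbv beta; X_coords; apply (@scal_assoc C_Ring).
- exists (Rmax q 1); split.
  + eapply Rlt_le_trans; [apply Rlt_0_1|apply Rmax_r].
  + intros f; eapply Rle_trans; [now apply col_op_norm_le|].
    apply Rmult_le_compat_r; [apply norm_ge_0|apply Rmax_l].
Qed.

Lemma col_op_Xe c q j : col_bound c q -> col_op c (Xe j) = c j.
Proof.
intros B; apply col_op_unique.
destruct j as [|j].
- assert (Z : c 0%nat = zero).
  { apply X_norm_eq0, Rle_antisym; [|apply (norm_ge_0 (c 0%nat))].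
    eapply Rle_trans; [apply B|]; simpl; lra. }
  rewrite Xe_O, Z.
  apply (is_series_ext (fun _ => zero)).
  + intros n; X_coords; symmetry; apply (@scal_zero_l C_Ring).
  + apply (filterlim_ext (fun _ => zero)); [|apply filterlim_const].
    intros n; unfold sum_n; symmetry; apply sum_n_m_const_zero.
- apply filterlim_ext_loc with (fun _ => c (S j)); [|apply filterlim_const].
  exists (S j); intros n Hn; symmetry.
  rewrite (sum_n_single _ _ (S j) n); [| |exact Hn].
  + simpl Xseq; rewrite Nat.eqb_refl; apply (@scal_one C_Ring).
  + intros k Hk; change (Xe (S j) k) with (unit_seq (S j) k).
    rewrite unit_seq_neq; [apply (@scal_zero_l C_Ring)|exact Hk].
Qed.

(** * The exponential of a bounded operator *)

Definition square_sum {G : AbelianMonoid} (u : nat -> nat -> G) (N : nat) : G :=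
  sum_n (fun p => sum_n (u p) N) N.

(** For an array of products this is a partial sum of the Cauchy product, while [square_sum] is the
    product of the partial sums. *)
Definition triangle_sum {G : AbelianMonoid} (u : nat -> nat -> G) (N : nat) : G :=
  sum_n (fun n => sum_n (fun p => u p (n - p)%nat) n) N.

Lemma triangle_sum_rows {G : AbelianMonoid} (u : nat -> nat -> G) N :
  triangle_sum u N = sum_n (fun p => sum_n (u p) (N - p)) N.
Proof.
unfold triangle_sum; induction N as [|N IH]; [now rewrite !sum_O|].
rewrite sum_Sn, IH, (sum_Sn _ N), (sum_Sn (fun p => sum_n (u p) (S N - p)) N).
rewrite Nat.sub_diag, sum_O, plus_assoc; f_equal.
etransitivity; [symmetry; apply (sum_n_m_plus (G := G))|].
apply sum_n_m_ext_loc; intros k Hk.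
replace (S N - k)%nat with (S (N - k)) by lia; now rewrite sum_Sn.
Qed.

Lemma sum_n_minus (G : AbelianGroup) (u v : nat -> G) n :
  minus (sum_n u n) (sum_n v n) = sum_n (fun k => minus (u k) (v k)) n.
Proof.
induction n as [|n IH]; [now rewrite !sum_O|].
rewrite !sum_Sn, <- IH; apply minus_plus_plus.
Qed.

(** The difference consists of the entries with p, q <= N and p + q > N, so the triangle inequality
    bounds it by the same difference for a scalar majorant. *)
Lemma square_triangle_norm (u : nat -> nat -> X) (w : nat -> nat -> R) N :
  (forall p q, norm (u p q) <= w p q) ->
  norm (minus (square_sum u N) (triangle_sum u N)) <= square_sum w N - triangle_sum w N.
Proof.
intros B; rewrite !triangle_sum_rows; unfold square_sum.
change (sum_n (fun p => sum_n (w p) N) N - sum_n (fun p => sum_n (w p) (N - p)) N)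
  with (minus (sum_n (fun p => sum_n (w p) N) N) (sum_n (fun p => sum_n (w p) (N - p)) N)).
rewrite (sum_n_minus X_AbelianGroup), (sum_n_minus R_AbelianGroup).
eapply Rle_trans; [apply X_norm_sum_n|].
apply sum_n_m_le; intros p.
rewrite (sum_n_minus_tail X_AbelianGroup (u p)), (sum_n_minus_tail R_AbelianGroup (w p)) by lia.
eapply Rle_trans; [apply (norm_sum_n_m (K := C_AbsRing) (V := X_NormedModule))|].
apply sum_n_m_le; intros q; apply B.
Qed.

Lemma sum_n_Rmult_l (k : R) (u : nat -> R) n : sum_n (fun i => k * u i) n = k * sum_n u n.
Proof. exact (sum_n_scal_l (K := R_Ring) (V := R_ModuleSpace) k u n). Qed.

Lemma sum_n_Rmult_r (k : R) (u : nat -> R) n : sum_n (fun i => u i * k) n = sum_n u n * k.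
Proof. exact (sum_n_mult_r (K := R_Ring) k u n). Qed.

Lemma square_triangle_product (x y : nat -> R) A B :
  (forall k, 0 <= x k) -> (forall k, 0 <= y k) -> is_series x A -> is_series y B ->
  is_lim_seq (fun N => square_sum (fun p q => x p * y q) N
                       - triangle_sum (fun p q => x p * y q) N) 0.
Proof.
intros Px Py HA HB.
replace (Finite 0) with (Finite (A * B - A * B)) by (f_equal; ring).
apply is_lim_seq_minus'.
- apply is_lim_seq_ext with (fun N => sum_n x N * sum_n y N).
  + intros N; unfold square_sum; rewrite <- sum_n_Rmult_r.
    apply sum_n_ext; intros p; symmetry; apply sum_n_Rmult_l.
  + apply is_lim_seq_mult'; [exact HA|exact HB].
- apply is_lim_seq_ext with (2 := is_series_mult_pos x y A B HA HB Px Py).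
  intros N; apply sum_n_ext; intros n; symmetry; apply sum_n_Reals.
Qed.

Definition exp_coef (z : C) (k : nat) : C := (z ^ k * RtoC (/ INR (fact k)))%C.

Lemma exp_coef_Cmod z k : Cmod (exp_coef z k) = / INR (fact k) * Cmod z ^ k.
Proof.
unfold exp_coef; rewrite Cmod_mult, Cmod_pow, Cmod_R, Rabs_pos_eq; [ring|].
left; apply Rinv_0_lt_compat, INR_fact_lt_0.
Qed.

Lemma is_series_exp x : is_series (fun k => / INR (fact k) * x ^ k) (exp x).
Proof.
eapply is_series_ext; [|exact (is_exp_Reals x)].
intros k; rewrite pow_n_pow; apply Rmult_comm.
Qed.

Lemma exp_coef_succ z k :
  (RtoC (INR (S k)) * exp_coef z (S k))%C = (z * exp_coef z k)%C.
Proof.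
unfold exp_coef; rewrite fact_simpl, mult_INR, Cpow_S.
rewrite Rinv_mult, RtoC_mult.
transitivity (z * z ^ k * RtoC (/ INR (fact k)) * (RtoC (INR (S k)) * RtoC (/ INR (S k))))%C;
  [ring|].
rewrite <- RtoC_mult, Rinv_r; [ring|apply not_0_INR; lia].
Qed.

Lemma exp_coef_O z : exp_coef z 0 = 1%C.
Proof. unfold exp_coef; simpl; rewrite Rinv_1; ring. Qed.

Lemma sum_n_Cscal (k : C) (u : nat -> C) n :
  sum_n (fun i => (k * u i)%C) n = (k * sum_n u n)%C.
Proof. exact (sum_n_scal_l (K := C_Ring) (V := Ring_ModuleSpace C_Ring) k u n). Qed.

Lemma sum_n_Cplus (u v : nat -> C) n :
  sum_n (fun i => (u i + v i)%C) n = (sum_n u n + sum_n v n)%C.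
Proof. exact (sum_n_plus (G := C_AbelianGroup) u v n). Qed.

(** The binomial theorem divided by n!. In the induction the factor n + 1 is split as p + (n + 1 -
    p), a Leibniz rule for the coefficients. *)
Lemma exp_coef_binomial z w n :
  sum_n (fun p => (exp_coef z p * exp_coef w (n - p))%C) n = exp_coef (z + w)%C n.
Proof.
induction n as [|n IH]; [now rewrite sum_O, !exp_coef_O, Cmult_1_l|].
assert (N0 : RtoC (INR (S n)) <> 0%C).
{ intros E; apply RtoC_inj in E; revert E; apply not_0_INR; lia. }
assert (E : (RtoC (INR (S n)) * sum_n (fun p => exp_coef z p * exp_coef w (S n - p))%C (S n)
             = (z + w) * exp_coef (z + w) n)%C).
2: { rewrite <- exp_coef_succ in E.
     apply (f_equal (fun x => / RtoC (INR (S n)) * x)%C) in E.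
     rewrite !Cmult_assoc, Cinv_l, !Cmult_1_l in E; [exact E|exact N0]. }
rewrite <- IH, <- sum_n_Cscal.
transitivity (sum_n (fun p => (RtoC (INR p) * exp_coef z p * exp_coef w (S n - p)
  + exp_coef z p * (RtoC (INR (S n - p)) * exp_coef w (S n - p)))%C) (S n)).
{ apply sum_n_m_ext_loc; intros p Hp.
  replace (INR (S n)) with (INR p + INR (S n - p)) by (rewrite <- plus_INR; f_equal; lia).
  rewrite RtoC_plus; Cring. }
rewrite sum_n_Cplus, Cmult_plus_distr_r; f_equal.
- unfold sum_n at 1; rewrite sum_Sn_m by lia.
  change (INR 0) with 0; rewrite !Cmult_0_l.
  etransitivity; [apply (plus_zero_l (G := C_AbelianMonoid))|].
  rewrite <- sum_n_m_S; fold (@sum_n C_AbelianMonoid).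
  rewrite <- sum_n_Cscal; apply sum_n_ext; intros p.
  rewrite exp_coef_succ, Nat.sub_succ; Cring.
- rewrite sum_Sn, Nat.sub_diag; change (INR 0) with 0; rewrite Cmult_0_l, Cmult_0_r.
  etransitivity; [apply (plus_zero_r (G := C_AbelianMonoid))|].
  rewrite <- sum_n_Cscal; apply sum_n_m_ext_loc; intros p Hp.
  replace (S n - p)%nat with (S (n - p)) by lia; rewrite exp_coef_succ; Cring.
Qed.

Lemma iter_linear (L : X -> X) k : is_linear L -> is_linear (fun f => Nat.iter k L f).
Proof.
intros HL; induction k as [|k IH]; [apply is_linear_id|].
exact (is_linear_comp _ L IH HL).
Qed.

Lemma iter_norm_le (L : X -> X) B k f :
  0 <= B -> (forall x, norm (L x) <= B * norm x) ->
  norm (Nat.iter k L f) <= B ^ k * norm f.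
Proof.
intros HB HL; induction k as [|k IH]; simpl; [lra|].
eapply Rle_trans; [apply HL|].
rewrite Rmult_assoc; now apply Rmult_le_compat_l.
Qed.

Lemma sum_n_scal_r_X (u : nat -> C) (x : X) n :
  sum_n (fun k => scal (u k) x) n = scal (sum_n u n) x.
Proof.
induction n as [|n IH]; [now rewrite !sum_O|].
rewrite !sum_Sn, IH; symmetry; apply (@scal_distr_r C_Ring).
Qed.

Lemma linear_sum_n (U V : NormedModule C_AbsRing) (L : U -> V) (u : nat -> U) n :
  is_linear L -> L (sum_n u n) = sum_n (fun k => L (u k)) n.
Proof.
intros HL; induction n as [|n IH]; [now rewrite !sum_O|].
now rewrite !sum_Sn, (linear_plus L HL), IH.
Qed.

Lemma filterlim_norm_minus (T : Type) (F : (T -> Prop) -> Prop) {FF : Filter F}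
  (V : NormedModule C_AbsRing) (u : T -> V) s :
  filterlim u F (locally s) -> filterlim (fun x => norm (minus (u x) s)) F (locally 0).
Proof.
intros H; apply (filterlim_locally_ball_norm (K := R_AbsRing) (U := R_NormedModule)).
intros eps; generalize (proj1 (filterlim_locally_ball_norm u s) H eps).
apply filter_imp; intros x Hx; unfold ball_norm in *.
change (Rabs (norm (minus (u x) s) - 0) < eps).
rewrite Rminus_0_r, Rabs_pos_eq; [exact Hx|apply norm_ge_0].
Qed.

Lemma X_eq_of_lim (a b : X) (q : nat -> R) :
  (forall N, norm (minus a b) <= q N) -> is_lim_seq q 0 -> a = b.
Proof.
intros B Q.
assert (E : norm (minus a b) <= 0).
{ exact (is_lim_seq_le (fun _ => norm (minus a b)) q (Finite _) (Finite 0) B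
    (is_lim_seq_const _) Q). }
assert (Z : minus a b = zero).
{ apply X_norm_eq0, Rle_antisym; [exact E|apply (norm_ge_0 (minus a b))]. }
apply X_ext; intros i.
apply (f_equal (fun g : X => g i)) in Z; revert Z; X_coords; intros Z.
transitivity ((a i - b i) + b i)%C; [ring|rewrite Z; ring].
Qed.

Lemma X_norm_minus_sym (a b : X) : norm (minus a b) = norm (minus b a).
Proof. now rewrite <- norm_opp, opp_minus. Qed.

Definition exp_term (L : X -> X) (z : C) (f : X) (k : nat) : X :=
  scal (exp_coef z k) (Nat.iter k L f).

Definition exp_op (L : X -> X) (z : C) (f : X) : X :=
  epsilon (inhabits (zero : X)) (fun s => is_series (exp_term L z f) s).

Section Exponential.

Context (L : X -> X) (B : R) (L_linear : is_linear L) (B_ge_0 : 0 <= B)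
  (L_le : forall f, norm (L f) <= B * norm f).

Lemma exp_term_norm_le z f k :
  norm (exp_term L z f k) <= / INR (fact k) * (Cmod z * B) ^ k * norm f.
Proof.
unfold exp_term; rewrite X_norm_scal_eq, exp_coef_Cmod, Rpow_mult_distr, !Rmult_assoc.
apply Rmult_le_compat_l; [left; apply Rinv_0_lt_compat, INR_fact_lt_0|].
apply Rmult_le_compat_l; [apply pow_le, Cmod_ge_0|].
now apply iter_norm_le.
Qed.

Lemma ex_series_exp_norm x (f : X) :
  ex_series (fun k => / INR (fact k) * x ^ k * norm f).
Proof.
exists (exp x * norm f); apply is_series_scal_r, is_series_exp.
Qed.

Lemma exp_op_unique z f s : is_series (exp_term L z f) s -> exp_op L z f = s.
Proof.
intros H.
apply (filterlim_locally_unique (K := C_AbsRing) (V := X_NormedModule) (F := eventually)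
  (sum_n (exp_term L z f))); [|exact H].
exact (epsilon_spec (inhabits (zero : X)) (fun s => is_series (exp_term L z f) s)
  (ex_intro _ s H)).
Qed.

Lemma exp_op_series z f : is_series (exp_term L z f) (exp_op L z f).
Proof.
destruct (X_ex_series (exp_term L z f)) as [s Hs].
- apply (ex_series_le (K := R_AbsRing) (V := R_CompleteNormedModule))
    with (b := fun k => / INR (fact k) * (Cmod z * B) ^ k * norm f).
  + intros k; change (Rabs (norm (exp_term L z f k))
      <= / INR (fact k) * (Cmod z * B) ^ k * norm f).
    rewrite Rabs_pos_eq; [apply exp_term_norm_le|apply norm_ge_0].
  + apply ex_series_exp_norm.
- now rewrite (exp_op_unique _ _ _ Hs).
Qed.

Lemma exp_partial_norm_le z f N :
  norm (sum_n (exp_term L z f) N) <= exp (Cmod z * B) * norm f.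
Proof.
eapply Rle_trans; [apply X_norm_sum_n|].
eapply Rle_trans; [apply sum_n_m_le; intros k; apply exp_term_norm_le|].
fold (sum_n (fun k => / INR (fact k) * (Cmod z * B) ^ k * norm f) N).
rewrite <- (is_series_unique _ _ (is_series_exp (Cmod z * B))), <- Series_scal_r.
apply sum_n_le_Series; [|apply ex_series_exp_norm].
intros k; apply Rmult_le_pos; [|apply norm_ge_0].
apply Rmult_le_pos; [left; apply Rinv_0_lt_compat, INR_fact_lt_0|].
apply pow_le, Rmult_le_pos; [apply Cmod_ge_0|exact B_ge_0].
Qed.

Lemma exp_op_norm_le z f : norm (exp_op L z f) <= exp (Cmod z * B) * norm f.
Proof.
apply (is_lim_seq_le (fun N => norm (sum_n (exp_term L z f) N))
  (fun _ => exp (Cmod z * B) * norm f) (Finite _) (Finite _)).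
- apply exp_partial_norm_le.
- apply (filterlim_comp _ _ _ _ _ _ _ _ (exp_op_series z f)), filterlim_norm.
- apply is_lim_seq_const.
Qed.

Lemma exp_term_linear z k : is_linear (fun f => exp_term L z f k).
Proof.
exact (is_linear_scal_fun _ _ _ _ (iter_linear L k L_linear)).
Qed.

Lemma exp_op_linear z : is_linear (exp_op L z).
Proof.
split.
- intros f g; apply exp_op_unique.
  eapply is_series_ext;
    [|exact (is_series_plus _ _ _ _ (exp_op_series z f) (exp_op_series z g))].
  intros k; symmetry; apply (linear_plus _ (exp_term_linear z k)).
- intros c f; apply exp_op_unique.
  eapply is_series_ext; [|exact (is_series_scal_l c _ _ (exp_op_series z f))].
  intros k; symmetry; apply (linear_scal _ (exp_term_linear z k)).
- exists (exp (Cmod z * B)); split; [apply exp_pos|apply exp_op_norm_le].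
Qed.

Lemma exp_op_comm z f : L (exp_op L z f) = exp_op L z (L f).
Proof.
symmetry; apply exp_op_unique.
apply filterlim_ext with (fun n => L (sum_n (exp_term L z f) n)).
- intros n; rewrite (linear_sum_n _ _ _ _ _ L_linear); apply sum_n_ext; intros k.
  unfold exp_term; rewrite (linear_scal L L_linear).
  now rewrite <- Nat.iter_succ, <- Nat.iter_succ_r.
- apply (filterlim_comp _ _ _ _ _ _ _ _ (exp_op_series z f)).
  now apply (linear_cont L (exp_op L z f)).
Qed.

Lemma exp_op_zero f : exp_op L 0%C f = f.
Proof.
apply exp_op_unique.
apply filterlim_ext with (fun _ => f); [|apply filterlim_const].
intros n; symmetry; etransitivity.
- apply (sum_n_single _ _ 0); [|lia].
  intros k Hk; unfold exp_term, exp_coef; destruct k as [|k]; [easy|].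
  rewrite Cpow_S, !Cmult_0_l; apply (@scal_zero_l C_Ring).
- unfold exp_term; rewrite exp_coef_O; apply (@scal_one C_Ring).
Qed.

(** The square sums of [u] approach the composition, its triangular sums are the partial sums for z
    + w, and their difference is dominated by that of two scalar exponential series, which tends to
    0. *)
Lemma exp_op_plus z w f : exp_op L (z + w)%C f = exp_op L z (exp_op L w f).
Proof.
symmetry.
set (u p q := scal (exp_coef z p) (scal (exp_coef w q) (Nat.iter (p + q) L f)) : X).
set (x p := / INR (fact p) * (Cmod z * B) ^ p).
set (y q := / INR (fact q) * (Cmod w * B) ^ q * norm f).
assert (Ux : forall p, 0 <= x p).
{ intros k; apply Rmult_le_pos; [left; apply Rinv_0_lt_compat, INR_fact_lt_0|].
  apply pow_le, Rmult_le_pos; [apply Cmod_ge_0|exact B_ge_0]. }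
assert (Uy : forall q, 0 <= y q).
{ intros k; apply Rmult_le_pos; [|apply norm_ge_0].
  apply Rmult_le_pos; [left; apply Rinv_0_lt_compat, INR_fact_lt_0|].
  apply pow_le, Rmult_le_pos; [apply Cmod_ge_0|exact B_ge_0]. }
assert (Sq : forall N, square_sum u N
  = sum_n (exp_term L z (sum_n (exp_term L w f) N)) N).
{ intros N; apply sum_n_ext; intros p; unfold exp_term at 1.
  rewrite (linear_sum_n _ _ (fun f => Nat.iter p L f) _ N (iter_linear L p L_linear)).
  symmetry; etransitivity; [symmetry; apply (sum_n_scal_l (K := C_Ring) (V := X_ModuleSpace))|].
  apply sum_n_ext; intros q; unfold u, exp_term; f_equal.
  rewrite Nat.iter_add; apply (linear_scal _ (iter_linear L p L_linear)). }
assert (Tr : forall N, triangle_sum u N = sum_n (exp_term L (z + w)%C f) N).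
{ intros N; apply sum_n_ext; intros n; unfold exp_term.
  rewrite <- exp_coef_binomial, <- sum_n_scal_r_X.
  apply sum_n_m_ext_loc; intros p Hp; unfold u.
  replace (p + (n - p))%nat with n by lia; apply (@scal_assoc C_Ring). }
assert (D : is_lim_seq (fun N => norm (minus (square_sum u N) (triangle_sum u N))) 0).
{ apply is_lim_seq_le_le with (u := fun _ => 0)
    (w := fun N => square_sum (fun p q => x p * y q) N
                   - triangle_sum (fun p q => x p * y q) N).
  - intros N; split; [apply norm_ge_0|].
    apply square_triangle_norm; intros p q; unfold u, x, y.
    rewrite !X_norm_scal_eq, !exp_coef_Cmod, !Rpow_mult_distr.
    pose proof (iter_norm_le L B (p + q) f B_ge_0 L_le) as I; rewrite pow_add in I.
    assert (Fp : 0 < / INR (fact p)) by apply Rinv_0_lt_compat, INR_fact_lt_0.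
    assert (Fq : 0 < / INR (fact q)) by apply Rinv_0_lt_compat, INR_fact_lt_0.
    pose proof (pow_le _ p (Cmod_ge_0 z)) as Zp; pose proof (pow_le _ q (Cmod_ge_0 w)) as Wq.
    replace (/ INR (fact p) * (Cmod z ^ p * B ^ p) *
      (/ INR (fact q) * (Cmod w ^ q * B ^ q) * norm f)) with
      ((/ INR (fact p) * Cmod z ^ p) * (/ INR (fact q) * Cmod w ^ q * (B ^ p * B ^ q * norm f)))
      by ring.
    apply Rmult_le_compat_l; [nra|]; apply Rmult_le_compat_l; [nra|exact I].
  - apply is_lim_seq_const.
  - apply square_triangle_product with (3 := is_series_exp (Cmod z * B))
      (B := exp (Cmod w * B) * norm f); [exact Ux|exact Uy|].
    apply is_series_scal_r, is_series_exp. }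
set (err1 N := norm (minus (sum_n (exp_term L w f) N) (exp_op L w f))).
set (err2 N := norm (minus (sum_n (exp_term L z (exp_op L w f)) N)
                           (exp_op L z (exp_op L w f)))).
set (err3 N := norm (minus (sum_n (exp_term L (z + w)%C f) N) (exp_op L (z + w)%C f))).
apply X_eq_of_lim with (fun N => exp (Cmod z * B) * err1 N + err2 N
  + norm (minus (square_sum u N) (triangle_sum u N)) + err3 N).
- intros N.
  set (E1 := sum_n (exp_term L w f) N) in *.
  set (E2 := sum_n (exp_term L z (exp_op L w f)) N) in *.
  set (E3 := sum_n (exp_term L (z + w)%C f) N) in *.
  (* Replacing the inner partial sum by its limit costs the outer partial sum applied to the error;
     hence the factor [exp (Cmod z * B)] in front of [err1]. *)
  assert (P : minus (square_sum u N) E2 = sum_n (exp_term L z (minus E1 (exp_op L w f))) N).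
  { rewrite Sq; unfold E2; rewrite (sum_n_minus X_AbelianGroup).
    apply sum_n_ext; intros k; symmetry.
    exact (linear_minus _ _ _ (exp_term_linear z k)). }
  replace (minus (exp_op L z (exp_op L w f)) (exp_op L (z + w)%C f))
    with (plus (plus (plus (minus E2 (square_sum u N)) (minus (exp_op L z (exp_op L w f)) E2))
           (minus (square_sum u N) (triangle_sum u N)))
             (minus E3 (exp_op L (z + w)%C f))) by (rewrite Tr; fold E3; X_ring).
  eapply Rle_trans; [apply X_triangle|apply Rplus_le_compat; [|apply Rle_refl]].
  eapply Rle_trans; [apply X_triangle|apply Rplus_le_compat; [|apply Rle_refl]].
  eapply Rle_trans; [apply X_triangle|].
  rewrite (X_norm_minus_sym E2), P, (X_norm_minus_sym _ E2).
  apply Rplus_le_compat; [apply exp_partial_norm_le|apply Rle_refl].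
- assert (Z : forall v s, is_series v s ->
    is_lim_seq (fun N => norm (minus (sum_n v N : X) s)) 0).
  { intros v s H; exact (filterlim_norm_minus _ _ _ _ _ H). }
  pose proof (is_lim_seq_scal_l _ (exp (Cmod z * B)) _ (Z _ _ (exp_op_series w f))) as D1.
  pose proof (is_lim_seq_plus' _ _ _ _ (is_lim_seq_plus' _ _ _ _ (is_lim_seq_plus' _ _ _ _
    D1 (Z _ _ (exp_op_series z (exp_op L w f)))) D) (Z _ _ (exp_op_series (z + w)%C f))) as D2.
  replace 0 with (exp (Cmod z * B) * 0 + 0 + 0 + 0) by ring.
  exact D2.
Qed.

(** The remainder is the series from k = 2 on. For |h| <= 1 a factor |h|^2 can be taken out of each
    term, and what is left is part of the series of [exp B]. *)
Lemma exp_op_first_order h f : Cmod h <= 1 ->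
  norm (minus (minus (exp_op L h f) f) (scal h (L f))) <= exp B * Cmod h ^ 2 * norm f.
Proof.
intros Hh.
assert (S2 : is_series (fun k => exp_term L h f (2 + k))
  (minus (minus (exp_op L h f) f) (scal h (L f)))).
{ apply (is_series_incr_n (exp_term L h f) 2); [lia|].
  refine (eq_ind _ (is_series (exp_term L h f)) (exp_op_series h f) _ _).
  change (Init.Nat.pred 2) with 1%nat.
  rewrite (sum_Sn (G := X_AbelianMonoid)), sum_O; unfold exp_term; rewrite exp_coef_O.
  assert (C1 : exp_coef h 1 = h) by (unfold exp_coef; simpl; rewrite Rinv_1; ring).
  rewrite C1; change (Nat.iter 0 L f) with f; change (Nat.iter 1 L f) with (L f).
  X_ring. }
assert (E2 : ex_series (fun k => / INR (fact (2 + k)) * B ^ (2 + k))).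
{ apply (ex_series_incr_n (fun k => / INR (fact k) * B ^ k) 2); eexists; apply is_series_exp. }
assert (P : forall k, 0 <= / INR (fact k) * B ^ k).
{ intros k; apply Rmult_le_pos; [left; apply Rinv_0_lt_compat, INR_fact_lt_0|now apply pow_le]. }
assert (LE : Series (fun k => / INR (fact (2 + k)) * B ^ (2 + k)) <= exp B).
{ rewrite <- (is_series_unique _ _ (is_series_exp B)).
  rewrite (Series_incr_n (fun k => / INR (fact k) * B ^ k) 2);
    [|lia|eexists; apply is_series_exp].
  pose proof (cond_pos_sum (fun k => / INR (fact k) * B ^ k) (Init.Nat.pred 2) P); lra. }
eapply Rle_trans; [apply (is_series_norm_le _ _ _
  (fun k => Cmod h ^ 2 * norm f * (/ INR (fact (2 + k)) * B ^ (2 + k))) S2)|].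
- intros k; eapply Rle_trans; [apply exp_term_norm_le|].
  rewrite Rpow_mult_distr, (pow_add (Cmod h) 2 k).
  pose proof (P (2 + k)%nat) as Pk; pose proof (norm_ge_0 f) as Nf.
  assert (Hk : 0 <= Cmod h ^ k <= 1).
  { split; [apply pow_le, Cmod_ge_0|].
    rewrite <- (pow1 k); apply pow_incr; split; [apply Cmod_ge_0|exact Hh]. }
  pose proof (pow_le _ 2 (Cmod_ge_0 h)) as H2.
  replace (/ INR (fact (2 + k)) * (Cmod h ^ 2 * Cmod h ^ k * B ^ (2 + k)) * norm f)
    with (Cmod h ^ k * (Cmod h ^ 2 * norm f * (/ INR (fact (2 + k)) * B ^ (2 + k)))) by ring.
  rewrite <- (Rmult_1_l (Cmod h ^ 2 * norm f * _)) at 2.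
  apply Rmult_le_compat_r; [|apply Hk].
  apply Rmult_le_pos; [now apply Rmult_le_pos|exact Pk].
- now apply ex_series_Rscal.
- rewrite Series_scal_l.
  replace (exp B * Cmod h ^ 2 * norm f) with (Cmod h ^ 2 * norm f * exp B) by ring.
  apply Rmult_le_compat_l; [|exact LE].
  apply Rmult_le_pos; [apply pow_le, Cmod_ge_0|apply norm_ge_0].
Qed.

End Exponential.

(** * Dissipativity on a cone *)

(** The closed cone of the [z] with [|arg z| <= acos q]. *)
Definition cone (q : R) (z : C) : Prop := q * Cmod z <= Re z.

Lemma Cmod_scal_pos (s : R) (z : C) : 0 <= s -> Cmod (RtoC s * z)%C = s * Cmod z.
Proof. intros H; rewrite Cmod_mult, Cmod_R, Rabs_pos_eq; [reflexivity|exact H]. Qed.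

Lemma cone_scal q s z : 0 <= s -> cone q z -> cone q (RtoC s * z)%C.
Proof.
intros Hs H; unfold cone in *; rewrite Cmod_scal_pos; [|exact Hs].
replace (Re (RtoC s * z)%C) with (s * Re z); [nra|].
unfold Re; simpl; ring.
Qed.

(** q1 |z + h| <= q1 (1 + eps) |z| <= (q2 - eps) |z| <= Re (z + h): around a point of the smaller
    cone there is room proportional to |z|. *)
Lemma cone_near q1 q2 eps z h :
  0 <= q1 -> q1 * (1 + eps) <= q2 - eps -> cone q2 z -> Cmod h <= eps * Cmod z ->
  cone q1 (z + h)%C.
Proof.
intros Hq He Hz Hh; unfold cone in *.
pose proof (Cmod_triangle z h); pose proof (Cmod_ge_0 z); pose proof (Cmod_ge_0 h).
pose proof (re_le_Cmod h) as Rh; apply Rabs_le_between in Rh.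
change (Re (z + h)%C) with (Re z + Re h).
assert (q1 * Cmod (z + h)%C <= q1 * ((1 + eps) * Cmod z)) by (apply Rmult_le_compat_l; lra).
nra.
Qed.

Lemma is_lim_seq_inv_S : is_lim_seq (fun n => / INR (S n)) 0.
Proof.
apply (is_lim_seq_inv (fun n => INR (S n)) p_infty).
- exact (proj1 (is_lim_seq_incr_1 INR p_infty) is_lim_seq_INR).
- discriminate.
Qed.

Lemma le_of_subdivision (x y K : R) (N : nat) :
  (forall n, (N <= n)%nat -> x <= y + K * / INR (S n)) -> x <= y.
Proof.
intros H.
apply (is_lim_seq_le_loc (fun _ => x) (fun n => y + K * / INR (S n)) (Finite x) (Finite y)).
- now exists N.
- apply is_lim_seq_const.
- replace (Finite y) with (Finite (y + K * 0)) by (f_equal; ring).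
  apply is_lim_seq_plus'; [apply is_lim_seq_const|].
  apply (is_lim_seq_scal_l _ K (Finite 0)), is_lim_seq_inv_S.
Qed.

Lemma inv_S_pos n : 0 < / INR (S n).
Proof. apply Rinv_0_lt_compat, lt_0_INR; lia. Qed.

Lemma eventually_inv_S_le (x eps : R) :
  0 < eps -> exists N, forall n, (N <= n)%nat -> / INR (S n) * x <= eps.
Proof.
intros He.
assert (L : is_lim_seq (fun n => / INR (S n) * x) (0 * x)).
{ apply (is_lim_seq_scal_r _ x (Finite 0)), is_lim_seq_inv_S. }
rewrite Rmult_0_l in L; apply is_lim_seq_spec in L.
destruct (L (mkposreal eps He)) as [N HN]; exists N; intros n Hn.
specialize (HN n Hn); change (Rabs (/ INR (S n) * x - 0) < eps) in HN; apply Rabs_def2 in HN; lra.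
Qed.

(** A mean value inequality in which A plays the part of a bound on the derivative: n + 1 steps of
    length e = 1 / (n + 1) add up to A + M e, and e tends to 0. *)
Lemma increment_bound (F : R -> X) (A M eta : R) :
  0 < eta ->
  (forall s e, 0 <= s -> 0 <= e <= eta -> s + e <= 1 ->
     norm (minus (F (s + e)) (F s)) <= A * e + M * e ^ 2) ->
  norm (minus (F 1) (F 0)) <= A.
Proof.
intros He H.
destruct (eventually_inv_S_le 1 eta He) as [N HN].
apply le_of_subdivision with M N; intros n Hn.
specialize (HN n Hn); rewrite Rmult_1_r in HN.
pose proof (inv_S_pos n) as Ip.
set (e := / INR (S n)) in *.
assert (Ne : INR (S n) * e = 1) by (apply Rinv_r, not_0_INR; lia).
assert (Q : forall k, (k <= S n)%nat ->
  norm (minus (F (INR k * e)) (F 0)) <= INR k * (A * e + M * e ^ 2)).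
{ induction k as [|k IH]; intros Hk.
  - simpl INR; rewrite !Rmult_0_l.
    replace (minus (F 0) (F 0)) with (zero : X) by X_ring.
    right; exact X_norm_zero.
  - replace (INR (S k) * e) with (INR k * e + e) by (rewrite S_INR; ring).
    replace (minus (F (INR k * e + e)) (F 0)) with
      (plus (minus (F (INR k * e + e)) (F (INR k * e))) (minus (F (INR k * e)) (F 0)))
      by X_ring.
    eapply Rle_trans; [apply X_triangle|].
    assert (Hk' : INR k * e + e <= 1).
    { rewrite <- Ne; replace (INR k * e + e) with (INR (S k) * e) by (rewrite S_INR; ring).
      apply Rmult_le_compat_r; [lra|]; now apply le_INR. }
    specialize (IH ltac:(lia)).
    assert (H0 : 0 <= INR k * e) by (apply Rmult_le_pos; [apply pos_INR|lra]).
    specialize (H (INR k * e) e H0 (conj (Rlt_le _ _ Ip) HN) Hk').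
    rewrite S_INR; lra. }
specialize (Q (S n) (Nat.le_refl _)); rewrite Ne in Q.
replace (A + M * e) with (INR (S n) * (A * e + M * e ^ 2)); [exact Q|].
transitivity ((INR (S n) * e) * (A + M * e)); [ring|rewrite Ne; ring].
Qed.

Section BoundedSector.

Context (L : X -> X) (B : R) (L_linear : is_linear L) (B_ge_0 : 0 <= B)
  (L_le : forall f, norm (L f) <= B * norm f).
Context (q c eta : R) (c_gt_0 : 0 < c) (eta_gt_0 : 0 < eta).
Context (L_dissipative : forall h f, cone q h -> Cmod h <= eta ->
  norm (plus f (scal h (L f))) <= norm f - c * Cmod h * norm (L f)).

Local Notation E := (exp_op L).

Lemma exp_op_step h f : cone q h -> Cmod h <= eta -> Cmod h <= 1 ->
  norm (E h f) <= norm f + exp B * Cmod h ^ 2 * norm f - c * Cmod h * norm (L f).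
Proof.
intros Hq H1 H2.
replace (E h f) with (plus (minus (minus (E h f) f) (scal h (L f))) (plus f (scal h (L f))))
  by X_ring.
eapply Rle_trans; [apply X_triangle|].
pose proof (exp_op_first_order L B B_ge_0 L_le h f H2).
pose proof (L_dissipative h f Hq H1); lra.
Qed.

(** [E z] is the power n + 1 of [E (z / (n + 1))], whose norm is at most 1 + K / (n + 1)^2 by
    dissipativity; the product is at most exp (K / (n + 1)), which tends to 1. The limit [eta] on
    the step is met once n is large. *)
Lemma exp_op_contraction z f : cone q z -> norm (E z f) <= norm f.
Proof.
intros Hq.
destruct (eventually_inv_S_le (Cmod z) (Rmin eta 1)) as [N HN].
{ apply Rmin_glb_lt; [exact eta_gt_0|apply Rlt_0_1]. }
set (K := exp B * Cmod z ^ 2).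
assert (HK : 0 <= K).
{ apply Rmult_le_pos; [left; apply exp_pos|apply pow_le, Cmod_ge_0]. }
assert (Q : forall n, (N <= n)%nat -> norm (E z f) <= exp (K * / INR (S n)) * norm f).
{ intros n Hn; specialize (HN n Hn).
  pose proof (inv_S_pos n) as Ip.
  set (e := / INR (S n)) in *.
  assert (Ne : INR (S n) * e = 1) by (apply Rinv_r, not_0_INR; lia).
  assert (I : forall k, norm (E (RtoC (INR k * e) * z)%C f) <= exp (INR k * (K * e ^ 2)) * norm f).
  { induction k as [|k IH].
    - simpl INR; rewrite !Rmult_0_l, exp_0, Cmult_0_l.
      rewrite exp_op_zero; lra.
    - replace (RtoC (INR (S k) * e) * z)%C with (RtoC e * z + RtoC (INR k * e) * z)%C.
      2: { rewrite S_INR, !RtoC_mult, RtoC_plus; ring. }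
      rewrite (exp_op_plus L B L_linear B_ge_0 L_le).
      eapply Rle_trans; [apply exp_op_step|].
      + apply cone_scal; [lra|exact Hq].
      + rewrite Cmod_scal_pos; [|lra]; eapply Rle_trans; [exact HN|apply Rmin_l].
      + rewrite Cmod_scal_pos; [|lra]; eapply Rle_trans; [exact HN|apply Rmin_r].
      + set (g := E _ f) in *.
        assert (P : 0 <= c * Cmod (RtoC e * z)%C * norm (L g)).
        { apply Rmult_le_pos; [|apply norm_ge_0].
          apply Rmult_le_pos; [lra|apply Cmod_ge_0]. }
        rewrite Cmod_scal_pos in P |- * by lra.
        replace (INR (S k) * (K * e ^ 2)) with (K * e ^ 2 + INR k * (K * e ^ 2))
          by (rewrite S_INR; ring).
        rewrite exp_plus, (Rmult_assoc (exp (K * e ^ 2))).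
        apply Rle_trans with ((1 + K * e ^ 2) * norm g).
        * replace ((1 + K * e ^ 2) * norm g)
            with (norm g + exp B * (e * Cmod z) ^ 2 * norm g) by (unfold K; ring).
          lra.
        * apply Rmult_le_compat; [|apply norm_ge_0|apply exp_ineq1_le|exact IH].
          apply Rplus_le_le_0_compat; [lra|]; apply Rmult_le_pos; [exact HK|apply pow2_ge_0]. }
  specialize (I (S n)); rewrite Ne, Cmult_1_l in I.
  replace (INR (S n) * (K * e ^ 2)) with (K * e) in I; [exact I|].
  transitivity (K * e * (INR (S n) * e)); [rewrite Ne; ring|ring]. }
apply (is_lim_seq_le_loc (fun _ => norm (E z f)) (fun n => exp (K * / INR (S n)) * norm f)
  (Finite _) (Finite _)).
- now exists N.
- apply is_lim_seq_const.
- replace (Finite (norm f)) with (Finite (exp 0 * norm f))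
    by (rewrite exp_0; f_equal; apply Rmult_1_l).
  apply (is_lim_seq_scal_r _ (norm f) (Finite (exp 0))).
  apply (is_lim_seq_continuous exp (fun n => K * / INR (S n)) 0).
  + apply derivable_continuous_pt, derivable_pt_exp.
  + replace (Finite 0) with (Finite (K * 0)) by (f_equal; ring).
    apply (is_lim_seq_scal_l _ K (Finite 0)), is_lim_seq_inv_S.
Qed.

Lemma exp_op_smoothing z f : cone q z -> c * Cmod z * norm (L (E z f)) <= norm f.
Proof.
intros Hq.
destruct (eventually_inv_S_le (Cmod z) (Rmin eta 1)) as [N HN].
{ apply Rmin_glb_lt; [exact eta_gt_0|apply Rlt_0_1]. }
set (K := exp B * Cmod z ^ 2 * norm f).
apply le_of_subdivision with K N; intros n Hn; specialize (HN n Hn).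
pose proof (inv_S_pos n) as Ip.
set (e := / INR (S n)) in *.
assert (Ne : INR (S n) * e = 1) by (apply Rinv_r, not_0_INR; lia).
(* The invariant adds to the current norm the whole gain so far, measured with the current value of
   norm (L _). As that value does not increase from step to step, earlier gains can be expressed
   through it. *)
assert (I : forall k, c * (INR k * e * Cmod z) * norm (L (E (RtoC (INR k * e) * z)%C f))
   + norm (E (RtoC (INR k * e) * z)%C f) <= norm f + INR k * (K * e ^ 2)).
{ induction k as [|k IH].
  - simpl INR; rewrite !Rmult_0_l, Cmult_0_l.
    rewrite exp_op_zero; lra.
  - replace (RtoC (INR (S k) * e) * z)%C with (RtoC e * z + RtoC (INR k * e) * z)%C.
    2: { rewrite S_INR, !RtoC_mult, RtoC_plus; ring. }
    rewrite (exp_op_plus L B L_linear B_ge_0 L_le).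
    assert (He : cone q (RtoC e * z)%C) by (apply cone_scal; [lra|exact Hq]).
    assert (S1 : norm (E (RtoC (INR k * e) * z)%C f) <= norm f).
    { apply exp_op_contraction, cone_scal; [|exact Hq].
      apply Rmult_le_pos; [apply pos_INR|lra]. }
    set (g := E (RtoC (INR k * e) * z)%C f) in *.
    assert (S2 : norm (L (E (RtoC e * z)%C g)) <= norm (L g)).
    { rewrite (exp_op_comm L B L_linear B_ge_0 L_le).
      now apply exp_op_contraction. }
    assert (S3 : norm (E (RtoC e * z)%C g) <= norm g + exp B * Cmod (RtoC e * z)%C ^ 2 * norm g
      - c * Cmod (RtoC e * z)%C * norm (L g)).
    { apply exp_op_step; [exact He| |].
      - rewrite Cmod_scal_pos; [|lra]; eapply Rle_trans; [exact HN|apply Rmin_l].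
      - rewrite Cmod_scal_pos; [|lra]; eapply Rle_trans; [exact HN|apply Rmin_r]. }
    rewrite Cmod_scal_pos in S3; [|lra].
    assert (S4 : exp B * (e * Cmod z) ^ 2 * norm g <= K * e ^ 2).
    { unfold K; replace (exp B * Cmod z ^ 2 * norm f * e ^ 2)
        with (exp B * (e * Cmod z) ^ 2 * norm f) by ring.
      apply Rmult_le_compat_l; [|exact S1].
      apply Rmult_le_pos; [left; apply exp_pos|apply pow2_ge_0]. }
    assert (S5 : c * (INR (S k) * e * Cmod z) * norm (L (E (RtoC e * z)%C g))
      <= c * (INR (S k) * e * Cmod z) * norm (L g)).
    { apply Rmult_le_compat_l; [|exact S2].
      apply Rmult_le_pos; [lra|]; apply Rmult_le_pos; [|apply Cmod_ge_0].
      apply Rmult_le_pos; [apply pos_INR|lra]. }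
    rewrite S_INR in *; nra. }
specialize (I (S n)); rewrite Ne, Cmult_1_l in I.
replace (INR (S n) * (K * e ^ 2)) with (K * e) in I.
2: { transitivity (K * e * (INR (S n) * e)); [rewrite Ne; ring|ring]. }
pose proof (norm_ge_0 (E z f)); rewrite Rmult_1_l in I; lra.
Qed.

(** Half of z is spent on each factor L, since L commutes with its exponential: L L E z = L E (z/2)
    L E (z/2). *)
Lemma exp_op_second_order_smoothing z f :
  cone q z -> (c * Cmod z / 2) ^ 2 * norm (L (L (E z f))) <= norm f.
Proof.
intros Hq.
assert (Hh : cone q (RtoC (/ 2) * z)%C) by (apply cone_scal; [lra|exact Hq]).
assert (Ez : E z f = E (RtoC (/ 2) * z)%C (E (RtoC (/ 2) * z)%C f)).
{ rewrite <- (exp_op_plus L B L_linear B_ge_0 L_le); f_equal.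
  rewrite <- Cmult_plus_distr_r, <- RtoC_plus.
  replace (/ 2 + / 2) with 1 by field; ring. }
rewrite Ez, (exp_op_comm L B L_linear B_ge_0 L_le).
set (g := E (RtoC (/ 2) * z)%C f).
pose proof (exp_op_smoothing _ (L g) Hh) as S1.
pose proof (exp_op_smoothing _ f Hh) as S2; fold g in S2.
rewrite Cmod_scal_pos in S1, S2 by lra.
set (m := norm (L (E (RtoC (/ 2) * z)%C (L g)))) in *.
set (k := c * (/ 2 * Cmod z)) in *.
assert (0 <= k) by (apply Rmult_le_pos; [lra|]; pose proof (Cmod_ge_0 z); lra).
replace ((c * Cmod z / 2) ^ 2 * m) with (k * (k * m)) by (unfold k; field).
apply Rle_trans with (k * norm (L g)); [|exact S2].
now apply Rmult_le_compat_l.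
Qed.

(** * Second-order expansion along a segment in the cone *)

Section Segment.

Context (z h : C) (r : R) (r_gt_0 : 0 < r).
Context (segment_ok : forall s, 0 <= s <= 1 ->
  cone q (z + RtoC s * h)%C /\ r <= Cmod (z + RtoC s * h)%C).

Lemma exp_op_second_order_segment f s : 0 <= s <= 1 ->
  norm (L (L (E (z + RtoC s * h)%C f))) <= (2 / (c * r)) ^ 2 * norm f.
Proof.
intros Hs; destruct (segment_ok s Hs) as [Hq Hr].
pose proof (exp_op_second_order_smoothing _ f Hq) as S.
set (m := norm (L (L (E (z + RtoC s * h)%C f)))) in *.
assert (m_ge_0 : 0 <= m) by apply norm_ge_0.
assert (S' : (c * r / 2) ^ 2 * m <= norm f).
{ eapply Rle_trans; [|exact S]; apply Rmult_le_compat_r; [exact m_ge_0|].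
  apply pow_incr; split; nra. }
replace m with ((2 / (c * r)) ^ 2 * ((c * r / 2) ^ 2 * m)) by (field; lra).
apply Rmult_le_compat_l; [apply pow2_ge_0|exact S'].
Qed.

Lemma small_step e : 0 <= e <= / (1 + Cmod h) -> Cmod (RtoC e * h)%C <= 1.
Proof.
intros He; pose proof (Cmod_ge_0 h); rewrite Cmod_scal_pos by lra.
apply Rle_trans with (/ (1 + Cmod h) * (1 + Cmod h)).
- apply Rmult_le_compat; lra.
- right; field; lra.
Qed.

Lemma step_width_pos : 0 < / (1 + Cmod h).
Proof. apply Rinv_0_lt_compat; pose proof (Cmod_ge_0 h); lra. Qed.

Lemma exp_op_segment_step s e f : 0 <= s <= 1 -> 0 <= e <= / (1 + Cmod h) ->
  norm (minus (minus (E (z + RtoC (s + e) * h)%C f) (E (z + RtoC s * h)%C f))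
     (scal (RtoC e * h)%C (L (E (z + RtoC s * h)%C f))))
  <= exp B * Cmod h ^ 2 * norm f * e ^ 2.
Proof.
intros Hs He.
replace (z + RtoC (s + e) * h)%C with (RtoC e * h + (z + RtoC s * h))%C
  by (rewrite RtoC_plus; ring).
rewrite (exp_op_plus L B L_linear B_ge_0 L_le).
pose proof (exp_op_contraction _ f (proj1 (segment_ok s Hs))) as G.
set (g := E (z + RtoC s * h)%C f) in *.
eapply Rle_trans; [apply (exp_op_first_order L B B_ge_0 L_le), small_step, He|].
rewrite Cmod_scal_pos by lra.
replace (exp B * Cmod h ^ 2 * norm f * e ^ 2) with (exp B * (e * Cmod h) ^ 2 * norm f) by ring.
apply Rmult_le_compat_l; [|exact G].
apply Rmult_le_pos; [left; apply exp_pos|apply pow2_ge_0].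
Qed.

(** The derivative of s |-> L E (z + s h) f is h L L E (z + s h) f, bounded on the segment by
    second-order smoothing. The norm bound B of L only enters the local error, so the result is
    uniform over truncations. *)
Lemma exp_op_derivative_increment f :
  norm (minus (L (E (z + h)%C f)) (L (E z f))) <= Cmod h * ((2 / (c * r)) ^ 2 * norm f).
Proof.
pose proof (increment_bound (fun s => L (E (z + RtoC s * h)%C f))
  (Cmod h * ((2 / (c * r)) ^ 2 * norm f)) (B * (exp B * Cmod h ^ 2 * norm f))
  (/ (1 + Cmod h)) step_width_pos) as I.
cbv beta in I; rewrite Cmult_1_l, Cmult_0_l, Cplus_0_r in I; apply I; clear I.
intros s e Hs He Hse.
assert (Hs' : 0 <= s <= 1) by lra.
pose proof (exp_op_segment_step s e f Hs' He) as S1.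
pose proof (exp_op_second_order_segment f s Hs') as S2.
set (g := E (z + RtoC s * h)%C f) in *.
set (g' := E (z + RtoC (s + e) * h)%C f) in *.
replace (minus (L g') (L g)) with
  (plus (L (minus (minus g' g) (scal (RtoC e * h)%C (L g)))) (scal (RtoC e * h)%C (L (L g)))).
2: { rewrite !(linear_minus _ _ _ L_linear), (linear_scal _ L_linear); X_ring. }
eapply Rle_trans; [apply X_triangle|].
rewrite X_norm_scal_eq, Cmod_scal_pos by lra.
pose proof (L_le (minus (minus g' g) (scal (RtoC e * h)%C (L g)))) as S3.
assert (B * norm (minus (minus g' g) (scal (RtoC e * h)%C (L g)))
  <= B * (exp B * Cmod h ^ 2 * norm f * e ^ 2)) by now apply Rmult_le_compat_l.
assert (e * Cmod h * norm (L (L g)) <= e * Cmod h * ((2 / (c * r)) ^ 2 * norm f)).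
{ apply Rmult_le_compat_l; [|exact S2].
  apply Rmult_le_pos; [lra|apply Cmod_ge_0]. }
lra.
Qed.

End Segment.

(** The mean value inequality for s |-> E (z + s h) f - s h L E z f, whose derivative h (L E (z + s
    h) f - L E z f) is controlled by [exp_op_derivative_increment]. *)
Lemma exp_op_expansion z h r f : 0 < r ->
  (forall s, 0 <= s <= 1 ->
     cone q (z + RtoC s * h)%C /\ r <= Cmod (z + RtoC s * h)%C) ->
  norm (minus (minus (E (z + h)%C f) (E z f)) (scal h (L (E z f))))
  <= Cmod h ^ 2 * ((2 / (c * r)) ^ 2 * norm f).
Proof.
intros Hr Hseg.
pose proof (increment_bound
  (fun s => minus (E (z + RtoC s * h)%C f) (scal (RtoC s * h)%C (L (E z f))))
  (Cmod h ^ 2 * ((2 / (c * r)) ^ 2 * norm f)) (exp B * Cmod h ^ 2 * norm f)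
  (/ (1 + Cmod h)) (step_width_pos h)) as I.
cbv beta in I; rewrite Cmult_1_l, Cmult_0_l, Cplus_0_r in I.
match type of I with _ -> norm ?x <= _ =>
  replace (minus (minus (E (z + h)%C f) (E z f)) (scal h (L (E z f)))) with x by X_ring end.
apply I; clear I; intros s e Hs He Hse.
assert (Hs' : 0 <= s <= 1) by lra.
pose proof (exp_op_segment_step z h r Hseg s e f Hs' He) as S1.
assert (S2 : norm (minus (L (E (z + RtoC s * h)%C f)) (L (E z f)))
  <= Cmod (RtoC s * h)%C * ((2 / (c * r)) ^ 2 * norm f)).
{ apply exp_op_derivative_increment; [exact Hr|]; intros t Ht.
  rewrite Cmult_assoc, <- RtoC_mult; apply Hseg; nra. }
set (g := E (z + RtoC s * h)%C f) in *.
set (g' := E (z + RtoC (s + e) * h)%C f) in *.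
match goal with |- norm ?x <= _ => replace x with
  (plus (minus (minus g' g) (scal (RtoC e * h)%C (L g)))
     (scal (RtoC e * h)%C (minus (L g) (L (E z f))))) by (rewrite RtoC_plus; X_ring) end.
eapply Rle_trans; [apply X_triangle|].
rewrite X_norm_scal_eq, Cmod_scal_pos in * by lra.
assert (e * Cmod h * norm (minus (L g) (L (E z f)))
  <= e * Cmod h * (Cmod h * ((2 / (c * r)) ^ 2 * norm f))).
{ pose proof (Cmod_ge_0 h); apply Rmult_le_compat_l; [nra|].
  eapply Rle_trans; [exact S2|]; apply Rmult_le_compat_r; [|nra].
  apply Rmult_le_pos; [apply pow2_ge_0|apply norm_ge_0]. }
lra.
Qed.

End BoundedSector.

(** * Local boundedness of C0-semigroups *)

Lemma at_right_0_ball (P : R -> Prop) :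
  at_right 0 P -> exists delta, 0 < delta /\ forall t, 0 < t < delta -> P t.
Proof.
intros [delta H]; exists delta; split; [apply cond_pos|].
intros t [H0 H1]; apply H; [|exact H0].
change (Rabs (t - 0) < delta); rewrite Rminus_0_r, Rabs_pos_eq; lra.
Qed.

(** Since 2 l xi = l (x + xi) - l (x - xi), one of these two vectors has an image at least as large
    as that of xi. A centre can thus be moved to where an operator is large, whatever its value at
    x. *)
Lemma norm_max_pm (l : X -> X) (x xi : X) :
  is_linear l -> exists x', norm (minus x' x) = norm xi /\ norm (l xi) <= norm (l x').
Proof.
intros L.
destruct (Rle_lt_dec (norm (l xi)) (norm (l (plus x xi)))) as [H|H].
- exists (plus x xi); split; [|exact H].
  f_equal; X_ring.
- exists (minus x xi); split.
  + rewrite X_norm_minus_sym; f_equal; X_ring.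
  + apply Rnot_lt_le; intros H'.
    pose proof (X_triangle_minus (l (plus x xi)) (l (minus x xi))) as T.
    replace (minus (l (plus x xi)) (l (minus x xi))) with (scal (RtoC (1 + 1)) (l xi)) in T.
    * rewrite X_norm_scal_eq, Cmod_R, Rabs_pos_eq in T; lra.
    * rewrite (linear_plus l L), (linear_minus l _ _ L), RtoC_plus; X_ring.
Qed.

Lemma norm_minus_perturb (a b c : X) :
  norm (minus b c) - norm (minus a b) <= norm (minus a c)
    <= norm (minus b c) + norm (minus a b).
Proof.
pose proof (X_triangle (minus a b) (minus b c)) as T1.
pose proof (X_triangle_minus (minus a c) (minus a b)) as T2.
match type of T1 with norm ?u <= _ => replace u with (minus a c) in T1 by X_ring end.
replace (minus (minus a c) (minus a b)) with (minus b c) in T2 by X_ring.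
split; lra.
Qed.

Section LocalBoundedness.

Context (U : R -> X -> X) (U_C0 : C0_semigroup U).

(* Shrinking balls on which [U t] stays large, for suitable small [t]: the
   nested-ball form of the uniform boundedness principle. *)
Lemma nested_ball_step (x : X) (eps M t : R) (xi : X) : 0 < eps -> 0 <= t -> 0 <= M ->
  (M + 1) / eps * norm xi < norm (U t xi) ->
  exists (x' : X) (eps' : posreal), norm (minus x' x) <= eps /\ 2 * eps' <= eps /\
    forall y, norm (minus y x') <= 2 * eps' -> M <= norm (U t y).
Proof.
intros He Ht HM Hxi.
pose proof (proj1 U_C0 t Ht) as L.
destruct (linear_norm _ L) as (b & Hb & Lb).
assert (X0 : 0 < norm xi).
{ destruct (norm_ge_0 xi) as [H|H]; [exact H|exfalso].
  specialize (Lb xi); rewrite <- H, Rmult_0_r in *; lra. }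
set (k := RtoC (eps / norm xi)).
assert (K : Cmod k = eps / norm xi).
{ unfold k; rewrite Cmod_R; apply Rabs_pos_eq; left; now apply Rdiv_lt_0_compat. }
assert (N1 : norm (scal k xi) = eps) by (rewrite X_norm_scal_eq, K; field; lra).
assert (N2 : M + 1 < norm (U t (scal k xi))).
{ rewrite (linear_scal _ L), X_norm_scal_eq, K.
  replace (M + 1) with (eps / norm xi * ((M + 1) / eps * norm xi)) by (field; lra).
  apply Rmult_lt_compat_l; [now apply Rdiv_lt_0_compat|exact Hxi]. }
destruct (norm_max_pm _ x (scal k xi) L) as (x' & D & N3).
(* The radius 1 / (2 b) keeps [U t y] within 1 of [U t x'] on the doubled ball, which uses up the 1
   in M + 1. *)
assert (E0 : 0 < Rmin (eps / 2) (/ (2 * b))).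
{ apply Rmin_glb_lt; [lra|apply Rinv_0_lt_compat; lra]. }
exists x', (mkposreal _ E0); split; [lra|split].
- simpl; pose proof (Rmin_l (eps / 2) (/ (2 * b))); lra.
- intros y Hy; simpl in Hy.
  pose proof (Rmin_r (eps / 2) (/ (2 * b))) as R2.
  assert (B : b * norm (minus y x') <= 1).
  { apply Rle_trans with (b * (2 * / (2 * b))); [|right; field; lra].
    apply Rmult_le_compat_l; lra. }
  pose proof (Lb (minus y x')) as B'.
  pose proof (X_triangle_minus (U t y) (U t (minus y x'))) as T.
  replace (minus (U t y) (U t (minus y x'))) with (U t x') in T; [lra|].
  rewrite (linear_minus _ _ _ L); X_ring.
Qed.

(** Otherwise nested balls can be chosen on which some [U t] with t <= 1 / (k + 1) is at least k. At
    their common point the orbit is unbounded near 0, against strong continuity. *)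
Lemma C0_bounded_near_0 :
  exists delta M, 0 < delta /\ 1 <= M /\
    forall t x, 0 <= t <= delta -> norm (U t x) <= M * norm x.
Proof.
apply NNPP; intros Hn.
set (Next (k : nat) (p p' : X * posreal) :=
  norm (minus (fst p') (fst p)) <= snd p /\ 2 * snd p' <= snd p /\
  exists t, 0 <= t <= / INR (S k) /\
    forall y, norm (minus y (fst p')) <= 2 * snd p' -> INR k <= norm (U t y)).
assert (Step : forall k p, exists p', Next k p p').
{ intros k [x eps]; apply NNPP; intros Hk; apply Hn.
  exists (/ INR (S k)), (Rmax 1 ((INR k + 1) / eps)).
  split; [apply inv_S_pos|split; [apply Rmax_l|]].
  intros t xi Ht; apply Rnot_lt_le; intros H; apply Hk.
  destruct (nested_ball_step x eps (INR k) t xi) as (x' & eps' & H1 & H2 & H3).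
  - apply cond_pos.
  - apply Ht.
  - apply pos_INR.
  - eapply Rle_lt_trans; [|exact H]; apply Rmult_le_compat_r; [apply norm_ge_0|apply Rmax_r].
  - exists (x', eps'); split; [exact H1|split; [exact H2|]]; now exists t. }
destruct (choice _ (fun k => choice (Next k) (Step k))) as [F HF]; clear Hn Step.
set (p := nat_rect (fun _ => (X * posreal)%type) (zero, mkposreal 1 Rlt_0_1) F).
assert (Hp : forall k, Next k (p k) (p (S k))) by (intros k; apply HF).
set (x k := fst (p k)); set (eps k := pos (snd (p k))).
assert (EP : forall k, 0 < eps k) by (intros; apply cond_pos).
assert (EH : forall k, 2 * eps (S k) <= eps k) by (intros k; apply Hp).
assert (DX : forall k, norm (minus (x (S k)) (x k)) <= eps k) by (intros k; apply Hp).
(* As the radii at least halve, [eps k <= 2 * (eps k - eps (S k))], and the displacements telescope.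
   The limit is thus within [2 * eps k] of every centre, hence the doubled balls. *)
assert (Cau : forall k m, norm (minus (x (m + k)%nat) (x k)) <= 2 * (eps k - eps (m + k)%nat)).
{ intros k m; induction m as [|m IH].
  - simpl; replace (minus (x k) (x k)) with (zero : X) by X_ring.
    change (X_norm X_zero <= 2 * (eps k - eps k)); rewrite X_norm_zero; lra.
  - simpl; replace (minus (x (S (m + k))) (x k))
      with (plus (minus (x (S (m + k))) (x (m + k)%nat)) (minus (x (m + k)%nat) (x k)))
      by X_ring.
    eapply Rle_trans; [apply X_triangle|].
    specialize (DX (m + k)%nat); specialize (EH (m + k)%nat); lra. }
assert (EG : forall k, eps k <= (1 / 2) ^ k).
{ induction k as [|k IH]; [simpl; unfold eps; simpl; lra|].
  simpl; specialize (EH k); lra. }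
destruct (X_ex_series (fun k => minus (x (S k)) (x k))) as [s Hs].
{ apply (ex_series_le (K := R_AbsRing) (V := R_CompleteNormedModule))
    with (b := fun k => (1 / 2) ^ k).
  - intros k; change (Rabs (norm (minus (x (S k)) (x k))) <= (1 / 2) ^ k).
    rewrite Rabs_pos_eq by apply norm_ge_0; eapply Rle_trans; [apply DX|apply EG].
  - eexists; apply is_series_geom; rewrite Rabs_pos_eq; lra. }
assert (Part : forall n, sum_n (fun k => minus (x (S k)) (x k)) n = x (S n)).
{ induction n as [|n IH].
  - rewrite sum_O; change (x 0%nat) with (zero : X); X_ring.
  - rewrite sum_Sn, IH; X_ring. }
assert (Lim : forall k, norm (minus s (x k)) <= 2 * eps k).
{ intros k.
  apply (is_lim_seq_le_loc
    (fun n => norm (minus (sum_n (fun k => minus (x (S k)) (x k)) n) (x k) : X))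
    (fun _ => 2 * eps k) (Finite (norm (minus s (x k)))) (Finite (2 * eps k))).
  - exists k; intros n Hn; rewrite Part.
    replace (S n) with (S n - k + k)%nat by lia.
    eapply Rle_trans; [apply Cau|]; pose proof (EP (S n - k + k)%nat); lra.
  - pose proof (filterlim_norm_minus _ _ _ _ _ Hs) as H0.
    apply (is_lim_seq_le_le (fun n => norm (minus s (x k))
        - norm (minus (sum_n (fun k => minus (x (S k)) (x k)) n) s))
      _ (fun n => norm (minus s (x k))
        + norm (minus (sum_n (fun k => minus (x (S k)) (x k)) n) s))).
    + intros n; apply norm_minus_perturb.
    + replace (Finite (norm (minus s (x k)))) with (Finite (norm (minus s (x k)) - 0))
        by (f_equal; ring).
      apply is_lim_seq_minus'; [apply is_lim_seq_const|exact H0].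
    + replace (Finite (norm (minus s (x k)))) with (Finite (norm (minus s (x k)) + 0))
        by (f_equal; ring).
      apply is_lim_seq_plus'; [apply is_lim_seq_const|exact H0].
  - apply is_lim_seq_const. }
destruct U_C0 as (_ & SO & _ & SC).
destruct (at_right_0_ball _ (proj1 (filterlim_locally_ball_norm _ _) (SC s)
  (mkposreal 1 Rlt_0_1))) as (delta & Hd & HB).
assert (B : forall t, 0 <= t < delta -> norm (U t s) <= norm s + 1).
{ intros t [[Ht|Ht] Htd].
  - specialize (HB t (conj Ht Htd)); change (X_norm (X_plus (U t s) (X_opp s)) < 1) in HB.
    pose proof (X_triangle (minus (U t s) s) s) as T.
    match type of T with norm ?u <= _ => replace u with (U t s) in T by X_ring end.
    change (norm (minus (U t s) s)) with (X_norm (X_plus (U t s) (X_opp s))) in T; lra.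
  - rewrite <- Ht, SO; lra. }
destruct (eventually_inv_S_le 1 (delta / 2)) as [N1 HN1]; [lra|].
destruct (nfloor_ex (norm s + 2)) as [N2 HN2]; [pose proof (norm_ge_0 s); lra|].
(* [N1] makes t smaller than delta, and N2 + 1 exceeds norm s + 2, so that k is larger than the
   bound norm s + 1 on the orbit. *)
set (k := (N1 + N2 + 1)%nat).
destruct (Hp k) as (_ & _ & t & Ht & Hl).
specialize (Hl s (Lim (S k))).
specialize (HN1 k ltac:(unfold k; lia)).
specialize (B t ltac:(lra)).
unfold k in Hl; rewrite !plus_INR in Hl; simpl INR in Hl.
pose proof (pos_INR N1); lra.
Qed.

Lemma C0_bounded_on_interval T :
  exists M, 0 <= M /\ forall t x, 0 <= t <= T -> norm (U t x) <= M * norm x.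
Proof.
destruct C0_bounded_near_0 as (delta & M & Hd & HM & HB).
assert (Q : forall n t x, 0 <= t <= INR n * delta -> norm (U t x) <= M ^ n * norm x).
{ induction n as [|n IH]; intros t x Ht.
  - simpl INR in Ht; replace t with 0 by lra.
    rewrite (proj1 (proj2 U_C0)); simpl; lra.
  - rewrite S_INR in Ht; pose proof (norm_ge_0 x) as X0.
    assert (MP : 1 <= M ^ n) by now apply pow_R1_Rle.
    destruct (Rle_lt_dec t delta) as [H|H].
    + eapply Rle_trans; [apply HB; lra|].
      apply Rmult_le_compat_r; [exact X0|]; simpl; nra.
    + replace t with (delta + (t - delta)) by ring.
      rewrite (proj1 (proj2 (proj2 U_C0))) by lra.
      eapply Rle_trans; [apply HB; lra|].
      simpl; rewrite Rmult_assoc; apply Rmult_le_compat_l; [lra|]; apply IH; lra. }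
destruct (nfloor_ex (Rmax 0 (T / delta))) as [n Hn]; [apply Rmax_l|].
exists (M ^ S n); split; [apply pow_le; lra|].
intros t x Ht; apply Q; split; [lra|].
pose proof (Rmax_r 0 (T / delta)); rewrite S_INR.
apply Rle_trans with (T / delta * delta); [|apply Rmult_le_compat_r; lra].
replace (T / delta * delta) with T by (field; lra); lra.
Qed.

End LocalBoundedness.

(** * Compactness from small tails *)

Definition increasing (s : nat -> nat) : Prop := forall k, (s k < s (S k))%nat.

Lemma increasing_ge s : increasing s -> forall k, (k <= s k)%nat.
Proof. intros H; induction k as [|k IH]; [lia|]; specialize (H k); lia. Qed.

Lemma increasing_lt s : increasing s -> forall i j, (i < j)%nat -> (s i < s j)%nat.
Proof.
intros H i j Hij; induction Hij as [|j Hij IH]; [apply H|]; specialize (H j); lia.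
Qed.

Lemma increasing_comp s s' : increasing s -> increasing s' -> increasing (fun k => s (s' k)).
Proof. intros H H' k; apply increasing_lt; [exact H|apply H']. Qed.

Lemma bounded_subsequence (u : nat -> R) M :
  (forall k, Rabs (u k) <= M) ->
  exists s, increasing s /\ exists l : R, is_lim_seq (fun k => u (s k)) l.
Proof.
intros B.
destruct (ex_LimSup_seq u) as [[l| |] H].
2: { exfalso; destruct (H M 0%nat) as (n & _ & Hn).
     specialize (B n); apply Rabs_le_between in B; lra. }
2: { exfalso; destruct (H (- M)) as (n & Hn); specialize (Hn n (Nat.le_refl n)).
     specialize (B n); apply Rabs_le_between in B; lra. }
(* [fst p] sets the accuracy and [snd p] is the last index used. *)
assert (Step : forall p : nat * nat, exists n,
  (snd p < n)%nat /\ Rabs (u n - l) < / INR (S (fst p))).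
{ intros [k m]; destruct (H (mkposreal _ (inv_S_pos k))) as [H1 [N H2]]; cbn [pos] in *.
  destruct (H1 (Nat.max N (S m))) as (n & Hn & H3); exists n.
  split; [simpl; lia|]; specialize (H2 n ltac:(lia)); cbn [fst].
  apply Rabs_def1; lra. }
destruct (choice _ Step) as [F HF].
set (s := nat_rect (fun _ => nat) (F (0, 0)%nat) (fun k m => F (S k, m))).
exists s; split.
- intros k; exact (proj1 (HF (S k, s k))).
- exists l; apply is_lim_seq_spec; intros eps.
  destruct (eventually_inv_S_le 1 eps (cond_pos eps)) as [N HN].
  exists N; intros n Hn; specialize (HN n Hn); rewrite Rmult_1_r in HN.
  eapply Rlt_le_trans; [|exact HN].
  destruct n as [|n]; [exact (proj2 (HF (0, 0)%nat))|exact (proj2 (HF (S n, s n)))].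
Qed.

(** Cantor's diagonal: [phi n] is the sequence after n extractions, and along [phi (S i)] coordinate
    i converges. By [Tail] the diagonal runs, from index [S i] on, through [phi (S i)] at indices
    tending to infinity. *)
Lemma diagonal_subsequence (v : nat -> nat -> R) (M : nat -> R) :
  (forall k i, Rabs (v k i) <= M i) ->
  exists s, increasing s /\ forall i, exists l : R, is_lim_seq (fun k => v (s k) i) l.
Proof.
intros B.
assert (Step : forall p : nat * (nat -> nat), exists s, increasing s /\
  exists l : R, is_lim_seq (fun k => v (snd p (s k)) (fst p)) l).
{ intros [i phi].
  exact (bounded_subsequence (fun k => v (phi k) i) (M i) (fun k => B (phi k) i)). }
destruct (choice _ Step) as [F HF].
set (phi := nat_rect (fun _ => nat -> nat) (fun k => k)
  (fun n phi k => phi (F (n, phi) k))).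
assert (Tail : forall n m, exists rho, increasing rho /\
  forall k, phi (m + n)%nat k = phi n (rho k)).
{ intros n m; induction m as [|m (rho & Hr & E)].
  - exists (fun k => k); split; [intros k; lia|reflexivity].
  - exists (fun k => rho (F ((m + n)%nat, phi (m + n)%nat) k)); split.
    + apply increasing_comp; [exact Hr|apply HF].
    + intros k; simpl; apply E. }
assert (Inc : forall n, increasing (phi n)).
{ intros n; destruct (Tail 0%nat n) as (rho & Hr & E); intros k.
  rewrite Nat.add_0_r in E; rewrite !E; apply Hr. }
exists (fun k => phi k k); split.
- intros k; simpl; apply increasing_lt; [apply Inc|].
  pose proof (increasing_ge _ (proj1 (HF (k, phi k))) (S k)); lia.
- intros i; destruct (proj2 (HF (i, phi i))) as [l Hl]; simpl in Hl; exists l.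
  destruct (choice _ (fun m => Tail (S i) m)) as [rho Hrho].
  apply (is_lim_seq_incr_n _ (S i)).
  apply is_lim_seq_ext
    with (fun m => v (phi i (F (i, phi i) (rho m (m + S i)%nat))) i).
  { intros m; f_equal; symmetry; apply (proj2 (Hrho m)). }
  apply (is_lim_seq_subseq (fun k => v (phi i (F (i, phi i) k)) i) l
    (fun m => rho m (m + S i)%nat)); [|exact Hl].
  intros P [N HN]; exists N; intros m Hm; apply HN.
  pose proof (increasing_ge _ (proj1 (Hrho m)) (m + S i)); lia.
Qed.

Lemma complex_diagonal_subsequence (v : nat -> nat -> C) M :
  (forall k i, Cmod (v k i) <= M) ->
  exists s, increasing s /\
    forall i, exists l : C, filterlim (fun k => v (s k) i) eventually (locally l).
Proof.
intros B.
(* Real and imaginary parts are interleaved as the even and odd coordinates of one real array. *)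
destruct (diagonal_subsequence
  (fun k i => if Nat.even i then Re (v k (Nat.div2 i)) else Im (v k (Nat.div2 i))) (fun _ => M))
  as (s & Hs & H).
{ intros k i; eapply Rle_trans; [|apply (B k (Nat.div2 i))].
  pose proof (Rmax_Cmod (v k (Nat.div2 i))) as X.
  destruct (Nat.even i); eapply Rle_trans; [|exact X| |exact X];
    [apply Rmax_l|apply Rmax_r]. }
exists s; split; [exact Hs|]; intros i.
destruct (H (2 * i)%nat) as [a Ha], (H (2 * i + 1)%nat) as [b Hb].
exists (a, b); apply filterlim_locally; intros eps.
assert (E0 : Nat.even (2 * i) = true) by (rewrite Nat.even_mul; reflexivity).
assert (E1 : Nat.even (2 * i + 1) = false)
  by (rewrite Nat.even_add, Nat.even_mul; reflexivity).
assert (D0 : Nat.div2 (2 * i) = i) by apply Nat.div2_double.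
assert (D1 : Nat.div2 (2 * i + 1) = i)
  by (rewrite Nat.add_1_r; apply Nat.div2_succ_double).
rewrite E0, D0 in Ha; rewrite E1, D1 in Hb.
apply (filter_imp (fun k => ball a eps (Re (v (s k) i)) /\ ball b eps (Im (v (s k) i)))).
- intros k [P Q]; split; [exact P|exact Q].
- apply filter_and; [exact (proj1 (filterlim_locally _ _) Ha eps)
    |exact (proj1 (filterlim_locally _ _) Hb eps)].
Qed.

Definition cut_seq (N : nat) (f : nat -> C) (i : nat) : C := if (i <=? N)%nat then 0%C else f i.

Lemma inX_cut N (f : X) : inX (cut_seq N f).
Proof.
apply (inX_le _ _ eq_refl (proj2 (XseqP f))).
intros i; unfold cut_seq; destruct (i <=? N)%nat; [|lra].
rewrite Cmod_0, Rmult_0_r; apply X_term_ge_0.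
Qed.

Definition cut (N : nat) (f : X) : X := mkX _ (inX_cut N f).

Lemma cut_low N f i : (i <= N)%nat -> cut N f i = 0%C.
Proof. intros H; simpl; unfold cut_seq; apply Nat.leb_le in H; now rewrite H. Qed.

Lemma cut_high N f i : (N < i)%nat -> cut N f i = f i.
Proof. intros H; simpl; unfold cut_seq; apply Nat.leb_gt in H; now rewrite H. Qed.

Ltac cut_ring N := apply X_ext; intros ?i; X_coords; destruct (Nat.le_gt_cases i N);
  [rewrite ?cut_low by assumption|rewrite ?cut_high by assumption]; X_coords; Cring.

Lemma cut_norm_le N (f : X) : norm (cut N f) <= norm f.
Proof.
apply Series_le; [|apply XseqP].
intros i; split; [apply X_term_ge_0|]; destruct (Nat.le_gt_cases i N).
- rewrite cut_low, Cmod_0, Rmult_0_r by assumption; apply X_term_ge_0.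
- rewrite cut_high by assumption; apply Rle_refl.
Qed.

Lemma cut_linear N : is_linear (cut N).
Proof.
split.
- intros f h; cut_ring N.
- intros k f; cut_ring N.
- exists 1; split; [lra|]; intros f; rewrite Rmult_1_l; apply cut_norm_le.
Qed.

Lemma X_norm_low_high N (f : X) :
  norm f <= sum_n (fun i => INR i * Cmod (f i)) N + norm (cut N f).
Proof.
replace f with (plus (minus f (cut N f)) (cut N f)) at 1 by cut_ring N.
eapply Rle_trans; [apply X_triangle|apply Rplus_le_compat_r].
right; transitivity (sum_n (fun i => INR i * Cmod ((minus f (cut N f) : X) i)) N).
- apply is_series_unique, (is_series_finite R_AbsRing R_NormedModule).
  intros i Hi; X_coords; rewrite cut_high by exact Hi.
  unfold Cminus; rewrite Cplus_opp_r, Cmod_0; apply Rmult_0_r.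
- apply sum_n_m_ext_loc; intros i Hi; X_coords; rewrite cut_low by lia.
  do 2 f_equal; ring.
Qed.

(** A subsequence converges in every coordinate, its limit lying in X by Fatou. The first N
    coordinates converge in norm, being finitely many, and beyond N the sequence and, again by
    Fatou, the limit are uniformly small. *)
Lemma compact_of_small_tails (T : X -> X) : is_linear T ->
  (forall eps, 0 < eps -> exists N, forall f, norm (cut N (T f)) <= eps * norm f) ->
  compact_operator T.
Proof.
intros L Tail; split; [exact L|]; intros u [M HM].
destruct (linear_norm T L) as (b & Hb & Lb).
assert (M0 : 0 <= M) by (eapply Rle_trans; [apply (norm_ge_0 (u 0%nat))|apply HM]).
assert (B : forall k, norm (T (u k)) <= b * M).
{ intros k; eapply Rle_trans; [apply Lb|]; apply Rmult_le_compat_l; [lra|apply HM]. }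
destruct (complex_diagonal_subsequence (fun k i => T (u k) i) (b * M)) as (s & Hs & Hl).
{ intros k i; eapply Rle_trans; [apply X_coord_le|apply B]. }
destruct (choice _ Hl) as [y0 Hy0]; clear Hl.
destruct (X_fatou (fun k => T (u (s k))) y0 (b * M) Hy0) as (y & Hy & _).
{ exists 0%nat; intros k _; apply B. }
exists s, y; split; [exact Hs|].
apply (filterlim_locally_ball_norm (K := C_AbsRing) (U := X_NormedModule)); intros eps.
(* A quarter of eps each for the tail of the sequence, the tail of the limit and the first N
   coordinates. The 1 in 1 + M allows for M = 0. *)
destruct (Tail (eps / 4 / (1 + M))) as [N HN].
{ apply Rdiv_lt_0_compat; [|lra]; pose proof (cond_pos eps); lra. }
assert (Sm : forall k, norm (cut N (T (u k))) <= eps / 4).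
{ intros k; eapply Rle_trans; [apply HN|].
  apply Rle_trans with (eps / 4 / (1 + M) * (1 + M)); [|right; field; lra].
  apply Rmult_le_compat_l; [|specialize (HM k); lra].
  left; apply Rdiv_lt_0_compat; [|lra]; pose proof (cond_pos eps); lra. }
assert (Sy : norm (cut N y) <= eps / 4).
{ destruct (X_fatou (fun k => cut N (T (u (s k)))) (cut N y) (eps / 4)) as (c & Hc & Bc).
  - intros i; destruct (Nat.le_gt_cases i N) as [H|H].
    + rewrite cut_low by exact H.
      apply (filterlim_ext (fun _ => RtoC 0)); [|apply filterlim_const].
      intros k; now rewrite cut_low.
    + rewrite cut_high, Hy by exact H.
      apply filterlim_ext with (2 := Hy0 i); intros k; now rewrite cut_high.
  - exists 0%nat; intros k _; apply Sm.
  - replace (cut N y) with c; [exact Bc|]; apply X_ext; exact Hc. }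
assert (Low : is_lim_seq
  (fun k => sum_n (fun i => INR i * Cmod ((minus (T (u (s k))) y : X) i)) N) 0).
{ replace (Finite 0) with (Finite (sum_n (fun _ => 0) N)).
  2: { f_equal; apply (@sum_n_m_const_zero R_AbelianMonoid). }
  apply is_lim_seq_sum_n; intros i.
  replace (Finite 0) with (Finite (INR i * 0)) by (f_equal; ring).
  apply (is_lim_seq_scal_l _ (INR i) (Finite 0)).
  apply is_lim_seq_ext with (2 := filterlim_norm_minus _ _ C_NormedModule _ _ (Hy0 i)).
  intros k; X_coords; rewrite Hy; reflexivity. }
apply is_lim_seq_spec in Low.
assert (E4 : 0 < eps / 4) by (pose proof (cond_pos eps); lra).
destruct (Low (mkposreal _ E4)) as [K HK]; exists K; intros k Hk; specialize (HK k Hk).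
simpl pos in HK; rewrite Rminus_0_r in HK; apply Rabs_def2 in HK.
pose proof (X_norm_low_high N (minus (T (u (s k))) y)) as D.
assert (D2 : norm (cut N (minus (T (u (s k))) y)) <= norm (cut N (T (u (s k)))) + norm (cut N y)).
{ rewrite (linear_minus _ _ _ (cut_linear N)); apply X_triangle_minus. }
specialize (Sm (s k)).
change (norm (minus (T (u (s k))) y) < eps).
lra.
Qed.

(** * Triangular generators *)

Definition supported (J : nat) (f : X) : Prop := forall i, (J < i)%nat -> f i = 0%C.

Lemma supported_Xe J j : (j <= J)%nat -> supported J (Xe j).
Proof. intros H i Hi; apply unit_seq_neq; lia. Qed.

Lemma series_coord_zero (u : nat -> X) (s : X) i :
  is_series u s -> (forall k, u k i = 0%C) -> s i = 0%C.
Proof.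
intros H Z.
apply (filterlim_locally_unique (K := C_AbsRing) (V := C_NormedModule) (F := eventually)
  (fun n => (sum_n u n : X) i)).
- apply (filterlim_comp _ _ _ (sum_n u) (fun g : X => g i : C) _ (locally s) _ H).
  exact (linear_cont (K := C_AbsRing) (U := X_NormedModule) (V := C_NormedModule)
    (fun g : X => g i : C) s (X_coord_linear i)).
- apply filterlim_ext with (fun _ => zero : C); [|apply filterlim_const].
  intros n; rewrite X_coord_sum_n, (sum_n_ext _ (fun _ => zero)) by exact Z.
  unfold sum_n; symmetry; apply sum_n_m_const_zero.
Qed.

Lemma supported_expansion J f : supported J f -> f = sum_n (fun j => scal (f j) (Xe j)) J.
Proof.
intros H.
apply (filterlim_locally_unique (K := C_AbsRing) (V := X_NormedModule) (F := eventually)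
  (sum_n (fun j => scal (f j) (Xe j)))); [apply X_expansion|].
apply (is_series_finite C_AbsRing X_NormedModule).
intros k Hk; rewrite H by exact Hk; apply (@scal_zero_l C_Ring).
Qed.

Lemma linear_ext_supported (l l' : X -> X) J f :
  is_linear l -> is_linear l' ->
  (forall j, (1 <= j <= J)%nat -> l (Xe j) = l' (Xe j)) ->
  supported J f -> l f = l' f.
Proof.
intros Hl Hl' E S; rewrite (supported_expansion J f S).
rewrite (linear_sum_n _ _ l _ _ Hl), (linear_sum_n _ _ l' _ _ Hl').
apply sum_n_m_ext_loc; intros j Hj.
rewrite (linear_scal l Hl), (linear_scal l' Hl'); f_equal.
destruct j as [|j]; [|apply E; lia].
now rewrite (linear_Xe_O _ l Hl), (linear_Xe_O _ l' Hl').
Qed.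

Lemma sum_n_term_le (u : nat -> R) j J :
  (forall k, 0 <= u k) -> (j <= J)%nat -> u j <= sum_n u J.
Proof.
intros P; induction J as [|J IH]; intros H.
- replace j with 0%nat by lia; rewrite sum_O; lra.
- rewrite sum_Sn; change (u j <= sum_n u J + u (S J)).
  destruct (Nat.eq_dec j (S J)) as [->|N].
  + assert (0 <= sum_n u J); [|lra].
    rewrite sum_n_Reals; now apply cond_pos_sum.
  + specialize (IH ltac:(lia)); pose proof (P (S J)).
    change (u j <= sum_n u J) in IH; lra.
Qed.

(** With x = |h| t, the cone gives |1 - h t|^2 <= 1 - 2 q x + x^2, and x <= 2 c turns x^2 into 2 c
    x. As q >= kappa + 2 c, this is at most 1 - 2 (kappa + c) x <= (1 - (kappa + c) x)^2. The
    off-diagonal part consumes kappa x, and a gain of c x is left. *)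
Lemma diagonal_step_le (kappa c q t : R) (h : C) :
  0 <= kappa -> 0 < c -> kappa + 2 * c <= q -> q <= 1 -> 0 <= t ->
  cone q h -> Cmod h * t <= 2 * c ->
  Cmod (1 - h * RtoC t)%C + Cmod h * (kappa * t) <= 1 - c * Cmod h * t.
Proof.
intros Hk Hc Hq Hq1 Ht Hh Hs; unfold cone in Hh.
pose proof (Cmod_ge_0 h) as H0.
set (x := Cmod h * t) in *.
assert (X0 : 0 <= x) by now apply Rmult_le_pos.
assert (S : 0 <= 1 - (kappa + c) * x) by nra.
assert (Q : Cmod (1 - h * RtoC t)%C <= 1 - (kappa + c) * x).
{
  apply Rsqr_incr_0; [|apply Cmod_ge_0|exact S].
  rewrite !Rsqr_pow2, Cmod2_alt.
  pose proof (Cmod2_alt h) as M.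
  replace (Re (1 - h * RtoC t)%C) with (1 - t * Re h) by (unfold Re; simpl; ring).
  replace (Im (1 - h * RtoC t)%C) with (- (t * Im h)) by (unfold Im; simpl; ring).
  assert (R1 : t * Re h >= q * x) by (unfold x; nra).
  replace ((1 - t * Re h) ^ 2 + (- (t * Im h)) ^ 2)
    with (1 - 2 * (t * Re h) + t ^ 2 * (Re h ^ 2 + Im h ^ 2)) by ring.
  rewrite <- M; replace (t ^ 2 * Cmod h ^ 2) with (x ^ 2) by (unfold x; ring).
  assert (x * x <= 2 * c * x) by now apply Rmult_le_compat_r.
  assert ((kappa + 2 * c) * x <= q * x) by now apply Rmult_le_compat_r.
  pose proof (pow2_ge_0 ((kappa + c) * x)); lra. }
replace (c * Cmod h * t) with (c * x) by (unfold x; ring).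
replace (Cmod h * (kappa * t)) with (kappa * x) by (unfold x; ring).
lra.
Qed.

Section Triangular.

Context (g : nat -> X) (t : nat -> R) (kappa : R).
Context (kappa_bounds : 0 <= kappa < 1).
Context (t_pos : forall j, (1 <= j)%nat -> 0 < t j).
Context (g_upper : forall j i, (j < i)%nat -> g j i = 0%C).
Context (g_off : forall j, (1 <= j)%nat ->
  norm (plus (g j) (scal (RtoC (t j)) (Xe j))) <= kappa * t j * INR j).

(** * Bounded truncations of the generator *)

Definition trunc_col (J j : nat) : X :=
  if ((1 <=? j) && (j <=? J))%nat%bool then g j else zero.

Lemma trunc_col_in J j : (1 <= j <= J)%nat -> trunc_col J j = g j.
Proof.
intros [H1 H2]; unfold trunc_col.
apply Nat.leb_le in H1; apply Nat.leb_le in H2; now rewrite H1, H2.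
Qed.

Lemma trunc_col_out J j : ~ (1 <= j <= J)%nat -> trunc_col J j = zero.
Proof.
intros H; unfold trunc_col.
destruct (Nat.leb_spec 1 j); destruct (Nat.leb_spec j J); simpl; try reflexivity; lia.
Qed.

(** Crude and growing with J: it only serves local errors and estimates of a fixed finitely
    supported vector. *)
Definition trunc_bound (J : nat) : R := sum_n (fun j => norm (g j)) J.

Lemma trunc_bound_ge_0 J : 0 <= trunc_bound J.
Proof.
unfold trunc_bound; rewrite sum_n_Reals; apply cond_pos_sum; intros; apply norm_ge_0.
Qed.

Lemma trunc_col_bound J : col_bound (trunc_col J) (trunc_bound J).
Proof.
intros j; pose proof (trunc_bound_ge_0 J) as B0.
destruct (excluded_middle_informative (1 <= j <= J)%nat) as [H|H].
- rewrite trunc_col_in by exact H.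
  apply Rle_trans with (trunc_bound J * 1).
  + rewrite Rmult_1_r; apply (sum_n_term_le (fun j => norm (g j))); [|lia].
    intros; apply norm_ge_0.
  + apply Rmult_le_compat_l; [exact B0|]; apply (le_INR 1); lia.
- rewrite trunc_col_out by exact H.
  change (X_norm X_zero <= trunc_bound J * INR j); rewrite X_norm_zero.
  apply Rmult_le_pos; [exact B0|apply pos_INR].
Qed.

Definition trunc_gen (J : nat) : X -> X := col_op (trunc_col J).

Lemma trunc_gen_linear J : is_linear (trunc_gen J).
Proof. exact (col_op_linear _ _ (trunc_col_bound J)). Qed.

Lemma trunc_gen_le J f : norm (trunc_gen J f) <= trunc_bound J * norm f.
Proof. apply col_op_norm_le, trunc_col_bound. Qed.

Lemma trunc_gen_Xe J j : (1 <= j <= J)%nat -> trunc_gen J (Xe j) = g j.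
Proof.
intros H; unfold trunc_gen; rewrite (col_op_Xe _ _ _ (trunc_col_bound J)).
now apply trunc_col_in.
Qed.

Lemma trunc_gen_Xe_out J j : (J < j)%nat -> trunc_gen J (Xe j) = zero.
Proof.
intros H; unfold trunc_gen; rewrite (col_op_Xe _ _ _ (trunc_col_bound J)).
apply trunc_col_out; lia.
Qed.

Lemma trunc_gen_supported J f : supported J (trunc_gen J f).
Proof.
intros i Hi; apply (series_coord_zero _ _ i (col_op_series _ _ f (trunc_col_bound J))).
intros k; X_coords.
destruct (excluded_middle_informative (1 <= k <= J)%nat) as [H|H].
- rewrite trunc_col_in, g_upper by lia; ring.
- rewrite trunc_col_out by exact H; X_coords; ring.
Qed.

Lemma trunc_gen_consistent l J f :
  (l <= J)%nat -> supported l f -> trunc_gen J f = trunc_gen l f.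
Proof.
intros H; apply linear_ext_supported; [apply trunc_gen_linear|apply trunc_gen_linear|].
intros j Hj; rewrite !trunc_gen_Xe by lia; reflexivity.
Qed.

Definition trunc_exp (J : nat) (z : C) : X -> X := exp_op (trunc_gen J) z.

Lemma trunc_exp_linear J z : is_linear (trunc_exp J z).
Proof.
exact (exp_op_linear _ _ (trunc_gen_linear J) (trunc_bound_ge_0 J) (trunc_gen_le J) z).
Qed.

Lemma trunc_exp_supported J z f : supported J f -> supported J (trunc_exp J z f).
Proof.
intros S i Hi.
apply (series_coord_zero _ _ i (exp_op_series _ _ (trunc_bound_ge_0 J) (trunc_gen_le J) z f)).
intros k; unfold exp_term; X_coords.
assert (Z : Nat.iter k (trunc_gen J) f i = 0%C).
{ destruct k as [|k]; [now apply S|]; simpl; now apply trunc_gen_supported. }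
rewrite Z; ring.
Qed.

(** By upper triangularity the span of the first l unit vectors is invariant and both truncations
    act alike on it, hence so do their powers. The exponentials of different truncations thus fit
    together. *)
Lemma trunc_exp_consistent l J z f :
  (l <= J)%nat -> supported l f -> trunc_exp J z f = trunc_exp l z f.
Proof.
intros H S; apply exp_op_unique.
eapply is_series_ext;
  [|exact (exp_op_series _ _ (trunc_bound_ge_0 l) (trunc_gen_le l) z f)].
intros k; unfold exp_term; f_equal.
assert (I : Nat.iter k (trunc_gen l) f = Nat.iter k (trunc_gen J) f
  /\ supported l (Nat.iter k (trunc_gen l) f)); [|apply I].
induction k as [|k [IH1 IH2]]; [now split|]; simpl.
rewrite <- IH1, (trunc_gen_consistent l J) by assumption.
split; [reflexivity|apply trunc_gen_supported].
Qed.

(** The distance from kappa to 1 is divided into four parts. [q1] lies two above kappa, as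
    [diagonal_step_le] requires with c = gap. [q2], used later, lies three above, which leaves room
    inside the cone of [q1] and keeps it below 1, so that its sector has positive opening. In [c1]
    the factor 1 + kappa converts the weighted norm into the norm of the generator. *)
Let gap : R := (1 - kappa) / 4.
Let q1 : R := kappa + 2 * gap.
Let c1 : R := gap / (1 + kappa).

Lemma gap_pos : 0 < gap. Proof. unfold gap; lra. Qed.

Lemma c1_pos : 0 < c1.
Proof. apply Rdiv_lt_0_compat; [apply gap_pos|lra]. Qed.

Lemma q1_bounds : 0 <= q1 <= 1.
Proof. unfold q1, gap; lra. Qed.

(** * Weighted norm and dissipativity of the truncations *)

Definition trunc_weight (J j : nat) : R :=
  if ((1 <=? j) && (j <=? J))%nat%bool then t j * INR j else 0.

Lemma trunc_weight_in J j : (1 <= j <= J)%nat -> trunc_weight J j = t j * INR j.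
Proof.
intros [H1 H2]; unfold trunc_weight.
apply Nat.leb_le in H1; apply Nat.leb_le in H2; now rewrite H1, H2.
Qed.

Lemma trunc_weight_out J j : ~ (1 <= j <= J)%nat -> trunc_weight J j = 0.
Proof.
intros H; unfold trunc_weight.
destruct (Nat.leb_spec 1 j); destruct (Nat.leb_spec j J); simpl; try reflexivity; lia.
Qed.

(** The norm of the sequence t f over the first J coordinates. Up to constants depending on kappa
    alone it is equivalent to [norm (trunc_gen J f)]. *)
Definition weighted_norm (J : nat) (f : X) : R :=
  Series (fun j => Cmod (f j) * trunc_weight J j).

Lemma ex_series_weighted J (f : X) : ex_series (fun j => Cmod (f j) * trunc_weight J j).
Proof.
eexists; apply (is_series_finite R_AbsRing R_NormedModule) with (J := J).
intros k Hk; rewrite trunc_weight_out by lia; apply Rmult_0_r.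
Qed.

Lemma g_norm_le j : (1 <= j)%nat -> norm (g j) <= (1 + kappa) * (t j * INR j).
Proof.
intros Hj.
replace (g j) with (minus (plus (g j) (scal (RtoC (t j)) (Xe j))) (scal (RtoC (t j)) (Xe j)))
  by X_ring.
eapply Rle_trans; [apply X_triangle_minus|].
rewrite X_norm_scal_eq, Xe_norm, Cmod_R, Rabs_pos_eq by (left; now apply t_pos).
pose proof (g_off j Hj); lra.
Qed.

Lemma trunc_gen_norm_le J f : norm (trunc_gen J f) <= (1 + kappa) * weighted_norm J f.
Proof.
unfold weighted_norm; rewrite <- Series_scal_l.
eapply Rle_trans.
- apply (linear_norm_col X_NormedModule (trunc_gen J)
    (fun j => (1 + kappa) * trunc_weight J j)); [apply trunc_gen_linear| |].
  + intros j Hj; destruct (Nat.le_gt_cases j J) as [H|H].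
    * rewrite trunc_gen_Xe, trunc_weight_in by lia; now apply g_norm_le.
    * rewrite trunc_gen_Xe_out, trunc_weight_out by lia.
      change (X_norm X_zero <= (1 + kappa) * 0); rewrite X_norm_zero; lra.
  + eapply ex_series_ext; [|apply (ex_series_Rscal (1 + kappa)), (ex_series_weighted J f)].
    intros j; cbv beta; Rring.
- right; apply Series_ext; intros j; ring.
Qed.

(** Ensures |h| t_j <= 2 gap for 1 <= j <= J, the sum being an upper bound of the maximum. [t 0] may
    have any sign, hence the absolute values. *)
Definition trunc_eta (J : nat) : R := 2 * gap / (1 + sum_n (fun j => Rabs (t j)) J).

Lemma sum_abs_ge_0 J : 0 <= sum_n (fun j => Rabs (t j)) J.
Proof. rewrite sum_n_Reals; apply cond_pos_sum; intros; apply Rabs_pos. Qed.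

Lemma trunc_eta_pos J : 0 < trunc_eta J.
Proof.
pose proof (sum_abs_ge_0 J); pose proof gap_pos.
apply Rdiv_lt_0_compat; lra.
Qed.

(** The right-hand side is itself a sum over columns, so it suffices to bound the image of each e_j
    by the weight [INR j - gap * Cmod h * trunc_weight J j]. For j <= J the image is (1 - h t_j) e_j
    plus h times the off-diagonal column, and [diagonal_step_le] applies; beyond J the vector is
    fixed. *)
Lemma trunc_dissipative_weighted J h f : cone q1 h -> Cmod h <= trunc_eta J ->
  norm (plus f (scal h (trunc_gen J f))) <= norm f - gap * Cmod h * weighted_norm J f.
Proof.
intros Hh He.
pose proof (Cmod_ge_0 h) as H0; pose proof gap_pos as G0.
assert (Lin : is_linear (fun f => plus f (scal h (trunc_gen J f)) : X)).
{ apply (is_linear_ext (fun f => minus f (scal (- h)%C (trunc_gen J f)))).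
  - intros x; X_ring.
  - apply (is_linear_minus_fun X_NormedModule X_NormedModule); [apply is_linear_id|].
    apply (is_linear_scal_fun X_NormedModule X_NormedModule), trunc_gen_linear. }
assert (E1 : ex_series (fun j => gap * Cmod h * (Cmod (f j) * trunc_weight J j)))
  by apply ex_series_Rscal, ex_series_weighted.
assert (EQ : forall j, INR j * Cmod (f j) - gap * Cmod h * (Cmod (f j) * trunc_weight J j)
  = Cmod (f j) * (INR j - gap * Cmod h * trunc_weight J j)) by (intros; ring).
change (norm f) with (Series (fun j => INR j * Cmod (f j))).
unfold weighted_norm; rewrite <- Series_scal_l, <- Series_minus;
  [|apply XseqP|exact E1].
rewrite (Series_ext _ _ EQ).
apply (linear_norm_col X_NormedModule (fun f => plus f (scal h (trunc_gen J f)) : X)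
  (fun j => INR j - gap * Cmod h * trunc_weight J j)); [exact Lin| |].
- intros j Hj; destruct (Nat.le_gt_cases j J) as [H|H].
  + rewrite trunc_gen_Xe, trunc_weight_in by lia.
    pose proof (t_pos j Hj) as T0.
    replace (plus (Xe j) (scal h (g j))) with
      (plus (scal (1 - h * RtoC (t j))%C (Xe j))
         (scal h (plus (g j) (scal (RtoC (t j)) (Xe j))))) by X_ring.
    eapply Rle_trans; [apply X_triangle|].
    rewrite !X_norm_scal_eq, Xe_norm.
    assert (St : Cmod h * t j <= 2 * gap).
    { unfold trunc_eta in He; pose proof (sum_abs_ge_0 J) as A0.
      assert (Aj : t j <= sum_n (fun j => Rabs (t j)) J).
      { eapply Rle_trans; [apply Rle_abs|].
        apply (sum_n_term_le (fun j => Rabs (t j))); [intros; apply Rabs_pos|exact H]. }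
      set (A := sum_n (fun j => Rabs (t j)) J) in *.
      apply Rle_trans with (2 * gap / (1 + A) * (1 + A)); [|right; field; lra].
      apply Rmult_le_compat; lra. }
    pose proof (diagonal_step_le kappa gap q1 (t j) h (proj1 kappa_bounds) G0
      (Rle_refl _) (proj2 q1_bounds) (Rlt_le _ _ T0) Hh St) as D.
    pose proof (pos_INR j) as J0.
    pose proof (Rmult_le_compat_l _ _ _ H0 (g_off j Hj)) as O.
    pose proof (Rmult_le_compat_r _ _ _ J0 D) as D'; lra.
  + rewrite trunc_gen_Xe_out, trunc_weight_out by lia.
    replace (plus (Xe j) (scal h (zero : X))) with (Xe j) by X_ring.
    rewrite Xe_norm; lra.
- apply (ex_series_ext _ _ EQ).
  exact (ex_series_minus _ _ (proj2 (XseqP f)) E1).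
Qed.

Lemma trunc_dissipative J h f : cone q1 h -> Cmod h <= trunc_eta J ->
  norm (plus f (scal h (trunc_gen J f))) <= norm f - c1 * Cmod h * norm (trunc_gen J f).
Proof.
intros Hh He.
eapply Rle_trans; [now apply trunc_dissipative_weighted|].
pose proof (trunc_gen_norm_le J f) as N; pose proof (Cmod_ge_0 h) as H0; pose proof gap_pos.
assert (c1 * norm (trunc_gen J f) <= gap * weighted_norm J f).
{ unfold c1; apply Rle_trans with (gap / (1 + kappa) * ((1 + kappa) * weighted_norm J f)).
  - apply Rmult_le_compat_l; [|exact N]; left; apply c1_pos.
  - right; field; lra. }
nra.
Qed.

(* [exp (z G) e_j], computed with [G] truncated at [j] since its column [j] is
   supported on [1..j]; it is defined for all [z], but [sg z] is only meaningful on
   the cone where these columns are bounded by [j]. *)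
Definition sg_col (z : C) (j : nat) : X := trunc_exp j z (Xe j).

Definition sg (z : C) : X -> X := col_op (sg_col z).

Lemma trunc_exp_Xe J z j : (j <= J)%nat -> trunc_exp J z (Xe j) = sg_col z j.
Proof. intros H; exact (trunc_exp_consistent j J z _ H (supported_Xe j j (Nat.le_refl j))). Qed.

Lemma trunc_exp_contraction J z f : cone q1 z -> norm (trunc_exp J z f) <= norm f.
Proof.
apply (exp_op_contraction _ _ (trunc_gen_linear J) (trunc_bound_ge_0 J) (trunc_gen_le J)
  q1 c1 (trunc_eta J) c1_pos (trunc_eta_pos J) (trunc_dissipative J)).
Qed.

Lemma trunc_exp_smoothing J z f : cone q1 z ->
  c1 * Cmod z * norm (trunc_gen J (trunc_exp J z f)) <= norm f.
Proof.
apply (exp_op_smoothing _ _ (trunc_gen_linear J) (trunc_bound_ge_0 J) (trunc_gen_le J)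
  q1 c1 (trunc_eta J) c1_pos (trunc_eta_pos J) (trunc_dissipative J)).
Qed.

Lemma sg_col_bound z : cone q1 z -> col_bound (sg_col z) 1.
Proof.
intros Hz j; rewrite Rmult_1_l, <- (Xe_norm j); exact (trunc_exp_contraction j z (Xe j) Hz).
Qed.

Lemma sg_linear z : cone q1 z -> is_linear (sg z).
Proof. intros Hz; exact (col_op_linear _ _ (sg_col_bound z Hz)). Qed.

Lemma sg_norm_le z f : cone q1 z -> norm (sg z f) <= norm f.
Proof.
intros Hz; rewrite <- (Rmult_1_l (norm f)).
exact (col_op_norm_le _ _ f (sg_col_bound z Hz)).
Qed.

Lemma sg_Xe z j : cone q1 z -> sg z (Xe j) = sg_col z j.
Proof. intros Hz; exact (col_op_Xe _ _ j (sg_col_bound z Hz)). Qed.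

Lemma sg_supported J z f : cone q1 z -> supported J f -> sg z f = trunc_exp J z f.
Proof.
intros Hz; apply linear_ext_supported; [now apply sg_linear|apply trunc_exp_linear|].
intros j Hj; rewrite sg_Xe by exact Hz; symmetry; apply (trunc_exp_Xe J z j); lia.
Qed.

Lemma cone_plus q z w : 0 <= q -> cone q z -> cone q w -> cone q (z + w)%C.
Proof.
unfold cone; intros Hq Hz Hw; change (Re (z + w)%C) with (Re z + Re w).
pose proof (Rmult_le_compat_l q _ _ Hq (Cmod_triangle z w)); lra.
Qed.

(** On e_j both sides are given by exponentials of the truncation at j, because [sg w] keeps e_j in
    the span of the first j unit vectors. *)
Lemma sg_plus z w f : cone q1 z -> cone q1 w -> sg (z + w)%C f = sg z (sg w f).
Proof.
intros Hz Hw.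
assert (Hzw : cone q1 (z + w)%C) by (apply cone_plus; [apply q1_bounds|exact Hz|exact Hw]).
apply (linear_ext X_NormedModule (sg (z + w)%C) (fun f => sg z (sg w f))).
- now apply sg_linear.
- exact (is_linear_comp _ _ (sg_linear w Hw) (sg_linear z Hz)).
- intros j Hj; rewrite !sg_Xe by assumption.
  rewrite (sg_supported j z (sg_col w j) Hz)
    by (apply trunc_exp_supported, supported_Xe; lia).
  apply (exp_op_plus _ _ (trunc_gen_linear j) (trunc_bound_ge_0 j) (trunc_gen_le j)).
Qed.

Lemma cone_real q s : q <= 1 -> 0 <= s -> cone q (RtoC s).
Proof.
intros Hq Hs; unfold cone; rewrite Cmod_R, Rabs_pos_eq by exact Hs.
change (Re (RtoC s)) with s; nra.
Qed.

Lemma sg_zero f : sg (RtoC 0) f = f.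
Proof.
assert (H0 : cone q1 (RtoC 0)) by (apply cone_real; [apply q1_bounds|lra]).
apply (linear_ext X_NormedModule (sg (RtoC 0)) (fun f => f)).
- now apply sg_linear.
- apply is_linear_id.
- intros j Hj; rewrite sg_Xe by exact H0; exact (exp_op_zero (trunc_gen j) (Xe j)).
Qed.

(** * Holomorphy on the smaller cone *)

Let q2 : R := kappa + 3 * gap.

Lemma q2_bounds : 0 <= q2 < 1.
Proof. unfold q2, gap; lra. Qed.

Lemma cone_q2_q1 z : cone q2 z -> cone q1 z.
Proof.
unfold cone; pose proof (Cmod_ge_0 z); pose proof gap_pos; unfold q1, q2; nra.
Qed.

Lemma cone_q2_near z h : cone q2 z -> Cmod h <= gap / 2 * Cmod z -> cone q1 (z + h)%C.
Proof.
apply cone_near; [apply q1_bounds|].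
unfold q1, q2; unfold gap; nra.
Qed.

(** The operator G exp (z G) by its columns; smoothing bounds column j by j / (c1 |z|), so it is
    bounded for z <> 0 in the cone although G need not be. *)
Definition sg_derivative (z : C) : X -> X :=
  col_op (fun j => trunc_gen j (sg_col z j)).

Lemma sg_derivative_bound z : cone q1 z -> 0 < Cmod z ->
  col_bound (fun j => trunc_gen j (sg_col z j)) (/ (c1 * Cmod z)).
Proof.
intros Hz Pz j; pose proof c1_pos as C0.
pose proof (trunc_exp_smoothing j z (Xe j) Hz) as S; fold (sg_col z j) in S.
rewrite Xe_norm in S.
assert (P : 0 < c1 * Cmod z) by now apply Rmult_lt_0_compat.
apply (Rmult_le_reg_l (c1 * Cmod z)); [exact P|].
rewrite <- Rmult_assoc, Rinv_r, Rmult_1_l by lra; exact S.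
Qed.

Lemma sg_expansion z h f : cone q2 z -> 0 < Cmod z -> Cmod h <= gap / 2 * Cmod z ->
  norm (minus (minus (sg (z + h)%C f) (sg z f)) (scal h (sg_derivative z f)))
  <= Cmod h ^ 2 * (2 / (c1 * (Cmod z / 2))) ^ 2 * norm f.
Proof.
intros Hz Pz Hh.
assert (Hz1 := cone_q2_q1 z Hz); assert (Hzh := cone_q2_near z h Hz Hh).
pose proof (sg_derivative_bound z Hz1 Pz) as DB.
apply (linear_norm_le X_NormedModule
  (fun f => minus (minus (sg (z + h)%C f) (sg z f)) (scal h (sg_derivative z f)))).
- apply (is_linear_minus_fun X_NormedModule X_NormedModule).
  + apply (is_linear_minus_fun X_NormedModule X_NormedModule); now apply sg_linear.
  + apply (is_linear_scal_fun X_NormedModule X_NormedModule).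
    exact (col_op_linear _ _ DB).
- intros j Hj; rewrite !sg_Xe by assumption.
  unfold sg_derivative; rewrite (col_op_Xe _ _ j DB).
  rewrite Rmult_assoc, <- (Xe_norm j).
  apply (exp_op_expansion _ _ (trunc_gen_linear j) (trunc_bound_ge_0 j) (trunc_gen_le j)
    q1 c1 (trunc_eta j) c1_pos (trunc_eta_pos j) (trunc_dissipative j)); [lra|].
  intros s Hs.
  assert (Hsh : Cmod (RtoC s * h)%C <= gap / 2 * Cmod z).
  { rewrite Cmod_scal_pos by lra; pose proof (Cmod_ge_0 h); nra. }
  split; [now apply cone_q2_near|].
  (* |z + s h| >= |z| - |s h| >= |z| / 2 because gap <= 1; this is the lower bound r required by the
     expansion. *)
  pose proof (Cmod_triangle (z + RtoC s * h)%C (- (RtoC s * h))%C) as Tr.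
  replace (z + RtoC s * h + - (RtoC s * h))%C with z in Tr by ring.
  rewrite Cmod_opp in Tr.
  assert (gap <= 1) by (unfold gap; lra); nra.
Qed.

Lemma sg_differentiable z : cone q2 z -> 0 < Cmod z -> op_differentiable sg z.
Proof.
intros Hz Pz; exists (sg_derivative z).
pose proof (sg_derivative_bound z (cone_q2_q1 z Hz) Pz) as DB.
split; [exact (col_op_linear _ _ DB)|].
intros eps He.
set (A := (2 / (c1 * (Cmod z / 2))) ^ 2).
assert (A0 : 0 <= A) by apply pow2_ge_0.
exists (Rmin (gap / 2 * Cmod z) (eps / (1 + A))); split.
- apply Rmin_glb_lt; [pose proof gap_pos; nra|apply Rdiv_lt_0_compat; lra].
- intros h Hh x.
  eapply Rle_trans; [apply sg_expansion; [exact Hz|exact Pz|]|].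
  + left; eapply Rlt_le_trans; [exact Hh|apply Rmin_l].
  + fold A; apply Rmult_le_compat_r; [apply norm_ge_0|].
    assert (Hh2 : Cmod h <= eps / (1 + A)).
    { left; eapply Rlt_le_trans; [exact Hh|apply Rmin_r]. }
    pose proof (Cmod_ge_0 h) as H0.
    assert (Cmod h * (1 + A) <= eps).
    { apply Rle_trans with (eps / (1 + A) * (1 + A)); [|right; field; lra].
      apply Rmult_le_compat_r; lra. }
    nra.
Qed.

Lemma sg_continuous_supported J z f : cone q1 z -> supported J f -> Cmod z <= 1 ->
  norm (minus (sg z f) f) <= Cmod z * ((exp (trunc_bound J) + trunc_bound J) * norm f).
Proof.
intros Hz S H1; rewrite (sg_supported J z f Hz S); unfold trunc_exp.
pose proof (exp_op_first_order _ _ (trunc_bound_ge_0 J) (trunc_gen_le J) z f H1) as E.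
replace (minus (exp_op (trunc_gen J) z f) f) with
  (plus (minus (minus (exp_op (trunc_gen J) z f) f) (scal z (trunc_gen J f)))
        (scal z (trunc_gen J f))) by X_ring.
eapply Rle_trans; [apply X_triangle|]; rewrite X_norm_scal_eq.
pose proof (Cmod_ge_0 z) as Z0; pose proof (norm_ge_0 f) as F0.
pose proof (Rmult_le_compat_l _ _ _ Z0 (trunc_gen_le J f)) as G.
pose proof (exp_pos (trunc_bound J)) as P.
assert (exp (trunc_bound J) * Cmod z ^ 2 * norm f <= Cmod z * (exp (trunc_bound J) * norm f)).
{ replace (exp (trunc_bound J) * Cmod z ^ 2 * norm f)
    with (Cmod z * (Cmod z * (exp (trunc_bound J) * norm f))) by ring.
  apply Rmult_le_compat_l; [exact Z0|].
  assert (0 <= exp (trunc_bound J) * norm f) by nra; nra. }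
lra.
Qed.

Lemma X_truncation (f : X) eps : 0 < eps ->
  exists J f', supported J f' /\ norm (minus f' f) < eps.
Proof.
intros He.
destruct (proj1 (filterlim_locally_ball_norm (K := C_AbsRing) (U := X_NormedModule) _ _)
  (X_expansion f) (mkposreal eps He)) as [N HN].
exists N, (sum_n (fun j => scal (f j) (Xe j)) N); split; [|exact (HN N (Nat.le_refl _))].
intros i Hi; rewrite X_coord_sum_n.
unfold sum_n; rewrite (sum_n_m_ext_loc _ (fun _ => zero : C)).
- apply (@sum_n_m_const_zero C_AbelianMonoid).
- intros k Hk; X_coords; change (Xe k i) with (unit_seq k i).
  rewrite unit_seq_neq by lia; apply Cmult_0_r.
Qed.

Lemma sg_continuous f eps : 0 < eps ->
  exists eta, 0 < eta /\ forall z, cone q1 z -> Cmod z < eta -> norm (minus (sg z f) f) < eps.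
Proof.
intros He; destruct (X_truncation f (eps / 3)) as (J & f' & S & D); [lra|].
set (A := (exp (trunc_bound J) + trunc_bound J) * norm f').
assert (A0 : 0 <= A).
{ apply Rmult_le_pos; [|apply norm_ge_0].
  pose proof (exp_pos (trunc_bound J)); pose proof (trunc_bound_ge_0 J); lra. }
exists (Rmin 1 (eps / 3 / (1 + A))); split.
{ apply Rmin_glb_lt; [lra|apply Rdiv_lt_0_compat; lra]. }
intros z Hz Hs.
assert (Z1 : Cmod z <= 1) by (left; eapply Rlt_le_trans; [exact Hs|apply Rmin_l]).
assert (Z2 : Cmod z <= eps / 3 / (1 + A))
  by (left; eapply Rlt_le_trans; [exact Hs|apply Rmin_r]).
pose proof (sg_continuous_supported J z f' Hz S Z1) as B; fold A in B.
(* A third of eps goes to the motion of the finitely supported f'; the error f' - f enters twice,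
   [sg z] being a contraction, and takes the rest. *)
replace (minus (sg z f) f) with
  (plus (minus (sg z f') f') (minus (minus f' f) (sg z (minus f' f)))).
2: { rewrite (linear_minus _ _ _ (sg_linear z Hz)); X_ring. }
eapply Rle_lt_trans; [apply X_triangle|].
assert (N : norm (minus (minus f' f) (sg z (minus f' f))) <= 2 * norm (minus f' f)).
{ eapply Rle_trans; [apply X_triangle_minus|].
  pose proof (sg_norm_le z (minus f' f) Hz); lra. }
assert (Cmod z * (1 + A) <= eps / 3).
{ apply Rle_trans with (eps / 3 / (1 + A) * (1 + A)); [|right; field; lra].
  apply Rmult_le_compat_r; lra. }
pose proof (Cmod_ge_0 z); nra.
Qed.

(** Cosine decreases on [0, pi], so |phi| < acos q gives q <= cos phi. *)
Lemma sector_cone q z : 0 <= q < 1 -> sector (acos q) z -> cone q z /\ 0 < Cmod z.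
Proof.
intros Hq (rho & phi & Hr & Hp & ->).
assert (M : Cmod (rho * cos phi, rho * sin phi) = rho).
{ unfold Cmod; simpl fst; simpl snd.
  replace ((rho * cos phi) ^ 2 + (rho * sin phi) ^ 2)
    with (rho ^ 2 * (Rsqr (sin phi) + Rsqr (cos phi))) by (unfold Rsqr; ring).
  rewrite sin2_cos2, Rmult_1_r; apply sqrt_pow2; lra. }
unfold cone; rewrite M; split; [|exact Hr].
change (Re (rho * cos phi, rho * sin phi)) with (rho * cos phi).
assert (q <= cos phi); [|nra].
rewrite <- (cos_acos q) by lra.
pose proof (acos_bound q) as AB.
replace (cos phi) with (cos (Rabs phi))
  by (unfold Rabs; destruct Rcase_abs; [apply cos_neg|reflexivity]).
left; apply cos_decreasing_1; pose proof (Rabs_pos phi); lra.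
Qed.

Lemma acos_open_range q : 0 <= q < 1 -> 0 < acos q <= PI / 2.
Proof.
intros Hq; pose proof (acos_bound q) as AB; split.
- destruct (proj1 AB) as [H|H]; [exact H|].
  exfalso; pose proof (cos_acos q ltac:(lra)) as E; rewrite <- H, cos_0 in E; lra.
- apply Rnot_lt_le; intros H.
  pose proof (cos_acos q ltac:(lra)) as E.
  assert (cos (acos q) < 0); [|lra].
  pose proof PI_RGT_0; apply cos_lt_0; lra.
Qed.

Lemma locally_C_Cmod (eta : R) : 0 < eta ->
  locally (T := C_UniformSpace) (RtoC 0) (fun z => Cmod z < eta).
Proof.
intros He; apply (locally_le_locally_norm (K := C_AbsRing) (V := C_NormedModule)).
exists (mkposreal eta He); intros y Hy.
replace (y : C) with (minus y (RtoC 0) : C); [exact Hy|].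
unfold minus; simpl; unfold plus, opp; simpl; ring.
Qed.

Lemma sg_analytic (S : R -> X -> X) :
  (forall s f, 0 <= s -> sg (RtoC s) f = S s f) -> analytic_semigroup S.
Proof.
intros ES; exists (acos q2); split; [apply acos_open_range, q2_bounds|].
assert (SC : forall z, sector (acos q2) z -> cone q1 z).
{ intros z Hz; apply cone_q2_q1, sector_cone; [apply q2_bounds|exact Hz]. }
exists sg; split; [|split; [|split; [|split]]].
- intros s f Hs; now apply ES.
- intros z Hz; apply sg_linear; auto.
- intros z w f Hz Hw; apply sg_plus; auto.
- intros z Hz; destruct (sector_cone q2 z q2_bounds Hz); now apply sg_differentiable.
- intros delta' f Hd.
  apply (filterlim_locally_ball_norm (K := C_AbsRing) (U := X_NormedModule)); intros eps.
  destruct (sg_continuous f eps (cond_pos eps)) as (eta & Heta & H).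
  generalize (locally_C_Cmod eta Heta); unfold within; apply filter_imp.
  intros z Hz (rho & phi & Hr & Hp & Ez); apply H; [|exact Hz].
  apply SC; exists rho, phi; repeat split; [exact Hr|lra|exact Ez].
Qed.

(** * Agreement with the given semigroup *)

Section Generated.

Context (U : R -> X -> X) (U_C0 : C0_semigroup U).
Context (U_gen : forall j, (1 <= j)%nat -> generator U (Xe j) (g j)).

(** Both orbits of e_j have derivative [g j] at 0: that of [U] by the definition of the generator,
    the other by the first-order estimate for the truncation at j. *)
Lemma sg_col_agrees_first_order j eps : (1 <= j)%nat -> 0 < eps ->
  exists delta, 0 < delta /\ forall h, 0 < h < delta ->
    norm (minus (sg_col (RtoC h) j) (U h (Xe j))) <= eps * h.
Proof.
intros Hj He.
assert (He2 : 0 < eps / 2) by lra.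
destruct (at_right_0_ball _ (proj1 (filterlim_locally_ball_norm _ _) (U_gen j Hj)
  (mkposreal _ He2))) as (d1 & Hd1 & H1).
set (K := exp (trunc_bound j) * INR j).
assert (K0 : 0 <= K) by (apply Rmult_le_pos; [left; apply exp_pos|apply pos_INR]).
exists (Rmin d1 (Rmin 1 (eps / 2 / (1 + K)))); split.
{ repeat apply Rmin_glb_lt; [exact Hd1|lra|apply Rdiv_lt_0_compat; lra]. }
intros h [Hh0 Hh].
assert (Hhd : h < d1) by (eapply Rlt_le_trans; [exact Hh|apply Rmin_l]).
assert (Hh1 : h <= 1).
{ left; eapply Rlt_le_trans; [exact Hh|]; eapply Rle_trans; [apply Rmin_r|apply Rmin_l]. }
assert (HhK : h <= eps / 2 / (1 + K)).
{ left; eapply Rlt_le_trans; [exact Hh|]; eapply Rle_trans; [apply Rmin_r|apply Rmin_r]. }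
assert (Ch : Cmod (RtoC h) = h) by (rewrite Cmod_R; apply Rabs_pos_eq; lra).
assert (D1 : norm (minus (minus (U h (Xe j)) (Xe j)) (scal (RtoC h) (g j))) <= eps / 2 * h).
{ specialize (H1 h (conj Hh0 Hhd)).
  change (norm (minus (scal (RtoC (/ h)) (minus (U h (Xe j)) (Xe j))) (g j)) < eps / 2) in H1.
  replace (minus (minus (U h (Xe j)) (Xe j)) (scal (RtoC h) (g j)))
    with (scal (RtoC h) (minus (scal (RtoC (/ h)) (minus (U h (Xe j)) (Xe j))) (g j))).
  - rewrite X_norm_scal_eq, Ch; nra.
  - apply X_ext; intros i; X_coords.
    transitivity (RtoC h * RtoC (/ h) * (U h (Xe j) i - Xe j i) - RtoC h * g j i)%C; [ring|].
    rewrite <- RtoC_mult, Rinv_r by lra; ring. }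
assert (D2 : norm (minus (minus (sg_col (RtoC h) j) (Xe j)) (scal (RtoC h) (g j)))
  <= eps / 2 * h).
{ rewrite <- (trunc_gen_Xe j j) by lia.
  eapply Rle_trans.
  - apply (exp_op_first_order _ _ (trunc_bound_ge_0 j) (trunc_gen_le j)); lra.
  - rewrite Ch, Xe_norm.
    replace (exp (trunc_bound j) * h ^ 2 * INR j) with (K * h * h) by (unfold K; ring).
    apply Rmult_le_compat_r; [lra|].
    apply Rle_trans with ((1 + K) * (eps / 2 / (1 + K))); [|right; field; lra].
    apply Rmult_le_compat; lra. }
pose proof (X_triangle_minus (minus (minus (sg_col (RtoC h) j) (Xe j)) (scal (RtoC h) (g j)))
  (minus (minus (U h (Xe j)) (Xe j)) (scal (RtoC h) (g j)))) as T.
match type of T with norm ?u <= _ =>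
  replace u with (minus (sg_col (RtoC h) j) (U h (Xe j))) in T by X_ring end.
lra.
Qed.

Lemma cone_q1_real s : 0 <= s -> cone q1 (RtoC s).
Proof. apply cone_real, q1_bounds. Qed.

(** The minimum of finitely many delta makes the estimate uniform on the span of the first J unit
    vectors. The telescoping sum needs it at the moving points [sg (k h) e_j], which stay in such a
    span. *)
Lemma sg_agrees_first_order J eps : 0 < eps ->
  exists delta, 0 < delta /\ forall h f, 0 < h < delta -> supported J f ->
    norm (minus (sg (RtoC h) f) (U h f)) <= eps * h * norm f.
Proof.
intros He.
assert (Common : exists delta, 0 < delta /\ forall h j, 0 < h < delta -> (1 <= j <= J)%nat ->
  norm (minus (sg_col (RtoC h) j) (U h (Xe j))) <= eps * h).
{ induction J as [|J' IH].
  - exists 1; split; [lra|]; intros; lia.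
  - destruct IH as (d1 & Hd1 & H1).
    destruct (sg_col_agrees_first_order (S J') eps) as (d2 & Hd2 & H2); [lia|exact He|].
    exists (Rmin d1 d2); split; [now apply Rmin_glb_lt|].
    intros h j Hh Hj; pose proof (Rmin_l d1 d2); pose proof (Rmin_r d1 d2).
    destruct (Nat.eq_dec j (S J')) as [->|N]; [apply H2; lra|apply H1; [lra|lia]]. }
destruct Common as (delta & Hd & H); exists delta; split; [exact Hd|].
intros h f Hh Hf.
assert (Hc : cone q1 (RtoC h)) by (apply cone_q1_real; lra).
assert (UL : is_linear (U h)) by (apply (proj1 U_C0); lra).
assert (Lin : is_linear (fun f => minus (sg (RtoC h) f) (U h f))).
{ apply (is_linear_minus_fun X_NormedModule X_NormedModule); [now apply sg_linear|exact UL]. }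
set (v j := minus (sg (RtoC h) (Xe j)) (U h (Xe j))).
assert (E : minus (sg (RtoC h) f) (U h f) = sum_n (fun j => scal (f j) (v j)) J).
{ transitivity ((fun f => minus (sg (RtoC h) f) (U h f)) (sum_n (fun j => scal (f j) (Xe j)) J)).
  - now rewrite <- (supported_expansion J f Hf).
  - etransitivity; [exact (linear_sum_n _ _ _ (fun j => scal (f j) (Xe j)) J Lin)|].
    apply sum_n_ext; intros j; exact (linear_scal _ Lin (f j) (Xe j)). }
rewrite E.
eapply Rle_trans; [apply X_norm_sum_n|].
apply Rle_trans with (sum_n (fun j => eps * h * (INR j * Cmod (f j))) J).
- apply sum_n_m_le; intros j; rewrite X_norm_scal_eq.
  destruct (excluded_middle_informative (1 <= j <= J)%nat) as [Hj|Hj].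
  + specialize (H h j Hh Hj); rewrite <- (sg_Xe _ _ Hc) in H; fold (v j) in H.
    pose proof (Cmod_ge_0 (f j)) as P; pose proof (le_INR 1 j (proj1 Hj)) as P1.
    change (INR 1) with 1 in P1.
    apply Rle_trans with (Cmod (f j) * (eps * h)); [now apply Rmult_le_compat_l|].
    replace (eps * h * (INR j * Cmod (f j))) with (Cmod (f j) * (eps * h) * INR j) by ring.
    rewrite <- (Rmult_1_r (Cmod (f j) * (eps * h))) at 1.
    apply Rmult_le_compat_l; [|exact P1].
    apply Rmult_le_pos; [exact P|]; apply Rmult_le_pos; lra.
  + replace (f j) with (RtoC 0).
    * rewrite Cmod_0, Rmult_0_l, !Rmult_0_r; apply Rle_refl.
    * symmetry; destruct (Nat.le_gt_cases j J); [|now apply Hf].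
      replace j with 0%nat by lia; apply X_coord_O.
- rewrite sum_n_Rmult_l; apply Rmult_le_compat_l; [apply Rmult_le_pos; lra|].
  apply sum_n_le_Series; [apply X_term_ge_0|apply XseqP].
Qed.

(** Each step of length h costs at most M eps h j, where M bounds [U] on [0, s]. The steps add up to
    s, so the total is s M j eps, with eps arbitrary. *)
Lemma sg_generated s f : 0 <= s -> sg (RtoC s) f = U s f.
Proof.
intros Hs.
assert (Hc := cone_q1_real s Hs).
apply (linear_ext X_NormedModule); [now apply sg_linear|now apply (proj1 U_C0)|].
intros j Hj; clear f.
destruct (C0_bounded_on_interval U U_C0 s) as (M & HM & BM).
set (K := s * M * INR j).
assert (K0 : 0 <= K) by (repeat apply Rmult_le_pos; [exact Hs|exact HM|apply pos_INR]).
assert (Q : forall eps, 0 < eps -> norm (minus (sg (RtoC s) (Xe j)) (U s (Xe j))) <= K * eps).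
{ intros eps He.
  destruct (sg_agrees_first_order j eps He) as (delta & Hd & HA).
  destruct Hs as [Hs|<-].
  2: { rewrite sg_zero, (proj1 (proj2 U_C0)).
       replace (minus (Xe j) (Xe j)) with (zero : X) by X_ring.
       change (X_norm X_zero <= K * eps); rewrite X_norm_zero; apply Rmult_le_pos; lra. }
  destruct (eventually_inv_S_le s (delta / 2)) as [N HN]; [lra|].
  specialize (HN N (Nat.le_refl N)).
  pose proof (inv_S_pos N) as Ip.
  set (h := / INR (S N) * s) in *.
  assert (Nh : INR (S N) * h = s).
  { unfold h; rewrite <- Rmult_assoc, Rinv_r; [ring|apply not_0_INR; lia]. }
  assert (Hh : 0 < h < delta) by (split; [now apply Rmult_lt_0_compat|lra]).
  (* The intermediate points of the telescoping sum: [sg] acts for time k h, then [U] for the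
     remaining time. *)
  assert (I : forall k, (k <= S N)%nat ->
    norm (minus (U (INR (S N - k) * h) (sg (RtoC (INR k * h)) (Xe j))) (U s (Xe j)))
      <= INR k * h * M * INR j * eps).
  { induction k as [|k IH]; intros Hk.
    - change (INR 0) with 0; rewrite !Rmult_0_l, sg_zero, Nat.sub_0_r, Nh.
      replace (minus (U s (Xe j)) (U s (Xe j))) with (zero : X) by X_ring.
      change (X_norm X_zero <= 0); rewrite X_norm_zero; lra.
    - specialize (IH ltac:(lia)).
      set (r := INR (S N - S k) * h).
      assert (R0 : 0 <= r) by (apply Rmult_le_pos; [apply pos_INR|lra]).
      assert (Rs : r <= s).
      { rewrite <- Nh; apply Rmult_le_compat_r; [lra|]; apply le_INR; lia. }
      assert (K1 : 0 <= INR k * h) by (apply Rmult_le_pos; [apply pos_INR|lra]).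
      replace (INR (S N - k) * h) with (r + h) in IH.
      2: { unfold r; replace (S N - k)%nat with (S (S N - S k)) by lia; rewrite S_INR; ring. }
      rewrite (proj1 (proj2 (proj2 U_C0))) in IH by lra.
      replace (RtoC (INR (S k) * h)) with (RtoC h + RtoC (INR k * h))%C
        by (rewrite <- RtoC_plus, S_INR; f_equal; ring).
      rewrite sg_plus by (apply cone_q1_real; lra).
      assert (Ck : cone q1 (RtoC (INR k * h))) by (apply cone_q1_real; lra).
      assert (Sup : supported j (sg (RtoC (INR k * h)) (Xe j))).
      { rewrite sg_Xe by exact Ck; apply trunc_exp_supported, supported_Xe; lia. }
      pose proof (sg_norm_le (RtoC (INR k * h)) (Xe j) Ck) as Nk; rewrite Xe_norm in Nk.
      set (y := sg (RtoC (INR k * h)) (Xe j)) in *.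
      pose proof (HA h y Hh Sup) as D.
      pose proof (BM r (minus (sg (RtoC h) y) (U h y)) (conj R0 Rs)) as D'.
      rewrite (linear_minus _ _ _ (proj1 U_C0 r R0)) in D'.
      pose proof (X_triangle (minus (U r (sg (RtoC h) y)) (U r (U h y)))
        (minus (U r (U h y)) (U s (Xe j)))) as T.
      match type of T with norm ?u <= _ =>
        replace u with (minus (U r (sg (RtoC h) y)) (U s (Xe j))) in T by X_ring end.
      assert (D2 : norm (minus (U r (sg (RtoC h) y)) (U r (U h y))) <= M * (eps * h * INR j)).
      { eapply Rle_trans; [exact D'|]; apply Rmult_le_compat_l; [exact HM|].
        eapply Rle_trans; [exact D|]; apply Rmult_le_compat_l; [|exact Nk].
        apply Rmult_le_pos; lra. }
      rewrite S_INR; lra. }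
  specialize (I (S N) (Nat.le_refl _)).
  rewrite Nat.sub_diag, Nh in I; change (INR 0) with 0 in I.
  rewrite Rmult_0_l, (proj1 (proj2 U_C0)) in I; exact I. }
apply X_eq_of_lim with (fun n => K * / INR (S n)).
- intros n; apply Q, inv_S_pos.
- replace (Finite 0) with (Finite (K * 0)) by (f_equal; ring).
  apply (is_lim_seq_scal_l _ K (Finite 0)), is_lim_seq_inv_S.
Qed.

End Generated.

(** Dissipativity read backwards: norm f <= norm (f + h G f) + h norm (G f), where the first term is
    at most norm f - gap h [weighted_norm J f]. Thus G f controls the weighted norm, through which
    smoothing reaches the tails. *)
Lemma weighted_norm_le J f : gap * weighted_norm J f <= norm (trunc_gen J f).
Proof.
pose proof (trunc_eta_pos J) as E0.
set (h := trunc_eta J) in *.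
assert (Ch : Cmod (RtoC h) = h) by (rewrite Cmod_R; apply Rabs_pos_eq; lra).
pose proof (trunc_dissipative_weighted J (RtoC h) f
  (cone_real q1 h (proj2 q1_bounds) (Rlt_le _ _ E0)) (Req_le _ _ Ch)) as D.
rewrite Ch in D.
assert (T : norm f <= norm (plus f (scal (RtoC h) (trunc_gen J f)))
  + h * norm (trunc_gen J f)).
{ rewrite <- Ch at 2; rewrite <- X_norm_scal_eq.
  eapply Rle_trans; [|apply X_triangle_minus].
  right; f_equal; X_ring. }
apply (Rmult_le_reg_l h); [exact E0|lra].
Qed.

Lemma cut_le_weighted_norm m N J f : 0 < m -> (forall i, (N < i)%nat -> m <= t i) ->
  supported J f -> norm (cut N f) <= / m * weighted_norm J f.
Proof.
intros Hm Ht Hf; unfold weighted_norm; rewrite <- Series_scal_l.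
apply Series_le; [|apply ex_series_Rscal, ex_series_weighted].
intros i; split; [apply X_term_ge_0|].
assert (P : 0 <= Cmod (f i) * trunc_weight J i).
{ apply Rmult_le_pos; [apply Cmod_ge_0|].
  destruct (excluded_middle_informative (1 <= i <= J)%nat) as [H|H].
  - rewrite trunc_weight_in by exact H.
    apply Rmult_le_pos; [left; apply t_pos; lia|apply pos_INR].
  - rewrite trunc_weight_out by exact H; lra. }
assert (I : 0 < / m) by now apply Rinv_0_lt_compat.
destruct (Nat.le_gt_cases i N) as [H|H].
- rewrite cut_low, Cmod_0, Rmult_0_r by exact H; apply Rmult_le_pos; lra.
- rewrite cut_high by exact H; destruct (Nat.le_gt_cases i J) as [HJ|HJ].
  + rewrite trunc_weight_in by lia; specialize (Ht i H).
    replace (INR i * Cmod (f i)) with (/ m * (Cmod (f i) * (m * INR i))) by (field; lra).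
    apply Rmult_le_compat_l; [lra|]; apply Rmult_le_compat_l; [apply Cmod_ge_0|].
    apply Rmult_le_compat_r; [apply pos_INR|exact Ht].
  + rewrite Hf, Cmod_0, Rmult_0_r by exact HJ.
    rewrite Hf, Cmod_0 in P by exact HJ; apply Rmult_le_pos; lra.
Qed.

Lemma sg_small_tails s eps : 0 < s -> 0 < eps ->
  (forall m, exists N, forall n, (N <= n)%nat -> m <= t n) ->
  exists N, forall f, norm (cut N (sg (RtoC s) f)) <= eps * norm f.
Proof.
intros Hs He Ht.
pose proof c1_pos as C0; pose proof gap_pos as G0.
assert (P : 0 < gap * (c1 * s)) 
  by (apply Rmult_lt_0_compat; [exact G0|now apply Rmult_lt_0_compat]).
(* With W the weighted norm and y = [sg_col s j], the chain tail <= W / m, gap W <= norm (G y), c1 s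
   norm (G y) <= j then ends in eps j. *)
set (m := / (eps * (gap * (c1 * s)))).
assert (Hm : 0 < m) by (apply Rinv_0_lt_compat, Rmult_lt_0_compat; assumption).
destruct (Ht m) as [N HN]; exists N; intros f.
assert (Hc := cone_q1_real s (Rlt_le _ _ Hs)).
apply (linear_norm_le X_NormedModule (fun f => cut N (sg (RtoC s) f))).
{ exact (is_linear_comp _ _ (sg_linear _ Hc) (cut_linear N)). }
intros j Hj; rewrite sg_Xe by exact Hc.
assert (Sup : supported j (sg_col (RtoC s) j)) by (apply trunc_exp_supported, supported_Xe; lia).
eapply Rle_trans.
{ apply (cut_le_weighted_norm m N j); [exact Hm| |exact Sup].
  intros i Hi; apply HN; lia. }
pose proof (weighted_norm_le j (sg_col (RtoC s) j)) as W.
pose proof (trunc_exp_smoothing j (RtoC s) (Xe j) Hc) as Sm; fold (sg_col (RtoC s) j) in Sm.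
rewrite Xe_norm, Cmod_R, Rabs_pos_eq in Sm by lra.
unfold m; rewrite Rinv_inv, Rmult_assoc; apply Rmult_le_compat_l; [lra|].
eapply Rle_trans; [|exact Sm].
replace (gap * (c1 * s) * weighted_norm j (sg_col (RtoC s) j))
  with (c1 * s * (gap * weighted_norm j (sg_col (RtoC s) j))) by ring.
apply Rmult_le_compat_l; [|exact W]; apply Rmult_le_pos; lra.
Qed.

Theorem triangular_semigroup (U : R -> X -> X) :
  C0_semigroup U -> (forall j, (1 <= j)%nat -> generator U (Xe j) (g j)) ->
  analytic_semigroup U /\
  ((forall m, exists N, forall n, (N <= n)%nat -> m <= t n) -> immediately_compact U).
Proof.
intros HU HG; split.
- apply sg_analytic; intros s f; now apply sg_generated.
- intros Ht s Hs; apply compact_of_small_tails; [apply (proj1 HU); lra|].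
  intros eps He; destruct (sg_small_tails s eps Hs He Ht) as [N HN].
  exists N; intros f; rewrite <- (sg_generated U HU HG) by lra; apply HN.
Qed.

End Triangular.

(** * The decay-fragmentation generator *)

Lemma Series_single (u : nat -> R) k0 : (forall k, k <> k0 -> u k = 0) -> Series u = u k0.
Proof.
intros Z; apply is_series_unique.
rewrite <- (sum_n_single R_AbelianMonoid u k0 k0 Z (Nat.le_refl k0)).
apply (is_series_finite R_AbsRing R_NormedModule); intros k Hk; apply Z; lia.
Qed.

Lemma CSeries_single (u : nat -> C) k0 :
  (forall k, k <> k0 -> u k = RtoC 0) -> CSeries u = u k0.
Proof.
intros Z; unfold CSeries.
rewrite (Series_single _ k0), (Series_single (fun k => Im (u k)) k0).
- now destruct (u k0).
- intros k Hk; now rewrite Z.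
- intros k Hk; now rewrite Z.
Qed.

Section DecayFragmentation.

Context (r d a : nat -> R) (b : nat -> nat -> R).
Context (r_pos : forall i, (1 <= i)%nat -> 0 < r i)
  (d_nonneg : forall i, (1 <= i)%nat -> 0 <= d i)
  (a_1 : a 1%nat = 0)
  (a_pos : forall i, (2 <= i)%nat -> 0 < a i)
  (b_nonneg : forall i j, (1 <= i)%nat -> (1 <= j)%nat -> 0 <= b i j)
  (b_mass : forall j, (2 <= j)%nat ->
     sum_n_m (fun i => INR i * b i j) 1 (j - 1) = INR j).

Lemma a_nonneg i : (1 <= i)%nat -> 0 <= a i.
Proof.
intros H; destruct (Nat.eq_dec i 1) as [->|N]; [rewrite a_1; lra|].
left; apply a_pos; lia.
Qed.

Lemma theta_pos j : (1 <= j)%nat -> 0 < theta r a d j.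
Proof.
intros H; unfold theta; pose proof (r_pos j H); pose proof (d_nonneg j H).
pose proof (a_nonneg j H); lra.
Qed.

Definition frag_entry (j i : nat) : C := if (i <? j)%nat then RtoC (a j * b i j) else RtoC 0.

Lemma frag_op_Xe j i : (1 <= i)%nat -> frag_op a b (Xe j) i = frag_entry j i.
Proof.
intros Hi; destruct i as [|i]; [lia|].
unfold frag_op, frag_entry.
(* The summation index k stands for column i + 1 + k. If column j is not reached, the subtraction
   truncates to 0, where the term vanishes as well. *)
rewrite (CSeries_single _ (j - (S i + 1))).
- destruct (Nat.ltb_spec (S i) j) as [H|H]; cbv zeta.
  + replace (S i + 1 + (j - (S i + 1)))%nat with j by lia.
    change (Xe j j) with (unit_seq j j); rewrite unit_seq_diag by lia; ring.
  + change (Xe j (S i + 1 + (j - (S i + 1)))%nat)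
      with (unit_seq j (S i + 1 + (j - (S i + 1)))%nat).
    rewrite unit_seq_neq by lia; ring.
- intros k Hk; cbv zeta.
  change (Xe j (S i + 1 + k)%nat) with (unit_seq j (S i + 1 + k)%nat).
  rewrite unit_seq_neq by lia; ring.
Qed.

Definition gen_col_seq (j i : nat) : C := (decay_op r a d (Xe j) i + frag_op a b (Xe j) i)%C.

Lemma gen_col_seq_pos j i : (1 <= i)%nat -> gen_col_seq j i =
  (RtoC (r (S i)) * unit_seq j (S i) - RtoC (theta r a d i) * unit_seq j i + frag_entry j i)%C.
Proof.
intros Hi; unfold gen_col_seq; rewrite frag_op_Xe by exact Hi.
destruct i as [|i]; [lia|reflexivity].
Qed.

Lemma gen_col_seq_upper j i : (j < i)%nat -> gen_col_seq j i = RtoC 0.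
Proof.
intros H; rewrite gen_col_seq_pos, !unit_seq_neq by lia; unfold frag_entry.
destruct (Nat.ltb_spec i j); [lia|ring].
Qed.

Lemma gen_col_seq_O j : gen_col_seq j 0 = RtoC 0.
Proof. unfold gen_col_seq; simpl; ring. Qed.

Definition gen_col (j : nat) : X :=
  mkX (gen_col_seq j) (inX_finite _ j (gen_col_seq_O j) (gen_col_seq_upper j)).

Lemma decay_domain_Xe j : decay_domain r a d (Xe j).
Proof.
assert (Z : forall x i, (j < i)%nat -> seqmul x (Xe j) i = RtoC 0).
{ intros x i Hi; unfold seqmul; change (Xe j i) with (unit_seq j i).
  rewrite unit_seq_neq by lia; ring. }
split; [|split].
- apply inX_finite with j; [|apply Z].
  unfold seqmul; rewrite X_coord_O; ring.
(* Taking differences enlarges the support by one index. *)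
- apply inX_finite with (S j); [reflexivity|].
  intros i Hi; destruct i as [|[|i]]; [lia|lia|].
  unfold Defs.triangle; rewrite !Z by lia; ring.
- apply filterlim_ext_loc with (fun _ => RtoC 0); [|apply filterlim_const].
  exists (S j); intros i Hi; symmetry; apply Z; lia.
Qed.

Lemma gen_col_graph j : decay_frag_graph r a d b (Xe j) (gen_col j).
Proof. split; [apply decay_domain_Xe|reflexivity]. Qed.

Lemma gen_col_generator (U : R -> X -> X) j :
  closure_generates (decay_frag_graph r a d b) U -> generator U (Xe j) (gen_col j).
Proof.
intros [_ H]; apply H; intros eps He; exists (Xe j), (gen_col j).
assert (Z : forall f : X, norm (minus f f) < eps).
{ intros f; replace (minus f f) with (zero : X) by X_ring.
  change (X_norm X_zero < eps); now rewrite X_norm_zero. }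
split; [apply gen_col_graph|split; apply Z].
Qed.

(** Adding theta_j e_j cancels the diagonal and leaves nonnegative entries. For j = 1 the entry r_1
    would fall on index 0, which carries no coordinate. *)
Lemma gen_col_off_entry j i : (1 <= j)%nat -> (1 <= i)%nat ->
  (plus (gen_col j) (scal (RtoC (theta r a d j)) (Xe j)) : X) i =
  RtoC ((if (S i =? j)%nat then r j else 0) + (if (i <? j)%nat then a j * b i j else 0)).
Proof.
intros Hj Hi; X_coords.
change (gen_col j i) with (gen_col_seq j i); change (Xe j i) with (unit_seq j i).
rewrite gen_col_seq_pos by exact Hi; unfold frag_entry.
destruct (Nat.eqb_spec (S i) j) as [E|E].
- rewrite <- E, unit_seq_diag, unit_seq_neq by lia.
  destruct (Nat.ltb_spec i (S i)); [|lia]; rewrite RtoC_plus; ring.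
- rewrite (unit_seq_neq j (S i)) by exact E.
  destruct (Nat.ltb_spec i j).
  + rewrite unit_seq_neq, RtoC_plus by lia; ring.
  + destruct (Nat.eq_dec i j) as [->|N]; [rewrite unit_seq_diag by lia|rewrite unit_seq_neq by lia];
      rewrite RtoC_plus; ring.
Qed.

(** The entry r_j sits at index j - 1 and so has weight j - 1; the fragments a_j b_{i,j} weigh j a_j
    in total by conservation of mass. *)
Lemma gen_col_off_norm j : (1 <= j)%nat ->
  norm (plus (gen_col j) (scal (RtoC (theta r a d j)) (Xe j)))
  <= INR (j - 1) * r j + INR j * a j.
Proof.
intros Hj; set (f := plus (gen_col j) (scal (RtoC (theta r a d j)) (Xe j)) : X).
assert (Ent : forall i, INR i * Cmod (f i) <=
  (if (S i =? j)%nat then INR (j - 1) * r j else 0)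
  + (if (i <? j)%nat then a j * (INR i * b i j) else 0)).
{ intros [|i].
  - rewrite X_coord_O, Cmod_0, Rmult_0_r; simpl INR at 2; rewrite Rmult_0_l, Rmult_0_r.
    pose proof (r_pos j Hj); pose proof (pos_INR (j - 1)).
    destruct (1 =? j)%nat, (0 <? j)%nat; nra.
  - unfold f; rewrite gen_col_off_entry by lia; rewrite Cmod_R, Rabs_pos_eq.
    + destruct (Nat.eqb_spec (S (S i)) j) as [E|E].
      * replace (j - 1)%nat with (S i) by lia.
        destruct (S i <? j)%nat; right; ring.
      * destruct (S i <? j)%nat; right; ring.
    + pose proof (r_pos j Hj); pose proof (a_nonneg j Hj).
      pose proof (b_nonneg (S i) j ltac:(lia) Hj).
      destruct (S (S i) =? j)%nat, (S i <? j)%nat; nra. }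
assert (Sm : Series (fun i => if (S i =? j)%nat then INR (j - 1) * r j else 0)
  = INR (j - 1) * r j).
{ rewrite (Series_single _ (j - 1)).
  - now replace (S (j - 1)) with j by lia; rewrite Nat.eqb_refl.
  - intros k Hk; destruct (Nat.eqb_spec (S k) j); [lia|reflexivity]. }
assert (E1 : ex_series (fun i => if (S i =? j)%nat then INR (j - 1) * r j else 0)).
{ eexists; apply (is_series_finite R_AbsRing R_NormedModule) with (J := j).
  intros k Hk; destruct (Nat.eqb_spec (S k) j); [lia|reflexivity]. }
assert (Hv : is_series (fun i => if (i <? j)%nat then a j * (INR i * b i j) else 0)
  (INR j * a j)).
{ replace (INR j * a j) with
    (sum_n (fun i => if (i <? j)%nat then a j * (INR i * b i j) else 0) (j - 1)).
  - apply (is_series_finite R_AbsRing R_NormedModule).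
    intros k Hk; destruct (Nat.ltb_spec k j); [lia|reflexivity].
  - transitivity (sum_n (fun i => a j * (INR i * b i j)) (j - 1)).
    { apply sum_n_m_ext_loc; intros k Hk; destruct (Nat.ltb_spec k j); [reflexivity|lia]. }
    (* Conservation of mass is available from j = 2 on; at j = 1 both sides vanish because a_1 =
       0. *)
    rewrite sum_n_Rmult_l; destruct (Nat.eq_dec j 1) as [->|N1].
    + rewrite a_1; Rring.
    + unfold sum_n; rewrite sum_Sn_m, b_mass by lia.
      change (INR 0 * b 0%nat j) with (0 * b 0%nat j); rewrite Rmult_0_l.
      change (a j * (0 + INR j) = INR j * a j); ring. }
change (norm f) with (Series (fun i => INR i * Cmod (f i))).
rewrite <- Sm, <- (is_series_unique _ _ Hv), <- Series_plus;
  [|exact E1|eexists; exact Hv].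
apply Series_le.
- intros i; split; [apply X_term_ge_0|apply Ent].
- exact (ex_series_plus _ _ E1 (ex_intro _ _ Hv)).
Qed.

(** * One domination constant for all columns *)

Context (p_ge_r : exists K, 0 < K /\ forall n, (1 <= n)%nat -> d n + a n >= K * r n)
  (d_eventually_pos : eventually (fun n => 0 < d n))
  (limsup_finite : Rbar_lt (LimSup_seq (fun n => a n / d n)) p_infty).

Definition dominated (kappa : R) (j : nat) : Prop :=
  INR (j - 1) * r j + INR j * a j <= kappa * theta r a d j * INR j.

Lemma dominated_mono k k' j : (1 <= j)%nat -> k <= k' -> dominated k j -> dominated k' j.
Proof.
unfold dominated; intros Hj Hk H; eapply Rle_trans; [exact H|].
apply Rmult_le_compat_r; [apply pos_INR|].
apply Rmult_le_compat_r; [left; now apply theta_pos|exact Hk].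
Qed.

(** The product theta_j j exceeds the off-diagonal weight by r_j + j d_j, which is positive even if
    d_j = 0, so the quotient of the two can serve as the constant. *)
Lemma dominated_each j : (1 <= j)%nat -> exists k, 0 <= k < 1 /\ dominated k j.
Proof.
intros Hj; pose proof (theta_pos j Hj) as T; pose proof (r_pos j Hj) as Rp.
pose proof (d_nonneg j Hj) as Dp; pose proof (a_nonneg j Hj) as Ap.
assert (J1 : INR j = INR (j - 1) + 1) by (rewrite <- S_INR; f_equal; lia).
pose proof (pos_INR (j - 1)) as J0.
assert (TJ : 0 < theta r a d j * INR j) by (apply Rmult_lt_0_compat; lra).
exists ((INR (j - 1) * r j + INR j * a j) / (theta r a d j * INR j)); repeat split.
- apply Rdiv_le_0_compat; [nra|exact TJ].
- apply (Rmult_lt_reg_r (theta r a d j * INR j)); [exact TJ|].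
  unfold Rdiv; rewrite Rmult_assoc, Rinv_l, Rmult_1_r, Rmult_1_l by lra.
  unfold theta; rewrite J1; nra.
- unfold dominated; right; field; lra.
Qed.

Lemma ratio_bounded : exists L, 0 <= L /\ eventually (fun n => a n <= L * d n).
Proof.
assert (B : exists L, eventually (fun n => a n / d n < L)).
{ revert limsup_finite; unfold LimSup_seq.
  destruct (ex_LimSup_seq (fun n => a n / d n)) as [[l| |] H]; simpl; intros F.
  - exists (l + 1); destruct (H (mkposreal 1 Rlt_0_1)) as [_ [N HN]]; now exists N.
  - contradiction.
  - exists 0; destruct (H 0) as [N HN]; now exists N. }
destruct B as [L HL]; exists (Rmax 0 L); split; [apply Rmax_l|].
generalize (filter_and _ _ HL d_eventually_pos); apply filter_imp; intros n [H1 H2].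
replace (a n) with (a n / d n * d n) by (field; lra).
apply Rmult_le_compat_r; [lra|]; eapply Rle_trans; [left; exact H1|apply Rmax_r].
Qed.

(** theta = r + a + d <= (1 + 1/K) (a + d) <= D d with D = (1 + 1/K) (1 + L), so that r + a = theta
    - d <= (1 - 1/D) theta. *)
Lemma dominated_eventually :
  exists k N, 0 <= k < 1 /\ forall j, (1 <= j)%nat -> (N <= j)%nat -> dominated k j.
Proof.
destruct ratio_bounded as (L & HL & N & HN), p_ge_r as (K & HK & HP).
assert (K0 : 0 < / K) by now apply Rinv_0_lt_compat.
set (D := (1 + / K) * (1 + L)).
assert (D1 : 1 <= D) by (unfold D; nra).
assert (D2 : 0 < / D <= 1).
{ split; [apply Rinv_0_lt_compat; lra|].
  rewrite <- Rinv_1; apply Rinv_le_contravar; lra. }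
exists (1 - / D), N; split; [lra|]; intros j Hj Hn.
pose proof (theta_pos j Hj) as T; pose proof (r_pos j Hj) as Rp.
pose proof (d_nonneg j Hj) as Dp; pose proof (a_nonneg j Hj) as Ap.
specialize (HN j Hn); specialize (HP j Hj).
assert (R1 : r j <= / K * (a j + d j)).
{ replace (r j) with (/ K * (K * r j)) by (field; lra).
  apply Rmult_le_compat_l; lra. }
assert (T1 : theta r a d j <= D * d j) by (unfold theta, D; nra).
assert (T2 : / D * theta r a d j <= d j).
{ apply Rle_trans with (/ D * (D * d j)); [apply Rmult_le_compat_l; lra|].
  right; field; lra. }
assert (J1 : INR j = INR (j - 1) + 1) by (rewrite <- S_INR; f_equal; lia).
pose proof (pos_INR (j - 1)) as J0.
assert (T3 : r j + a j <= (1 - / D) * theta r a d j) by (unfold theta in *; lra).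
unfold dominated; apply Rle_trans with ((r j + a j) * INR j); [nra|].
apply Rmult_le_compat_r; [lra|exact T3].
Qed.

(** The finitely many columns before the eventual bound each have a constant below 1, and so has
    their maximum with the eventual one. *)
Lemma dominated_uniform : exists k, 0 <= k < 1 /\ forall j, (1 <= j)%nat -> dominated k j.
Proof.
destruct dominated_eventually as (k1 & N & H1 & E1).
assert (F : exists k, 0 <= k < 1 /\ forall j, (1 <= j < N)%nat -> dominated k j).
{ clear E1; induction N as [|N (k & Hk & IH)].
  - exists 0; split; [lra|intros; lia].
  - destruct (Nat.eq_dec N 0) as [->|N0].
    + exists 0; split; [lra|intros; lia].
    + destruct (dominated_each N) as (k' & Hk' & D); [lia|].
      exists (Rmax k k'); split.
      * split; [eapply Rle_trans; [apply Hk|apply Rmax_l]|apply Rmax_lub_lt; lra].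
      * intros j Hj; destruct (Nat.eq_dec j N) as [->|Nj].
        -- apply dominated_mono with k'; [lia|apply Rmax_r|exact D].
        -- apply dominated_mono with k; [lia|apply Rmax_l|apply IH; lia]. }
destruct F as (k & Hk & F); exists (Rmax k k1); split.
- split; [eapply Rle_trans; [apply Hk|apply Rmax_l]|apply Rmax_lub_lt; lra].
- intros j Hj; destruct (Nat.le_gt_cases N j) as [H|H].
  + apply dominated_mono with k1; [exact Hj|apply Rmax_r|now apply E1].
  + apply dominated_mono with k; [exact Hj|apply Rmax_l|apply F; lia].
Qed.

End DecayFragmentation.

Theorem theorem2p11 (r d a : nat -> R) (b : nat -> nat -> R)
  (r_pos : forall i, (1 <= i)%nat -> 0 < r i)
  (d_nonneg : forall i, (1 <= i)%nat -> 0 <= d i)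
  (a_1 : a 1%nat = 0)
  (a_pos : forall i, (2 <= i)%nat -> 0 < a i)
  (b_nonneg : forall i j, (1 <= i)%nat -> (1 <= j)%nat -> 0 <= b i j)
  (b_upper : forall i j, (1 <= i)%nat -> (1 <= j)%nat -> (j <= i)%nat -> b i j = 0)
  (b_mass : forall j, (2 <= j)%nat ->
     sum_n_m (fun i => INR i * b i j) 1 (j - 1) = INR j)
  (S_G : R -> X -> X)
  (S_G_generated : closure_generates (decay_frag_graph r a d b) S_G)
  (p_ge_r : exists K, 0 < K /\ forall n, (1 <= n)%nat -> d n + a n >= K * r n)
  (d_eventually_pos : eventually (fun n => 0 < d n))
  (limsup_finite : Rbar_lt (LimSup_seq (fun n => a n / d n)) p_infty) :
  analytic_semigroup S_G /\
  (LimInf_seq (theta r a d) = p_infty -> immediately_compact S_G).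
Proof.
destruct (dominated_uniform r d a r_pos d_nonneg a_1 a_pos p_ge_r d_eventually_pos
  limsup_finite) as (kappa & Hk & Dom).
destruct (triangular_semigroup (gen_col r d a b) (theta r a d) kappa Hk) with (U := S_G)
  as [An Co].
- intros j Hj; now apply theta_pos.
- apply gen_col_seq_upper.
- intros j Hj; eapply Rle_trans; [now apply gen_col_off_norm|now apply Dom].
- apply S_G_generated.
- intros j Hj; now apply gen_col_generator.
- split; [exact An|]; intros HL; apply Co; intros m.
  revert HL; unfold LimInf_seq.
  destruct (ex_LimInf_seq (theta r a d)) as [l H]; simpl; intros ->.
  destruct (H m) as [N HN]; exists N; intros n Hn; left; now apply HN.
Qed.
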